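(* Let $\mathbf H_N$ be a UCI matrix and write $\mathcal S_{\theta_i}=\{\xi_{i,1},\dots,\xi_{i,m_i}\}$ for $1\le i\le j$. Then, for every small enough $\delta>0$, with probability tending to one as $N\to\infty$, the matrix $\widetilde{\mathbf H}_N=\mathbf H_N+\mathbf A_N$ possesses exactly $\sum_{i=1}^{j}k_i m_i$ eigenvalues (counted with algebraic multiplicity) in $\{z\in\mathbb C:\ \operatorname{dist}(z,\operatorname{supp}(\mu))>\delta\}$. More precisely, after a proper labeling, these eigenvalues are $\widetilde\lambda_{i,n,l}$, $1\le i\le j$, $1\le n\le m_i$, $1\le l\le k_i$, and they satisfy $$\widetilde\lambda_{i,n,l}=\xi_{i,n}+o(1)\qquad\text{for all } i\in\{1,\dots,j\},\ n\in\{1,\dots,m_i\},\ l\in\{1,\dots,k_i\},$$ where $o(1)$ denotes a quantity tending to $0$ in probability as $N\to\infty$.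
   Context: A UCI (Unitary Conjugation Invariant) matrix is a random $N\times N$ Hermitian matrix $\mathbf H_N$ (one for each $N\ge1$) such that: (i) for every $N\times N$ unitary matrix $\mathbf V$, $\mathbf V\mathbf H_N\mathbf V^*$ has the same distribution as $\mathbf H_N$; (ii) its empirical spectral measure $\frac1N\sum_{i=1}^N\delta_{\lambda_i(\mathbf H_N)}$ converges weakly in probability, as $N\to\infty$, to a compactly supported probability measure $\mu$ on $\mathbb R$, which is not a single Dirac measure; (iii) $\sup_{\lambda\in\operatorname{Spec}(\mathbf H_N)}\operatorname{dist}(\lambda,\operatorname{supp}(\mu))\to0$ in probability as $N\to\infty$. $r\ge1$ is a fixed integer. For each $N$, $\mathbf A_N$ is a random $N\times N$ complex matrix (not necessarily Hermitian), independent of $\mathbf H_N$, of rank at most $r$, of the form $\mathbf A_N=\mathbf U_{2r}\mathbf A_0\mathbf U_{2r}^*$, where $\mathbf A_0$ is a deterministic $2r\times2r$ complex matrix not depending on $N$ and $\mathbf U_{2r}$ is the $N\times 2r$ matrix formed by the first $2r$ columns of an $N\times N$ unitary matrix. $G_\mu(z)=\int\frac{\mu(dx)}{z-x}$. The distinct non-zero eigenvalues of $\mathbf A_0$ are $\theta_1,\dots,\theta_j$, and $k_i$ is the algebraic multiplicity of $\theta_i$. For each $i$, $\mathcal S_{\theta_i}=\{\xi\in\mathbb C\setminus\operatorname{supp}(\mu):\ G_\mu(\xi)=1/\theta_i\}$, taken to be a finite, possibly empty, set, and $m_i=\operatorname{Card}\mathcal S_{\theta_i}$.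
   Formalization: The solutions ξ_{i,1},…,ξ_{i,m_i} of G_μ(ξ)=1/θ_i are listed with multiplicity (order of the zero of G_μ−1/θ_i), so m_i is Card S_{θ_i} only if all are simple; with distinct points the claim fails, e.g. μ=(δ_{-1}+δ_1)/2, θ=2i, double solution i. *)

(* Defs.v *)
From HB Require Import structures.
From mathcomp Require Import all_boot all_order all_algebra.
From mathcomp Require Import spectral sesquilinear complex.
From mathcomp Require Import all_classical all_reals all_analysis.

Set Implicit Arguments.
Unset Strict Implicit.
Unset Printing Implicit Defensive.

Import Order.TTheory GRing.Theory Num.Theory.
Import numFieldNormedType.Exports.

Local Open Scope classical_set_scope.
Local Open Scope ring_scope.
Local Open Scope complex_scope.
Local Open Scope sesquilinear_scope.

(* The N-th random object may live on its own probability space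
   (T N, P N), as every limit below is a limit in probability.

   P N (E N) --> 1 is read through measurable subsets F N of E N, because
   the library's measures carry no information on non-measurable sets.
   For measurable E N this is equivalent to P N (E N) --> 1. *)
Definition with_high_probability {R : realType} {d : nat -> measure_display}
    {T : forall N, measurableType (d N)} (P : forall N, probability (T N) R)
    (E : forall N, set (T N)) : Prop :=
  exists F : forall N, set (T N),
    [/\ forall N, measurable (F N),
        forall N, F N `<=` E N
      & P N (F N) @[N --> \oo] --> 1%E].

(* [dst N w] is the distance to the limit. *)
Definition tends_to0_in_probability {R : realType} {d : nat -> measure_display}
    {T : forall N, measurableType (d N)} (P : forall N, probability (T N) R)
    (dst : forall N, T N -> R) : Prop :=
  forall e : R, 0 < e ->
    with_high_probability P (fun N => [set w | dst N w < e]).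

Section ComplexMatrices.
Context {R : realType}.
Local Notation C := R[i].

Definition cmod (z : C) : R := complex.Re `|z|.

(* dist (z, S), for S nonempty *)
Definition cdist (z : C) (S : set C) : R := inf [set cmod (z - s) | s in S].

(* The roots of the characteristic polynomial, repeated according to algebraic
   multiplicity; the order in the sequence is irrelevant. *)
Definition eigenvals {N : nat} (M : 'M[C]_N) : seq C :=
  sval (closed_field_poly_normal (char_poly M)).

(* Generators of the Borel sigma-algebra of the space of N x N complex
   matrices, seen as a real vector space of dimension 2 N^2. *)
Definition mx_gen (N : nat) : set (set 'M[C]_N) :=
  [set A | exists (i j : 'I_N) (B : set (measurableTypeR R)), measurable B /\
     (A = [set M : 'M[C]_N | B (complex.Re (M i j))] \/
      A = [set M : 'M[C]_N | B (complex.Im (M i j))])].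

Definition mx_borel (N : nat) : set (set 'M[C]_N) := <<s @mx_gen N >>.

Definition random_mx {d : measure_display} {T : measurableType d} {N : nat}
    (X : T -> 'M[C]_N) : Prop :=
  forall B, mx_borel B -> measurable (X @^-1` B).

Definition same_law {d : measure_display} {T : measurableType d}
    (P : probability T R) {N : nat} (X Y : T -> 'M[C]_N) : Prop :=
  forall B, mx_borel B -> P (X @^-1` B) = P (Y @^-1` B).

Definition independent_mx {d : measure_display} {T : measurableType d}
    (P : probability T R) {N : nat} (X Y : T -> 'M[C]_N) : Prop :=
  forall B B', mx_borel B -> mx_borel B' ->
    P (X @^-1` B `&` Y @^-1` B') = (P (X @^-1` B) * P (Y @^-1` B'))%E.

(* The eigenvalues of a Hermitian matrix are real; Re only changes the type. *)
Definition empirical_spectral_measure {N : nat} (M : 'M[C]_N) :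
    {measure set (measurableTypeR R) -> \bar R} :=
  mscale ((N%:R : R)^-1)%:nng
    (msum (fun i : nat =>
       dirac (complex.Re (nth 0 (eigenvals M) i) : measurableTypeR R)) N).

End ComplexMatrices.

Section LimitMeasure.
Context {R : realType}.
Local Notation C := R[i].
Implicit Type mu : probability (measurableTypeR R) R.

Definition msupp mu : set R :=
  [set x | forall e : R, 0 < e -> (0 < mu (ball x e))%E].

Definition csupp mu : set C := [set x%:C | x in msupp mu].

(* G_mu (z) = \int mu(dx) / (z - x) *)
Definition cauchy_transform mu (z : C) : C :=
  Rintegral mu setT (fun x : R => complex.Re ((z - x%:C)^-1)) +i*
  Rintegral mu setT (fun x : R => complex.Im ((z - x%:C)^-1)).

Definition outlier_set mu (theta : C) : set C :=
  [set z | ~ csupp mu z /\ cauchy_transform mu z = theta^-1].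

Definition vanishes_to_order (f : C -> C) (z : C) (p : nat) : Prop :=
  exists2 c : C, c != 0 &
    forall e : R, 0 < e -> exists2 h : R, 0 < h &
      forall w : C, 0 < cmod (w - z) < h ->
        cmod (f w / (w - z) ^+ p - c) < e.

(* xi lists the (finite) set outlier_set mu theta, each solution z being
   repeated according to its order as a zero of G_mu - 1 / theta.
   Non-real solutions can be multiple: for mu = (dirac (-1) + dirac 1) / 2 and
   theta = 2i the only solution is i, of order 2, and it attracts two
   eigenvalues of the deformed matrix. If all solutions are simple, then xi is
   injective and m is the cardinal of outlier_set mu theta. *)
Definition lists_outliers mu (theta : C) (m : nat) (xi : 'I_m -> C) : Prop :=
  [set xi n | n in [set: 'I_m]] = outlier_set mu theta /\
  forall n : 'I_m,
    vanishes_to_order (fun w => cauchy_transform mu w - theta^-1) (xi n)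
      #|[pred n' | xi n' == xi n]|.

End LimitMeasure.

Record UCI {R : realType} {d : nat -> measure_display}
    {T : forall N, measurableType (d N)} (P : forall N, probability (T N) R)
    (H : forall N, T N -> 'M[R[i]]_N)
    (mu : probability (measurableTypeR R) R) : Prop := {
  UCI_random : forall N, random_mx (H N);
  UCI_hermitian : forall N w, H N w \is hermsymmx;
  UCI_invariant : forall N (V : 'M[R[i]]_N), V \is unitarymx ->
    same_law (P N) (fun w => V *m H N w *m V^t*) (H N);
  UCI_compact : compact (msupp mu);
  UCI_not_dirac : ~ exists a : measurableTypeR R,
    forall B, measurable B -> mu B = dirac a B;
  UCI_spectral_measure : forall f : R -> R, continuous f ->
    (exists K : R, forall x, `|f x| <= K) ->
    tends_to0_in_probability P (fun N w =>
      `| Rintegral (empirical_spectral_measure (H N w)) setT f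
         - Rintegral mu setT f |);
  UCI_no_outlier :
    tends_to0_in_probability P (fun N w =>
      \big[Num.max/0]_(l <- eigenvals (H N w)) cdist l (csupp mu))
}.

(* There is no N x 2r matrix U_{2r} when N < 2r: the factorisation is then not
   required. *)
Record finite_rank_perturbation {R : realType} {d : nat -> measure_display}
    {T : forall N, measurableType (d N)} (P : forall N, probability (T N) R)
    (H : forall N, T N -> 'M[R[i]]_N) (r : nat) (A0 : 'M[R[i]]_(2 * r))
    (A : forall N, T N -> 'M[R[i]]_N) : Prop := {
  FRP_random : forall N, random_mx (A N);
  FRP_independent : forall N, independent_mx (P N) (H N) (A N);
  FRP_rank : forall N w, (\rank (A N w) <= r)%N;
  FRP_form : forall N (le2r : (2 * r <= N)%N) w,
    exists2 V : 'M[R[i]]_N, V \is unitarymx &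
      let U := colsub (widen_ord le2r) V in A N w = U *m A0 *m U^t*
}.

(* Main.v *)
Require Import Defs.
From HB Require Import structures.
From mathcomp Require Import all_boot all_order all_algebra fingroup perm.
From mathcomp Require Import spectral sesquilinear complex.
From mathcomp Require Import all_classical all_reals all_analysis.
From mathcomp Require Import measurable_realfun ring lra.
Set Implicit Arguments.
Unset Strict Implicit.
Unset Printing Implicit Defensive.
Import Order.TTheory GRing.Theory Num.Theory.
Import numFieldNormedType.Exports.
Local Open Scope classical_set_scope.
Local Open Scope ring_scope.
Local Open Scope complex_scope.

(** Off the spectrum of [H], the eigenvalues of [H + A] are the zeros of
    [D_N z = det (z - H - A) / det (z - H)]. As [A = U A0 U^*] has bounded rank,
    Sylvester's identity ([det_1subMC]) gives
    [D_N z = det (1 - U^* (z - H)^-1 U A0)], a determinant of size [2 r].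

    Unitary invariance makes [U^* (z - H)^-1 U] close to [G z] times the identity.
    Since [H] and [A] are independent, and [D_N] is unchanged when both are
    conjugated by the same unitary matrix, Tonelli's theorem allows [U] to be
    replaced by the first [2 r] columns of the identity ([transfer]), so that only
    a fixed corner of the resolvent is involved. Its entries concentrate by a second
    moment computation ([entry_moment]) in which invariance under permutations and
    under one reflection suffices: permutations make all off-diagonal entries
    equally small, since the Hilbert-Schmidt norm of the resolvent is of order
    [sqrt N], and a reflection mixing two coordinates carries this over to the
    difference of two diagonal entries. Hence the diagonal entries are close to
    the normalised trace, which tends to [G z] because the spectral measure
    converges ([resolvent_whp]).

    So [D_N] tends in probability to
    [D z = det (1 - G z A0) = prod_i (1 - theta_i G z) ^ k_i], first at one point
    and, by Lipschitz bounds for the resolvent, uniformly on bounded sets at positive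
    distance from the support ([uniform_whp]). The zeros of [D] there are the
    outlier points, the order at a point being [k_i] times the order of
    [G - 1 / theta_i] ([limit_det_order]).

    It remains to pass from convergence of functions to convergence of zeros. For
    a quotient of products of linear factors the geometric mean of the modulus over
    the [n]-th roots of unity, dilated to a circle, is explicit, and for large [n] it
    yields Jensen's formula: comparing two concentric circles on which [|D_N|]
    behaves like [|z - x| ^ p] shows that exactly [p] zeros lie inside
    ([count_zeros]). With a positive lower bound for [|D|] away from the outlier
    points, this puts the right number of eigenvalues into arbitrarily small discs
    about these points and none elsewhere ([well_placed_whp]). The labels are chosen
    once, for discs that are disjoint ([labelling_exists]); then they are
    automatically right for all smaller discs. *)

(** * The complex modulus *)

Section Modulus.
Context {R : realType}.
Local Notation C := R[i].
Implicit Types (x y z : C) (a : R).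

Lemma normC_cmod z : `|z| = (cmod z)%:C.
Proof. by rewrite /cmod normc_def. Qed.

Lemma cmod_ge0 z : 0 <= cmod z.
Proof. by rewrite -ler0c -normC_cmod. Qed.

Lemma cmodM x y : cmod (x * y) = cmod x * cmod y.
Proof. by apply: complexI; rewrite rmorphM /= -!normC_cmod normrM. Qed.

Lemma cmodV x : cmod x^-1 = (cmod x)^-1.
Proof. by apply: complexI; rewrite fmorphV /= -!normC_cmod normfV. Qed.

Lemma cmodN x : cmod (- x) = cmod x.
Proof. by apply: complexI; rewrite -!normC_cmod normrN. Qed.

Lemma cmodB x y : cmod (x - y) = cmod (y - x).
Proof. by rewrite -cmodN opprB. Qed.

Lemma cmod_eq0 x : (cmod x == 0) = (x == 0).
Proof. by rewrite -[RHS]normr_eq0 normC_cmod -(inj_eq (@complexI R)). Qed.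

Lemma cmod0 : cmod (0 : C) = 0.
Proof. by apply/eqP; rewrite cmod_eq0. Qed.

Lemma cmod1 : cmod (1 : C) = 1.
Proof. by apply: complexI; rewrite -normC_cmod normr1. Qed.

Lemma cmod_gt0 x : (0 < cmod x) = (x != 0).
Proof. by rewrite lt_def cmod_eq0 cmod_ge0 andbT. Qed.

Lemma cmodX x n : cmod (x ^+ n) = cmod x ^+ n.
Proof. by apply: complexI; rewrite rmorphXn /= -!normC_cmod normrX. Qed.

Lemma ler_cmodD x y : cmod (x + y) <= cmod x + cmod y.
Proof. by rewrite -lecR rmorphD /= -!normC_cmod ler_normD. Qed.

Lemma ler_cmodB x y : cmod (x - y) <= cmod x + cmod y.
Proof. by rewrite -(cmodN y) ler_cmodD. Qed.

Lemma ler_cmod_dist y x z : cmod (x - z) <= cmod (x - y) + cmod (y - z).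
Proof. by have := ler_cmodD (x - y) (y - z); rewrite addrA subrK. Qed.

Lemma cmod_real a : cmod a%:C = `|a|.
Proof. by rewrite /cmod normc_def /= expr0n /= addr0 sqrtr_sqr. Qed.

Lemma cmod_sqr z : cmod z ^+ 2 = complex.Re z ^+ 2 + complex.Im z ^+ 2.
Proof. by apply: complexI; rewrite rmorphXn /= -normC_cmod -add_Re2_Im2. Qed.

Lemma cmod_conj z : cmod (z^*)%C = cmod z.
Proof. by apply: complexI; rewrite -!normC_cmod normcJ. Qed.

Lemma cmod_sum (I : Type) (r : seq I) (Q : pred I) (F : I -> C) :
  cmod (\sum_(i <- r | Q i) F i) <= \sum_(i <- r | Q i) cmod (F i).
Proof.
elim/big_ind2: _ => [|x u y v hx hy|//]; first by rewrite cmod0.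
exact: le_trans (ler_cmodD _ _) (lerD hx hy).
Qed.

Lemma cmod_prod (I : Type) (r : seq I) (Q : pred I) (F : I -> C) :
  cmod (\prod_(i <- r | Q i) F i) = \prod_(i <- r | Q i) cmod (F i).
Proof. exact: (big_morph (@cmod R) cmodM cmod1). Qed.

Lemma ler_Re_cmod z : `|complex.Re z| <= cmod z.
Proof. by rewrite -lecR -normC_cmod normc_ge_Re. Qed.

Lemma ler_Im_cmod z : `|complex.Im z| <= cmod z.
Proof.
rewrite -(@ler_pXn2r _ 2) ?nnegrE ?cmod_ge0 // cmod_sqr real_normK ?num_real //.
by rewrite lerDr sqr_ge0.
Qed.

Lemma ler_cmod_ReIm z : cmod z <= `|complex.Re z| + `|complex.Im z|.
Proof.
rewrite -(@ler_pXn2r _ 2) ?nnegrE ?addr_ge0 ?cmod_ge0 // cmod_sqr sqrrD.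
rewrite !real_normK ?num_real //.
have := normr_ge0 (complex.Re z); have := normr_ge0 (complex.Im z); nra.
Qed.

Lemma ReB x y : complex.Re (x - y) = complex.Re x - complex.Re y.
Proof. exact: (raddfB (@complex.Re R : Rcomplex R -> R)). Qed.

Lemma ImB x y : complex.Im (x - y) = complex.Im x - complex.Im y.
Proof. exact: (raddfB (@complex.Im R : Rcomplex R -> R)). Qed.

Lemma ReD x y : complex.Re (x + y) = complex.Re x + complex.Re y.
Proof. exact: (raddfD (@complex.Re R : Rcomplex R -> R)). Qed.

Lemma ImD x y : complex.Im (x + y) = complex.Im x + complex.Im y.
Proof. exact: (raddfD (@complex.Im R : Rcomplex R -> R)). Qed.

Lemma Re_sum (I : Type) (r : seq I) (Q : pred I) (F : I -> C) :
  complex.Re (\sum_(i <- r | Q i) F i) = \sum_(i <- r | Q i) complex.Re (F i).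
Proof. exact: (raddf_sum (@complex.Re R : Rcomplex R -> R)). Qed.

Lemma Im_sum (I : Type) (r : seq I) (Q : pred I) (F : I -> C) :
  complex.Im (\sum_(i <- r | Q i) F i) = \sum_(i <- r | Q i) complex.Im (F i).
Proof. exact: (raddf_sum (@complex.Im R : Rcomplex R -> R)). Qed.

Lemma Re_scal a z : complex.Re (a%:C * z) = a * complex.Re z.
Proof. by case: z => u v /=; rewrite mul0r subr0. Qed.

Lemma Im_scal a z : complex.Im (a%:C * z) = a * complex.Im z.
Proof. by case: z => u v /=; rewrite mul0r addr0. Qed.

End Modulus.

(** * Counting the zeros of a rational function by a discrete Jensen formula *)

Section Jensen.
Context {R : realType}.
Local Notation C := R[i].
Implicit Types (z a b xi : C) (s rho t : R).

Lemma unity_roots n : (0 < n)%N ->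
  exists2 us : seq C, size us = n & 'X^n - 1 = \prod_(u <- us) ('X - u%:P).
Proof.
move=> n0; case: (closed_field_poly_normal ('X^n - 1 : {poly C})) => us usE.
have lc : lead_coef ('X^n - 1 : {poly C}) = 1.
  by apply/monicP; rewrite -[1]polyC1 monicXnsubC.
move: usE; rewrite lc scale1r => usE; exists us => //.
have := congr1 (fun p : {poly C} => size p) usE.
by rewrite size_XnsubC // size_prod_XsubC => -[].
Qed.

Lemma unity_root_cmod n (us : seq C) u : (0 < n)%N ->
  'X^n - 1 = \prod_(u <- us) ('X - u%:P) -> u \in us -> cmod u = 1.
Proof.
move=> n0 usE uin; have : root ('X^n - 1) u by rewrite usE root_prod_XsubC.
rewrite rootE !hornerE subr_eq0 => /eqP /(congr1 (@cmod R)).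
rewrite cmodX cmod1 => /eqP; rewrite -[X in _ == X](expr1n _ n) => /eqP.
by move/(pexpIrn n0); apply; rewrite nnegrE ?cmod_ge0.
Qed.

(** The points [t u], with [u] running over the [n]-th roots of unity, sample the
    circle of radius [t]; over them a linear factor has a closed-form product. *)
Lemma prod_circle n (us : seq C) t a : (0 < n)%N -> 0 < t ->
  size us = n -> 'X^n - 1 = \prod_(u <- us) ('X - u%:P) ->
  \prod_(u <- us) cmod (t%:C * u - a) = cmod (a ^+ n - t%:C ^+ n).
Proof.
move=> n0 t0 sz usE.
have tC0 : t%:C != 0 :> C by rewrite -cmod_eq0 cmod_real normr_eq0 gt_eqF.
have -> : \prod_(u <- us) cmod (t%:C * u - a)
    = \prod_(u <- us) (cmod t%:C * cmod (a / t%:C - u)).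
  apply: eq_bigr => u _; rewrite -cmodM cmodB mulrBr [t%:C * (_ / _)]mulrC.
  by rewrite divfK.
rewrite big_split /= big_const_seq count_predT sz iter_mulr_1 -cmod_prod.
have -> : \prod_(u <- us) (a / t%:C - u) = ('X^n - 1).[a / t%:C].
  by rewrite usE horner_prod; apply: eq_bigr => u _; rewrite !hornerE.
rewrite !hornerE -cmodX -cmodM mulrBr mulr1 expr_div_n.
by rewrite [_ * (_ / _)]mulrC divfK // expf_neq0.
Qed.

Lemma cvg_cmod_1subX x : cmod x < 1 ->
  (cmod (1 - x ^+ n) : R) @[n --> \oo] --> (1 : R).
Proof.
move=> x1; apply/cvgrPdist_le => e e0.
have ax : `|cmod x| < 1 by rewrite ger0_norm ?cmod_ge0.
have /cvgrPdist_le /(_ _ e0) := cvg_expr ax; apply: filterS => n.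
rewrite sub0r normrN; apply: le_trans.
rewrite [leRHS]ger0_norm ?exprn_ge0 ?cmod_ge0 // -cmodX.
have h1 := ler_cmodB 1 (x ^+ n).
have h2 := ler_cmodD (1 - x ^+ n) (x ^+ n).
rewrite subrK in h2; rewrite cmod1 in h1 h2.
by rewrite ler_norml; apply/andP; split; lra.
Qed.

Lemma cmod_subX n a b : b != 0 ->
  cmod (b ^+ n - a ^+ n) = cmod b ^+ n * cmod (1 - (a / b) ^+ n).
Proof.
by move=> b0; rewrite -cmodX -cmodM mulrBr mulr1 -exprMn mulrC divfK.
Qed.

(** A point inside both circles contributes the factor [(rho / s) ^ n] to the
    quotient of the two products over the circles, a point outside both of them
    contributes nothing, up to an exponentially small relative error. *)
Lemma cvg_circle_ratio s rho a : 0 < s -> s < rho ->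
  cmod a < s \/ rho < cmod a ->
  (cmod (a ^+ n - rho%:C ^+ n) / cmod (a ^+ n - s%:C ^+ n)
     / (if cmod a < s then rho / s else 1) ^+ n : R) @[n --> \oo] --> (1 : R).
Proof.
move=> s0 srho; have r0 : 0 < rho by exact: lt_trans srho.
have sC : s%:C != 0 :> C by rewrite -cmod_eq0 cmod_real normr_eq0 gt_eqF.
have rC : rho%:C != 0 :> C by rewrite -cmod_eq0 cmod_real normr_eq0 gt_eqF.
have cs : cmod (s%:C : C) = s by rewrite cmod_real gtr0_norm.
have cr : cmod (rho%:C : C) = rho by rewrite cmod_real gtr0_norm.
have key x y : cmod x < 1 -> cmod y < 1 ->
    (cmod (1 - x ^+ n) / cmod (1 - y ^+ n) : R) @[n --> \oo] --> (1 : R).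
  move=> x1 y1; rewrite -[X in _ --> X]divr1; apply: cvgM.
    exact: cvg_cmod_1subX.
  by apply: cvgV; [rewrite oner_neq0|exact: cvg_cmod_1subX].
have fac x n : 0 < x -> cmod (a ^+ n - x%:C ^+ n)
    = x ^+ n * cmod (1 - (a / x%:C) ^+ n).
  move=> x0; have xC : x%:C != 0 :> C by rewrite -cmod_eq0 cmod_real normr_eq0 gt_eqF.
  by rewrite cmodB (cmod_subX n a xC) cmod_real gtr0_norm.
have alg (A B c1 c2 : R) : A != 0 -> B != 0 -> A * c1 / (B * c2) / (A / B) = c1 / c2.
  move=> A0 B0; rewrite -(mulf_div A B) -[RHS]mul1r mulrAC divff //.
  by rewrite mulf_neq0 ?invr_eq0.
case=> ha.
- have -> : (fun n => cmod (a ^+ n - rho%:C ^+ n) / cmod (a ^+ n - s%:C ^+ n)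
       / (if cmod a < s then rho / s else 1) ^+ n) =
     (fun n => cmod (1 - (a / rho%:C) ^+ n) / cmod (1 - (a / s%:C) ^+ n)).
    apply/funext => n; rewrite ha [X in X / _ / _](fac rho n r0).
    rewrite [X in _ / X / _](fac s n s0) [X in _ / _ / X](expr_div_n rho s).
    by apply: alg; rewrite expf_neq0 ?gt_eqF.
  apply: key.
  + by rewrite cmodM cmodV cr ltr_pdivrMr // mul1r (lt_trans ha).
  + by rewrite cmodM cmodV cs ltr_pdivrMr // mul1r.
- have a0 : a != 0 by rewrite -cmod_gt0 (lt_trans r0).
  have -> : (fun n => cmod (a ^+ n - rho%:C ^+ n) / cmod (a ^+ n - s%:C ^+ n)
       / (if cmod a < s then rho / s else 1) ^+ n) =
     (fun n => cmod (1 - (rho%:C / a) ^+ n) / cmod (1 - (s%:C / a) ^+ n)).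
    apply/funext => n; rewrite ltNge ltW ?(lt_trans srho) //= expr1n divr1.
    rewrite [X in X / _](cmod_subX n rho%:C a0) [X in _ / X](cmod_subX n s%:C a0).
    by rewrite -mulf_div divff ?mul1r // expf_neq0 // gt_eqF ?cmod_gt0.
  apply: key.
  + by rewrite cmodM cmodV cr ltr_pdivrMr ?cmod_gt0 // mul1r.
  + by rewrite cmodM cmodV cs ltr_pdivrMr ?cmod_gt0 // mul1r (lt_trans srho).
Qed.

Lemma cvg_prod_seq (I : Type) (r : seq I) (F : I -> nat -> R) :
  (forall i, F i n @[n --> \oo] --> (1 : R)) ->
  (\prod_(i <- r) F i n : R) @[n --> \oo] --> (1 : R).
Proof.
move=> hF; elim: r => [|i r ih].
  by under eq_fun do rewrite big_nil; exact: cvg_cst.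
under eq_fun do rewrite big_cons.
by have h := cvgM (hF i) ih; rewrite mulr1 in h; exact: h.
Qed.

Lemma cvg_prod_in (r : seq C) (F : C -> nat -> R) :
  {in r, forall i, F i n @[n --> \oo] --> (1 : R)} ->
  (\prod_(i <- r) F i n : R) @[n --> \oo] --> (1 : R).
Proof.
move=> hF.
have -> : (fun n => \prod_(i <- r) F i n)
   = (fun n => \prod_(i <- r) (if i \in r then F i n else 1)).
  by apply/funext => n; rewrite big_seq big_mkcond.
apply: cvg_prod_seq => i; move: (hF i).
by case: (i \in r) => [h|_]; [exact: h|exact: cvg_cst].
Qed.

(** Jensen's formula says that the geometric mean of [|f|] over a circle of
    radius [t] about [xi] equals [t ^ q] times a constant as long as [q] zeros
    lie inside. Comparing two radii gives [q], and this only needs the size of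
    [|f|] up to a factor [3] when the ratio of the radii exceeds [3]. The means
    are taken over roots of unity, where the products have a closed form. *)
Lemma count_zeros (as_ bs : seq C) xi s rho (c : R) (p : nat) :
  0 < s -> 3 * s < rho -> 0 < c ->
  {in as_, forall a, cmod (a - xi) < s \/ rho < cmod (a - xi)} ->
  {in bs, forall b, rho < cmod (b - xi)} ->
  (forall z, cmod (z - xi) = s \/ cmod (z - xi) = rho ->
     c * cmod (z - xi) ^+ p <=
       cmod ((\prod_(a <- as_) (z - a)) / \prod_(b <- bs) (z - b))
       <= 3 * c * cmod (z - xi) ^+ p) ->
  count (fun a => cmod (a - xi) < s) as_ = p.
Proof.
move=> s0 s3 c0 hA hB hf.
have srho : s < rho by lra.
have r0 : 0 < rho by lra.
pose t := rho / s; have t3 : 3 < t by rewrite ltr_pdivlMr.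
have t0 : 0 < t by lra.
set q := count _ _.
pose J a n := cmod ((a - xi) ^+ n - rho%:C ^+ n) / cmod ((a - xi) ^+ n - s%:C ^+ n).
pose w a := if cmod (a - xi) < s then t else 1.
pose e n := \prod_(a <- as_) (J a n / w a ^+ n) / \prod_(b <- bs) (J b n / w b ^+ n).
have e1 : e n @[n --> \oo] --> (1 : R).
  have h : e n @[n --> \oo] --> (1 / 1 : R).
    apply: cvgM.
      by apply: cvg_prod_in => a /hA ha; exact: cvg_circle_ratio.
    apply: cvgV; first exact: oner_neq0.
    by apply: cvg_prod_in => b /hB hb; apply: cvg_circle_ratio => //; right.
  by rewrite divr1 in h.
have eE n : e n * t ^+ (n * q) = \prod_(a <- as_) J a n / \prod_(b <- bs) J b n.
  have wn (r : seq C) : \prod_(a <- r) w a ^+ n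
      = t ^+ (n * count (fun a => cmod (a - xi) < s) r).
    elim: r => [|x r ih]; first by rewrite big_nil muln0 expr0.
    rewrite big_cons ih /= mulnDr exprD; congr (_ * _); rewrite /w.
    by case: ifP; rewrite ?muln1 // muln0 expr1n.
  have b0 : count (fun b => cmod (b - xi) < s) bs = 0%N.
    apply/eqP; rewrite -leqn0 leqNgt -has_count; apply/hasPn => b /hB hb.
    by rewrite -leNgt ltW ?(lt_trans srho).
  rewrite /e !big_split /= !prodfV !wn b0 muln0 expr0 invr1 mulr1 -/q.
  by rewrite [LHS]mulrAC divfK // expf_neq0 ?gt_eqF.
have Jbnd n : (0 < n)%N ->
    t ^+ (n * p) <= 3 ^+ n * (e n * t ^+ (n * q)) /\
    e n * t ^+ (n * q) <= 3 ^+ n * t ^+ (n * p).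
  move=> n0; have [us sz usE] := unity_roots n0.
  pose f z := cmod ((\prod_(a <- as_) (z - a)) / \prod_(b <- bs) (z - b)).
  have fE (v : R) : 0 < v -> \prod_(u <- us) f (xi + v%:C * u) =
      \prod_(a <- as_) cmod ((a - xi) ^+ n - v%:C ^+ n) /
      \prod_(b <- bs) cmod ((b - xi) ^+ n - v%:C ^+ n).
    move=> v0; rewrite /f.
    under eq_bigr do rewrite cmodM cmodV !cmod_prod.
    rewrite big_split /= prodfV exchange_big /= [in X in _ / X]exchange_big /=.
    congr (_ / _); apply: eq_bigr => a _; rewrite -(prod_circle _ n0 v0 sz usE);
      by apply: eq_bigr => u _; congr cmod; ring.
  have on v u : 0 < v -> u \in us -> cmod (xi + v%:C * u - xi) = v.
    move=> v0 uin; rewrite addrC addKr cmodM cmod_real gtr0_norm //.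
    by rewrite (unity_root_cmod n0 usE uin) mulr1.
  have nin v (r : R) : \prod_(u <- us) (r * v ^+ p) = r ^+ n * v ^+ (n * p).
    by rewrite big_const_seq count_predT sz iter_mulr_1 exprMn -exprM mulnC.
  have fb v : v = s \/ v = rho -> 0 < v ->
      c ^+ n * v ^+ (n * p) <= \prod_(u <- us) f (xi + v%:C * u)
        <= (3 * c) ^+ n * v ^+ (n * p).
    move=> hv v0; rewrite -!nin; apply/andP; split; rewrite big_seq [leRHS]big_seq;
      apply: ler_prod => u uin; have := hf (xi + v%:C * u);
      rewrite on // => /(_ hv)/andP[h1 h2]; rewrite ?h1 ?h2 ?cmod_ge0 ?andbT //.
    by rewrite mulr_ge0 ?exprn_ge0 ?ltW.
  have /andP[a1 a2] := fb s (or_introl erefl) s0.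
  have /andP[b1 b2] := fb rho (or_intror erefl) r0.
  have ps : 0 < \prod_(u <- us) f (xi + s%:C * u).
    by apply: lt_le_trans a1; rewrite mulr_gt0 ?exprn_gt0.
  have rat : e n * t ^+ (n * q) =
      \prod_(u <- us) f (xi + rho%:C * u) / \prod_(u <- us) f (xi + s%:C * u).
    have alg4 (x y u v : R) : x / y / (u / v) = x / u / (y / v).
      by rewrite !invf_div mulrACA [RHS]mulrACA (mulrC u^-1).
    rewrite eE !fE // /J !big_split /= !prodfV.
    exact: alg4.
  have tE : t ^+ (n * p) = rho ^+ (n * p) / s ^+ (n * p) by rewrite expr_div_n.
  have sp : 0 < s ^+ (n * p) by rewrite exprn_gt0.
  have cn : 0 < c ^+ n by rewrite exprn_gt0.
  have rp : 0 < rho ^+ (n * p) by rewrite exprn_gt0.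
  have n3 : 0 < 3 ^+ n :> R by rewrite exprn_gt0.
  move: a1 a2 b1 b2; rewrite exprMn rat tE.
  move: (\prod_(u <- us) f _) ps => Ps ps.
  move: (\prod_(u <- us) f _) => Pr a1 a2 b1 b2; split.
    rewrite ler_pdivrMr // mulrA mulrAC ler_pdivlMr //.
    apply: le_trans (ler_wpM2l (ltW rp) a2) _.
    rewrite [leLHS](_ : _ = 3 ^+ n * s ^+ (n * p) * (c ^+ n * rho ^+ (n * p))); last by ring.
    rewrite [leRHS](_ : _ = 3 ^+ n * s ^+ (n * p) * Pr); last by ring.
    by rewrite ler_pM2l ?mulr_gt0.
  rewrite ler_pdivrMr // mulrA mulrAC ler_pdivlMr //.
  apply: le_trans (ler_wpM2r (ltW sp) b2) _.
  rewrite [leLHS](_ : _ = 3 ^+ n * rho ^+ (n * p) * (c ^+ n * s ^+ (n * p))); last by ring.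
  by rewrite ler_pM2l ?mulr_gt0.
(* Were the count off by one, the two circles would disagree by the factor
   [(t / 3) ^ n], which the correction [e n] cannot absorb for large [n]. *)
have [n [n0 en1 en2 tn]] : exists n, [/\ (0 < n)%N, 2^-1 < e n, e n < 2 & 2 < (t / 3) ^+ n].
  have lt1 : `|3 / t| < 1 by rewrite gtr0_norm ?divr_gt0 // ltr_pdivrMr // mul1r.
  have h3 := cvg_expr lt1.
  apply: (@filter_ex _ \oo); near=> n; split.
  - by near: n; exists 1%N.
  - by near: n; apply: (cvgr_gt _ e1); lra.
  - by near: n; apply: (cvgr_lt _ e1); lra.
  - have : (3 / t) ^+ n < 2^-1 by near: n; apply: (cvgr_lt _ h3); lra.
    rewrite -[t / 3]invf_div exprVn => h.
    by rewrite -[2]invrK ltf_pV2 // posrE ?exprn_gt0 ?divr_gt0.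
have [h1 h2] := Jbnd n n0.
have tp k : 0 < t ^+ k by rewrite exprn_gt0.
have n3 : 0 < 3 ^+ n :> R by rewrite exprn_gt0.
have t1 : 1 <= t by lra.
rewrite expr_div_n ltr_pdivlMr // in tn.
apply/eqP; rewrite eqn_leq; apply/andP; split; rewrite leqNgt; apply/negP => hpq.
- have h4 : t ^+ (n * p) * t ^+ n <= t ^+ (n * q).
    by rewrite -exprD; apply: ler_weXn2l => //; rewrite addnC -mulnS leq_mul.
  have h5 : 2 * 3 ^+ n * (e n * t ^+ (n * p)) < 3 ^+ n * t ^+ (n * p).
    apply: lt_le_trans h2; apply: lt_le_trans (ler_wpM2l _ h4); last by lra.
    rewrite [ltLHS](_ : _ = e n * t ^+ (n * p) * (2 * 3 ^+ n)); last by ring.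
    by rewrite [ltRHS]mulrA ltr_pM2l // mulr_gt0 //; lra.
  have : 2 * e n < 1.
    rewrite -(ltr_pM2r (mulr_gt0 n3 (tp (n * p)%N))) mul1r.
    by apply: le_lt_trans h5; rewrite le_eqVlt; apply/orP; left; apply/eqP; ring.
  by lra.
- have h4 : t ^+ (n * q) * t ^+ n <= t ^+ (n * p).
    by rewrite -exprD; apply: ler_weXn2l => //; rewrite addnC -mulnS leq_mul.
  have h5 : 2 * 3 ^+ n * t ^+ (n * q) < 2 * 3 ^+ n * t ^+ (n * q).
    apply: (lt_le_trans (y := t ^+ (n * q) * t ^+ n)).
      by rewrite mulrC ltr_pM2l.
    apply: (le_trans h4); apply: (le_trans h1).
    by rewrite mulrA ler_pM2r // [leLHS]mulrC ler_pM2r // ltW.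
  by rewrite ltxx in h5.
Unshelve. all: by end_near.
Qed.

End Jensen.

(** * The support of the limit measure *)

Section Distance.
Context {R : realType}.
Local Notation C := R[i].
Implicit Types (z w s : C) (S : set C) (d : R).

Lemma cdist_le z S s : S s -> cdist z S <= cmod (z - s).
Proof.
move=> Ss; apply: ge_inf; last by exists s.
by exists 0 => _ [t _ <-]; exact: cmod_ge0.
Qed.

Lemma cdist_ge z S d : S !=set0 -> (forall s, S s -> d <= cmod (z - s)) ->
  d <= cdist z S.
Proof.
case=> s Ss h; apply: lb_le_inf; first by exists (cmod (z - s)), s.
by move=> _ [t St <-]; exact: h.
Qed.

Lemma cdist_lt z S d : S !=set0 -> cdist z S < d ->
  exists2 s, S s & cmod (z - s) < d.
Proof.
move=> S0 h; apply: contrapT => nex; move: h; apply/negP; rewrite -leNgt.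
apply: cdist_ge => // s Ss; rewrite leNgt; apply/negP => hs.
by apply: nex; exists s.
Qed.

Lemma cdist_lip z w S : S !=set0 -> cdist z S <= cmod (z - w) + cdist w S.
Proof.
move=> S0; rewrite -lerBlDl; apply: cdist_ge => // s Ss.
by rewrite lerBlDl (le_trans (cdist_le z Ss)) // ler_cmod_dist.
Qed.

End Distance.

Section Support.
Context {R : realType} (mu : probability (measurableTypeR R) R).
Local Notation C := R[i].
Local Notation S := (csupp mu).

Lemma msupp_open x : ~ msupp mu x ->
  exists2 e : R, 0 < e & mu (ball x e) = 0%E.
Proof.
move=> nx; apply: contrapT => h; apply: nx => e e0.
rewrite lt_def measure_ge0 andbT; apply/negP => /eqP me.
by apply: h; exists e.
Qed.

Lemma msupp_null_ball x e y : mu (ball x e) = 0%E -> msupp mu y -> e <= `|x - y|.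
Proof.
move=> me my; rewrite leNgt; apply/negP => xy.
have := my (e - `|x - y|); rewrite subr_gt0 => /(_ xy); apply/negP.
rewrite -leNgt -me; apply: le_measure; rewrite ?inE; [exact: measurable_ball..|].
move=> u; rewrite /ball /= => yu; have := ler_normD (x - y) (y - u).
by rewrite addrA subrK => h; apply: le_lt_trans h _; rewrite -ltrBrDl.
Qed.

Lemma msupp_closed : closed (msupp mu).
Proof.
rewrite -openC openE => x /msupp_open[e e0 me]; exists e => //= y xy my.
by have := msupp_null_ball me my; rewrite leNgt xy.
Qed.

Lemma measurable_msupp : measurable (msupp mu : set (measurableTypeR R)).
Proof. exact: closed_measurable msupp_closed. Qed.

(** The complement is a union of null intervals with rational endpoints. *)
Lemma msupp_full : mu (~` msupp mu) = 0%E.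
Proof.
pose J (pq : rat * rat) : set (measurableTypeR R) :=
  [set` `](ratr pq.1 : R), (ratr pq.2 : R)[].
pose F k : set (measurableTypeR R) := if unpickle k is Some pq
  then (if `[< mu (J pq) = 0%E >] then J pq else set0) else set0.
have mJ pq : measurable (J pq) by exact: measurable_itv.
have nF k : mu.-negligible (F k).
  rewrite /F; case: (unpickle k) => [pq|]; last exact: negligible_set0.
  case: asboolP => h; last exact: negligible_set0.
  by apply/negligibleP.
have [B [mB B0 sB]] := negligible_bigcup nF.
apply/eqP; rewrite eq_le measure_ge0 andbT -B0; apply: le_measure; rewrite ?inE //.
  exact: measurableC measurable_msupp.
move=> x /msupp_open[e e0 me]; apply: sB.
have /rat_in_itvoo[p] : x - e < x by rewrite ltrBlDr ltrDl.
have /rat_in_itvoo[q] : x < x + e by rewrite ltrDl.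
rewrite !in_itv /= => /andP[q1 q2] /andP[p1 p2].
have [k hk] : exists k, unpickle k = Some (p, q).
  by exists (pickle (p, q)); exact: pickleK.
exists k; first exact: I.
rewrite /F hk; case: asboolP => [_|].
  by rewrite /J /= in_itv /= p2 q1.
case; apply/eqP; rewrite eq_le measure_ge0 andbT -me.
apply: le_measure; rewrite ?inE //; first exact: measurable_ball.
move=> y; rewrite /J /= in_itv /= => /andP[y1 y2]; rewrite /ball /=.
by rewrite ltr_norml; apply/andP; split; lra.
Qed.

Lemma msupp_neq0 : msupp mu !=set0.
Proof.
apply/set0P/negP => /eqP h; have := msupp_full; rewrite h setC0 probability_setT.
by move/eqP; rewrite gt_eqF // lte01.
Qed.

Lemma csupp_neq0 : S !=set0.
Proof. by have [x hx] := msupp_neq0; exists x%:C, x. Qed.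

Lemma cdist_csupp_gt0 z : ~ S z -> 0 < cdist z S.
Proof.
case: z => a b nz; have [b0|b0] := eqVneq b 0.
  have [|e e0 me] := @msupp_open a; first by move=> ha; apply: nz; exists a; rewrite // b0.
  apply: (lt_le_trans e0); apply: cdist_ge; first exact: csupp_neq0.
  move=> _ [x hx <-]; apply: le_trans (msupp_null_ball me hx) _.
  exact: ler_Re_cmod ((a +i* b) - x%:C).
apply: (@lt_le_trans _ _ `|b|); first by rewrite normr_gt0.
apply: cdist_ge; first exact: csupp_neq0.
by move=> _ [x hx <-]; have := ler_Im_cmod ((a +i* b) - x%:C); rewrite /= oppr0 addr0.
Qed.

Lemma measurable_restrict_msupp (f : measurableTypeR R -> R) :
  measurable_fun setT f -> measurable_fun setT (f \_ (msupp mu)).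
Proof.
move=> mf; apply/(@measurable_restrict _ _ _ _ _ setT) => //.
  exact: measurable_msupp.
exact: measurable_funS mf.
Qed.

Lemma Rintegral_restrict_msupp (f : R -> R) : measurable_fun [set: R] f ->
  Rintegral mu setT f = Rintegral mu setT (f \_ (msupp mu)).
Proof.
move=> mf; rewrite /Rintegral; congr fine; apply: ae_eq_integral => //.
- exact/measurable_EFinP.
- by apply/measurable_EFinP; exact: measurable_restrict_msupp.
- exists (~` msupp mu); split; [exact: measurableC measurable_msupp|exact: msupp_full|].
  move=> x /= h hx; apply: h => _; rewrite patchE mem_set //.
Qed.

Lemma eq_Rintegral_msupp (f g : R -> R) :
  measurable_fun [set: R] f -> measurable_fun [set: R] g ->
  (forall x, msupp mu x -> f x = g x) ->
  Rintegral mu setT f = Rintegral mu setT g.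
Proof.
move=> mf mg fg; rewrite (Rintegral_restrict_msupp mf) (Rintegral_restrict_msupp mg).
congr Rintegral; apply/funext => x; rewrite !patchE; case: ifPn => // /set_mem.
exact: fg.
Qed.

Lemma bounded_integrable_prob (f : R -> R) (B : R) :
  measurable_fun [set: R] f -> (forall x, `|f x| <= B) ->
  mu.-integrable setT (EFin \o f).
Proof.
move=> mf fB; apply: measurable_bounded_integrable => //.
  by apply: (le_lt_trans (probability_le1 mu measurableT)); rewrite ltry.
exists B; split; first exact: num_real.
by move=> M BM x _ /=; apply: le_trans (fB x) (ltW BM).
Qed.

(** Since the complement of the support is null, an estimate of the integrands on
    the support is enough; the Cauchy kernel may blow up off the support. *)
Lemma Rintegral_msupp_dist (f g : R -> R) (B e : R) :
  measurable_fun [set: R] f -> measurable_fun [set: R] g ->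
  (forall x, msupp mu x -> `|f x| <= B) -> (forall x, msupp mu x -> `|g x| <= B) ->
  (forall x, msupp mu x -> `|f x - g x| <= e) ->
  `|Rintegral mu setT f - Rintegral mu setT g| <= e.
Proof.
move=> mf mg fB gB fg; have [x0 hx0] := msupp_neq0.
have B0 : 0 <= B := le_trans (normr_ge0 _) (fB _ hx0).
have e0 : 0 <= e := le_trans (normr_ge0 _) (fg _ hx0).
rewrite (Rintegral_restrict_msupp mf) (Rintegral_restrict_msupp mg).
have int (h : R -> R) : measurable_fun [set: R] h -> (forall x, msupp mu x -> `|h x| <= B) ->
    mu.-integrable setT (EFin \o (h \_ (msupp mu))).
  move=> mh hB; apply: (@bounded_integrable_prob _ B); first exact: measurable_restrict_msupp.
  by move=> x; rewrite patchE; case: ifPn => [/set_mem/hB //|_]; rewrite normr0.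
have intD := integrableB (measurableT) (int _ mf fB) (int _ mg gB).
rewrite -RintegralB //; [|exact: int..].
apply: le_trans (le_normr_Rintegral _ _) _ => //.
apply: (@le_trans _ _ (Rintegral mu setT (cst e))).
  apply: le_Rintegral => //.
  - exact: (integrable_norm intD).
  - by apply: (@bounded_integrable_prob _ e) => // x; rewrite ger0_norm.
  - move=> x _ /=; rewrite /patch; case: ifPn => [/set_mem/fg //|_].
    by rewrite subrr normr0.
rewrite Rintegral_cst //; set m := fine _.
have -> : m = 1 by rewrite -[RHS]/(fine 1%E); congr fine; exact: probability_setT.
by rewrite mulr1.
Qed.

End Support.

(** * Events of probability tending to one *)

Section HighProbability.
Context {R : realType} {d : nat -> measure_display}
  {T : forall N, measurableType (d N)} (P : forall N, probability (T N) R).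
Implicit Types (E F : forall N, set (T N)).

Lemma prob_setC N (A : set (T N)) : measurable A ->
  fine (P N (~` A)) = 1 - fine (P N A).
Proof.
move=> mA; rewrite probability_setC //.
by rewrite -[in LHS](@fineK _ (P N A)) ?fin_num_measure.
Qed.

Lemma prob_cvg1P F : (forall N, measurable (F N)) ->
  P N (F N) @[N --> \oo] --> 1%E <->
  forall e : R, 0 < e ->
    exists N0, forall N, (N0 <= N)%N -> fine (P N (~` F N)) <= e.
Proof.
move=> mF; split=> [/fine_cvgP[_ /cvgrPdist_le h] e e0|h].
  have [N0 _ hN] := h _ e0; exists N0 => N N0N.
  by rewrite prob_setC //; apply: le_trans (hN N N0N); rewrite ler_norm.
apply/fine_cvgP; split.
  by apply: nearW => N; rewrite fin_num_measure.
apply/cvgrPdist_le => e e0; have [N0 hN] := h _ e0.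
exists N0 => // N /= N0N; rewrite -prob_setC // ger0_norm ?hN //.
exact: fine_ge0.
Qed.

Lemma whp_large E E' N0 : (forall N, (N0 <= N)%N -> E N `<=` E' N) ->
  with_high_probability P E -> with_high_probability P E'.
Proof.
move=> sE [F [mF FE]] /(prob_cvg1P mF) PF.
pose F' N := if (N0 <= N)%N then F N else set0.
have mF' N : measurable (F' N) by rewrite /F'; case: ifP.
exists F'; split => //.
  by move=> N; rewrite /F'; case: ifP => [N0N x /FE|_ x []]; exact: sE.
apply/(prob_cvg1P mF') => e /PF[N1 hN]; exists (maxn N0 N1) => N.
by rewrite geq_max /F' => /andP[-> /hN].
Qed.

Lemma whpS E E' : (forall N, E N `<=` E' N) ->
  with_high_probability P E -> with_high_probability P E'.
Proof. by move=> h; apply: (@whp_large _ _ 0) => N _; exact: h. Qed.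

Lemma whpI E E' : with_high_probability P E -> with_high_probability P E' ->
  with_high_probability P (fun N => E N `&` E' N).
Proof.
move=> [F [mF FE]] /(prob_cvg1P mF) PF [F' [mF' FE']] /(prob_cvg1P mF') PF'.
have mI N : measurable (F N `&` F' N) by exact: measurableI.
exists (fun N => F N `&` F' N); split => //.
  by move=> N x [/FE ? /FE' ?].
apply/(prob_cvg1P mI) => e e0.
have [|N1 h1] := PF (e / 2); first by rewrite divr_gt0.
have [|N2 h2] := PF' (e / 2); first by rewrite divr_gt0.
exists (maxn N1 N2) => N; rewrite geq_max => /andP[/h1 {}h1 /h2 {}h2].
rewrite setCI; apply: (@le_trans _ _ (fine (P N (~` F N)) + fine (P N (~` F' N)))); last by lra.
have m1 := measurableC (mF N); have m2 := measurableC (mF' N).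
rewrite -fineD ?fin_num_measure // fine_le ?fin_num_measure //.
- exact: measurableU.
- by rewrite fin_numD !fin_num_measure.
- exact: measureU2.
Qed.

Lemma whpT : with_high_probability P (fun N => setT).
Proof.
exists (fun=> setT); split => //.
by under eq_fun do rewrite probability_setT; exact: cvg_cst.
Qed.

Lemma whp_all (I : eqType) (r : seq I) (E : I -> forall N, set (T N)) :
  (forall i, i \in r -> with_high_probability P (E i)) ->
  with_high_probability P (fun N => [set w | forall i, i \in r -> E i N w]).
Proof.
elim: r => [_|i r ih h]; first by apply: whpS whpT => N w _ i.
have h1 := h i (mem_head i r).
have h2 : with_high_probability P (fun N => [set w | forall i, i \in r -> E i N w]).
  by apply: ih => i' i'r; apply: h; rewrite inE i'r orbT.
apply: whpS (whpI h1 h2) => N w [a b] i'; rewrite inE => /orP[/eqP -> //|].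
exact: b.
Qed.

End HighProbability.

(** * Measurability of complex-valued maps *)

Section ComplexMeasurable.
Context {R : realType}.
Local Notation C := R[i].

Lemma measurable_invr : measurable_fun [set: R] (@GRing.inv R).
Proof.
have -> : [set: R] = [set 0] `|` ~` [set 0] by rewrite setUv.
apply/measurable_funU; [exact: measurable_set1|apply: measurableC; exact: measurable_set1|].
split; first exact: measurable_fun_set1.
apply: open_continuous_measurable_fun.
  by rewrite openC; exact: closed_eq.
by move=> x; rewrite inE /= => /eqP x0; exact: inv_continuous.
Qed.

Section Closure.
Context {d : measure_display} {T : measurableType d}.
Implicit Types f g : T -> C.

Definition cmeasurable f := measurable_fun setT (fun x => complex.Re (f x)) /\
  measurable_fun setT (fun x => complex.Im (f x)).

Lemma cmeasurable_cst c : cmeasurable (fun=> c).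
Proof. by split; exact: measurable_cst. Qed.

Lemma cmeasurableD f g : cmeasurable f -> cmeasurable g ->
  cmeasurable (fun x => f x + g x).
Proof.
move=> [f1 f2] [g1 g2]; split.
  by under eq_fun do rewrite ReD; exact: measurable_funD.
by under eq_fun do rewrite ImD; exact: measurable_funD.
Qed.

Lemma cmeasurableM f g : cmeasurable f -> cmeasurable g ->
  cmeasurable (fun x => f x * g x).
Proof.
move=> [f1 f2] [g1 g2]; split.
  have -> : (fun x => complex.Re (f x * g x)) = (fun x => complex.Re (f x) *
    complex.Re (g x) - complex.Im (f x) * complex.Im (g x)).
    by apply/funext => x; case: (f x) (g x) => [a b] [u v].
  by apply: measurable_funB; exact: measurable_funM.
have -> : (fun x => complex.Im (f x * g x)) = (fun x => complex.Re (f x) *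
    complex.Im (g x) + complex.Im (f x) * complex.Re (g x)).
  by apply/funext => x; case: (f x) (g x) => [a b] [u v].
by apply: measurable_funD; exact: measurable_funM.
Qed.

Lemma measurable_cmod_sqr f : cmeasurable f ->
  measurable_fun setT (fun x => cmod (f x) ^+ 2).
Proof.
move=> [f1 f2]; under eq_fun do rewrite cmod_sqr.
by apply: measurable_funD; exact: measurable_funX.
Qed.

Lemma measurable_cmod f : cmeasurable f -> measurable_fun setT (fun x => cmod (f x)).
Proof.
move=> mf.
have -> : (fun x => cmod (f x)) = (fun x => Num.sqrt (cmod (f x) ^+ 2)).
  by apply/funext => x; rewrite sqrtr_sqr ger0_norm ?cmod_ge0.
apply: measurableT_comp (measurable_cmod_sqr mf).
by apply: continuous_measurable_fun; exact: sqrt_continuous.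
Qed.

Lemma cmeasurableV f : cmeasurable f -> cmeasurable (fun x => (f x)^-1).
Proof.
move=> mf; have mi := measurableT_comp measurable_invr (measurable_cmod_sqr mf).
have [f1 f2] := mf; split.
  have -> : (fun x => complex.Re (f x)^-1) =
      (fun x => complex.Re (f x) * (cmod (f x) ^+ 2)^-1).
    by apply/funext => x; rewrite cmod_sqr; case: (f x).
  exact: measurable_funM.
have -> : (fun x => complex.Im (f x)^-1) =
    (fun x => - complex.Im (f x) * (cmod (f x) ^+ 2)^-1).
  by apply/funext => x; rewrite cmod_sqr; case: (f x) => a b /=; rewrite mulNr.
by apply: measurable_funM => //; apply: measurableT_comp.
Qed.

Lemma cmeasurableN f : cmeasurable f -> cmeasurable (fun x => - f x).
Proof.
move=> mf; under eq_fun do rewrite -mulN1r.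
by apply: cmeasurableM => //; exact: cmeasurable_cst.
Qed.

Lemma cmeasurable_sum (I : Type) (r : seq I) (Q : pred I) (F : I -> T -> C) :
  (forall i, cmeasurable (F i)) -> cmeasurable (fun x => \sum_(i <- r | Q i) F i x).
Proof.
move=> h; elim: r => [|i r ih].
  by under eq_fun do rewrite big_nil; exact: cmeasurable_cst.
under eq_fun do rewrite big_cons; case: (Q i) => //.
exact: cmeasurableD.
Qed.

Lemma cmeasurable_prod (I : Type) (r : seq I) (Q : pred I) (F : I -> T -> C) :
  (forall i, cmeasurable (F i)) -> cmeasurable (fun x => \prod_(i <- r | Q i) F i x).
Proof.
move=> h; elim: r => [|i r ih].
  by under eq_fun do rewrite big_nil; exact: cmeasurable_cst.
under eq_fun do rewrite big_cons; case: (Q i) => //.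
exact: cmeasurableM.
Qed.

Lemma cmeasurable_det n (M : T -> 'M[C]_n) :
  (forall i j, cmeasurable (fun x => M x i j)) -> cmeasurable (fun x => \det (M x)).
Proof.
move=> h; rewrite /determinant; apply: cmeasurable_sum => s.
apply: cmeasurableM; first exact: cmeasurable_cst.
by apply: cmeasurable_prod => i.
Qed.

Lemma cmeasurable_adj n (M : T -> 'M[C]_n) i j :
  (forall i j, cmeasurable (fun x => M x i j)) ->
  cmeasurable (fun x => (\adj (M x)) i j).
Proof.
move=> h; under eq_fun do rewrite mxE /cofactor.
apply: cmeasurableM; first exact: cmeasurable_cst.
apply: cmeasurable_det => i' j'; under eq_fun do rewrite !mxE.
exact: h.
Qed.

End Closure.
End ComplexMeasurable.

(** * The Cauchy transform and the empirical spectral measure *)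

Section CauchyTransform.
Context {R : realType} (mu : probability (measurableTypeR R) R).
Local Notation C := R[i].
Local Notation S := (csupp mu).
Local Notation G := (cauchy_transform mu).
Implicit Types (z : C) (d : R).

Definition off_support d z := forall x, msupp mu x -> d <= cmod (z - x%:C).

Lemma off_supportP d z : d <= cdist z S <-> off_support d z.
Proof.
split=> [h x hx|h]; first by apply: le_trans h _; apply: cdist_le; exists x.
by apply: cdist_ge; [exact: csupp_neq0|move=> _ [x hx <-]; exact: h].
Qed.

Lemma cmeasurable_kernel z :
  cmeasurable (fun x : measurableTypeR R => (z - x%:C)^-1).
Proof.
apply: cmeasurableV; apply: cmeasurableD; first exact: cmeasurable_cst.
apply: cmeasurableN; split; first exact: measurable_id.
exact: measurable_cst.
Qed.

Lemma cmod_invB (u v : C) d : 0 < d -> d <= cmod u -> d <= cmod v ->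
  cmod (u^-1 - v^-1) <= cmod (u - v) / d ^+ 2.
Proof.
move=> d0 du dv.
have u0 : u != 0 by rewrite -cmod_gt0 (lt_le_trans d0).
have v0 : v != 0 by rewrite -cmod_gt0 (lt_le_trans d0).
have -> : u^-1 - v^-1 = (v - u) * (u^-1 * v^-1) by field; rewrite u0 v0.
rewrite cmodM cmodB ler_wpM2l ?cmod_ge0 // cmodM !cmodV -invfM.
rewrite lef_pV2 ?posrE ?exprn_gt0 ?mulr_gt0 ?cmod_gt0 //.
by rewrite expr2 ler_pM // ltW.
Qed.

Lemma cauchy_transform_lip d z w : 0 < d -> off_support d z -> off_support d w ->
  cmod (G z - G w) <= 2 * (cmod (z - w) / d ^+ 2).
Proof.
move=> d0 hz hw; apply: le_trans (ler_cmod_ReIm _) _.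
have [mz1 mz2] := cmeasurable_kernel z; have [mw1 mw2] := cmeasurable_kernel w.
have bz u : off_support d u -> forall x, msupp mu x -> cmod (u - x%:C)^-1 <= d^-1.
  move=> hu x hx; rewrite cmodV lef_pV2 ?posrE //; first exact: hu.
  by rewrite (lt_le_trans d0) // hu.
have key x : msupp mu x ->
    cmod ((z - x%:C)^-1 - (w - x%:C)^-1) <= cmod (z - w) / d ^+ 2.
  move=> hx; have -> : z - w = (z - x%:C) - (w - x%:C) by ring.
  by apply: cmod_invB => //; [exact: hz|exact: hw].
rewrite mulrDl mul1r; apply: lerD.
  rewrite ReB /=; apply: (@Rintegral_msupp_dist _ mu _ _ d^-1) => // x hx.
  - exact: le_trans (ler_Re_cmod _) (bz _ hz _ hx).
  - exact: le_trans (ler_Re_cmod _) (bz _ hw _ hx).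
  - by rewrite -ReB; exact: le_trans (ler_Re_cmod _) (key _ hx).
rewrite ImB /=; apply: (@Rintegral_msupp_dist _ mu _ _ d^-1) => // x hx.
- exact: le_trans (ler_Im_cmod _) (bz _ hz _ hx).
- exact: le_trans (ler_Im_cmod _) (bz _ hw _ hx).
- by rewrite -ImB; exact: le_trans (ler_Im_cmod _) (key _ hx).
Qed.

Lemma cauchy_transform_bound d z : 0 < d -> off_support d z ->
  cmod (G z) <= 2 / d.
Proof.
move=> d0 hz; apply: le_trans (ler_cmod_ReIm _) _.
have [mz1 mz2] := cmeasurable_kernel z.
have bz x : msupp mu x -> cmod (z - x%:C)^-1 <= d^-1.
  move=> hx; rewrite cmodV lef_pV2 ?posrE //; first exact: hz.
  by rewrite (lt_le_trans d0) // hz.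
have b0 x : msupp mu x -> `|0 : R| <= d^-1 by rewrite normr0 invr_ge0 ltW.
have r0 : Rintegral mu setT (fun=> 0) = 0 by rewrite Rintegral_cst // mul0r.
rewrite mulrDl mul1r; apply: lerD.
  rewrite /= -[X in `|X|]subr0 -[X in _ - X]r0.
  apply: (@Rintegral_msupp_dist _ mu _ _ d^-1) => // x hx; rewrite ?subr0;
    exact: le_trans (ler_Re_cmod _) (bz _ hx).
rewrite /= -[X in `|X|]subr0 -[X in _ - X]r0.
apply: (@Rintegral_msupp_dist _ mu _ _ d^-1) => // x hx; rewrite ?subr0;
  exact: le_trans (ler_Im_cmod _) (bz _ hx).
Qed.

(** A continuous bounded function of [x] on the line that agrees with
    [(z - x)^-1] wherever [|z - x| >= d]. *)
Definition cut_kernel d z (x : R) : C :=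
  (z - x%:C)^*%C * ((Num.max (cmod (z - x%:C) ^+ 2) (d ^+ 2))^-1)%:C.

Lemma cut_kernelE d z x : 0 < d -> d <= cmod (z - x%:C) ->
  cut_kernel d z x = (z - x%:C)^-1.
Proof.
move=> d0 hd; rewrite /cut_kernel max_l; last first.
  by rewrite ler_pXn2r ?nnegrE ?cmod_ge0 ?(ltW d0).
have u0 : z - x%:C != 0 by rewrite -cmod_gt0 (lt_le_trans d0).
rewrite [RHS]invc_norm normC_cmod mulrC; congr (_ * _).
by rewrite fmorphV rmorphXn.
Qed.

Lemma cut_kernel_bound d z x : 0 < d -> cmod (cut_kernel d z x) <= d^-1.
Proof.
move=> d0; rewrite cmodM cmod_conj cmod_real.
set a := cmod _; set m := Num.max _ _.
have a0 : 0 <= a := cmod_ge0 _.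
have m0 : 0 < m by rewrite lt_max (exprn_gt0 _ d0) orbT.
rewrite ger0_norm ?invr_ge0 ?(ltW m0) // ler_pdivrMr // mulrC ler_pdivlMr //.
have [ad|da] := leP a d.
  by apply: (@le_trans _ _ (d ^+ 2)); [rewrite expr2 ler_pM2r|rewrite le_max lexx orbT].
by apply: (@le_trans _ _ (a ^+ 2)); [rewrite expr2 ler_wpM2l // ltW|rewrite le_max lexx].
Qed.

Lemma cut_kernel_continuous d z : 0 < d ->
  continuous (fun x => complex.Re (cut_kernel d z x)) /\
  continuous (fun x => complex.Im (cut_kernel d z x)).
Proof.
move=> d0; case: z => a b.
pose m (x : R) := Num.max ((a - x) ^+ 2 + b ^+ 2) (d ^+ 2).
have mE x : m x = Num.max (cmod ((a +i* b) - x%:C) ^+ 2) (d ^+ 2).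
  by rewrite /m cmod_sqr /= oppr0 addr0.
have cs x : {for x, continuous (fun x : R => a - x)}.
  by apply: continuousB; [exact: cst_continuous|exact: cvg_id].
have cm x : {for x, continuous (fun x => (m x)^-1)}.
  apply: continuousV; first by rewrite gt_eqF // lt_max (exprn_gt0 _ d0) orbT.
  apply: continuous_max; last exact: cst_continuous.
  apply: continuousD; last exact: cst_continuous.
  by rewrite (_ : (fun x => _) = (fun x => (a - x) * (a - x))) //; apply: continuousM; exact: cs.
split.
  have -> : (fun x => complex.Re (cut_kernel d (a +i* b) x)) = (fun x => (a - x) * (m x)^-1).
    by apply/funext => x; rewrite mE /cut_kernel; set q := (_^-1 in RHS); rewrite /= mulr0 subr0.
  by move=> x; exact: (continuousM (cs x) (cm x)).
have -> : (fun x => complex.Im (cut_kernel d (a +i* b) x)) = (fun x => (- b) * (m x)^-1).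
  apply/funext => x; rewrite mE /cut_kernel; set q := (_^-1 in RHS).
  by rewrite /= mulr0 add0r oppr0 addr0.
by move=> x; exact: (continuousM (@cst_continuous _ _ (- b) x) (cm x)).
Qed.

End CauchyTransform.

Section Empirical.
Context {R : realType}.
Local Notation C := R[i].

Lemma size_eigenvals N (M : 'M[C]_N) : size (eigenvals M) = N.
Proof.
rewrite /eigenvals; case: closed_field_poly_normal => s /= hs.
have := congr1 (fun p : {poly C} => size p) hs.
rewrite size_char_poly (monicP (char_poly_monic M)) scale1r size_prod_XsubC.
by case.
Qed.

Lemma char_poly_eigenvals N (M : 'M[C]_N) :
  char_poly M = \prod_(l <- eigenvals M) ('X - l%:P).
Proof.
rewrite /eigenvals; case: closed_field_poly_normal => s /= hs.
by rewrite [LHS]hs (monicP (char_poly_monic M)) scale1r.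
Qed.

Lemma Rintegral_esm_ge0 N (M : 'M[C]_N) (f : R -> R) :
  measurable_fun [set: R] f -> (forall x, 0 <= f x) ->
  Rintegral (empirical_spectral_measure M) setT f =
    N%:R^-1 * \sum_(l <- eigenvals M) f (complex.Re l).
Proof.
move=> mf f0; rewrite /Rintegral /empirical_spectral_measure.
have mf' : measurable_fun [set: measurableTypeR R] (EFin \o f) by exact/measurable_EFinP.
rewrite ge0_integral_mscale //; last by move=> x _; rewrite /= lee_fin.
rewrite ge0_integral_measure_sum //; last by move=> x _; rewrite /= lee_fin.
have -> : (\sum_(n < N) \int[dirac (complex.Re (eigenvals M)`_n : measurableTypeR R)]_x
    (EFin \o f) x)%E = (\sum_(l <- eigenvals M) f (complex.Re l))%:E.
  rewrite (big_nth 0) big_mkord size_eigenvals -sumEFin.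
  apply: eq_bigr => i _; rewrite integral_dirac // diracT mul1e //.
by [].
Qed.

(** Adding the bound [B] makes the test function nonnegative, so that its integral
    against the sum of Dirac measures is a sum; on both sides the masses are [1],
    and the shift cancels. *)
Lemma Rintegral_esm_dist N (M : 'M[C]_N) (mu : probability (measurableTypeR R) R)
    (f : R -> R) (B : R) : (0 < N)%N ->
  measurable_fun [set: R] f -> (forall x, `|f x| <= B) ->
  Rintegral (empirical_spectral_measure M) setT (fun x => f x + B)
    - Rintegral mu setT (fun x => f x + B) =
  N%:R^-1 * \sum_(l <- eigenvals M) f (complex.Re l) - Rintegral mu setT f.
Proof.
move=> N0 mf fB.
have mB : measurable_fun [set: R] (fun x => f x + B).
  by apply: measurable_funD => //; exact: measurable_cst.
rewrite Rintegral_esm_ge0 //; last by move=> x; have := fB x; rewrite ler_norml; lra.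
rewrite big_split /= big_const_seq count_predT size_eigenvals iter_addr_0.
have -> : Rintegral mu setT (fun x => f x + B) = Rintegral mu setT f + B.
  have if1 := bounded_integrable_prob mu mf fB.
  have if2 : mu.-integrable setT (EFin \o (fun=> B)).
    by apply: (@bounded_integrable_prob _ mu _ `|B|) => //; exact: measurable_cst.
  rewrite (RintegralD _ if1 if2) // Rintegral_cst //.
  suff -> : fine (mu setT) = 1 by rewrite mulr1.
  by rewrite -[RHS]/(fine 1%E); congr fine; exact: probability_setT.
rewrite mulrDr -(mulr_natr B) [_ * (B * _)]mulrC mulfK ?pnatr_eq0 -?lt0n //.
by ring.
Qed.

End Empirical.

(** * Resolvents *)

Section LinearAlgebra.
Context {F : comNzRingType}.

(** Sylvester's determinant identity. *)
Lemma det_1subMC m n (A : 'M[F]_(m, n)) (B : 'M[F]_(n, m)) :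
  \det (1%:M - A *m B) = \det (1%:M - B *m A).
Proof.
have h1 : block_mx 1%:M A B 1%:M =
    block_mx 1%:M 0 B 1%:M *m block_mx 1%:M A 0 (1%:M - B *m A).
  by rewrite mulmx_block !mul1mx !mul0mx !mulmx1 !addr0 addrC subrK.
have h2 : block_mx 1%:M A B 1%:M =
    block_mx (1%:M - A *m B) A 0 1%:M *m block_mx 1%:M 0 B 1%:M.
  by rewrite mulmx_block !mul1mx !mul0mx !mulmx1 !mulmx0 !add0r subrK.
have := congr1 (fun M => \det M) (etrans (esym h2) h1).
by rewrite !det_mulmx !det_ublock !det_lblock !det1 !mulr1 !mul1r.
Qed.

Lemma horner_char_poly n (M : 'M[F]_n) z :
  (char_poly M).[z] = \det (z%:M - M).
Proof.
rewrite -[LHS]/(horner_eval z (char_poly M)) /char_poly -det_map_mx; congr (\det _).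
apply/matrixP => i j; rewrite !mxE rmorphB rmorphMn /= /horner_eval.
by rewrite hornerX hornerC.
Qed.

Lemma char_poly_conj n (A P Q : 'M[F]_n) : P *m Q = 1%:M ->
  char_poly (P *m A *m Q) = char_poly A.
Proof.
move=> PQ; rewrite /char_poly /char_poly_mx.
have QP := mulmx1C PQ.
have -> : 'X%:M - map_mx polyC (P *m A *m Q) =
    map_mx polyC P *m ('X%:M - map_mx polyC A) *m map_mx polyC Q.
  rewrite mulmxBr mulmxBl !map_mxM scalar_mxC.
  rewrite -[_%:M *m _ *m _]mulmxA -(map_mxM _ P Q) PQ map_mx1.
  by rewrite mulmx1.
rewrite !det_mulmx mulrAC -det_mulmx -map_mxM PQ map_mx1 det1 mul1r //.
Qed.

End LinearAlgebra.

Section Resolvent.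
Context {R : realType}.
Local Notation C := R[i].
Local Open Scope sesquilinear_scope.

Lemma horner_prod_eigenvals N (M : 'M[C]_N) z :
  \det (z%:M - M) = \prod_(l <- eigenvals M) (z - l).
Proof.
rewrite -horner_char_poly char_poly_eigenvals horner_prod.
by apply: eq_bigr => l _; rewrite !hornerE.
Qed.

(** With the adjugate the entries are visibly measurable in [h], and as
    [0^-1 = 0] the map commutes with unitary conjugation even when [z] is an
    eigenvalue. *)
Definition resolvent N (z : C) (h : 'M[C]_N) : 'M[C]_N :=
  (\det (z%:M - h))^-1 *: \adj (z%:M - h).

Lemma resolventE N z (h : 'M[C]_N) : \det (z%:M - h) != 0 ->
  resolvent z h = invmx (z%:M - h).
Proof. by move=> dn0; rewrite /invmx unitmxE unitfE dn0. Qed.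

Lemma cmod_conjC (z : C) : cmod (z^*)%R = cmod z.
Proof. by rewrite /cmod norm_conjC. Qed.

Lemma mulr_conjC (z : C) : z * (z^*)%R = (cmod z ^+ 2)%:C.
Proof. by rewrite -normCK normC_cmod rmorphXn. Qed.

Lemma unitary_mulC N (V : 'M[C]_N) : V \is unitarymx -> V^t* *m V = 1%:M.
Proof. by move/unitarymxP/mulmx1C. Qed.

Lemma adjointM m n p (A : 'M[C]_(m, n)) (B : 'M[C]_(n, p)) :
  (A *m B)^t* = B^t* *m A^t*.
Proof. by rewrite trmx_mul map_mxM. Qed.

Lemma adjointK m n (A : 'M[C]_(m, n)) : (A^t*)^t* = A.
Proof. by apply/matrixP => i j; rewrite !mxE conjCK. Qed.

Lemma det_conj N (V M : 'M[C]_N) : V \is unitarymx ->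
  \det (V *m M *m V^t*) = \det M.
Proof.
move=> uV; rewrite !det_mulmx mulrAC -det_mulmx (unitarymxP uV) det1.
by rewrite mul1r.
Qed.

Lemma sub_conj N (V h : 'M[C]_N) z : V \is unitarymx ->
  z%:M - V *m h *m V^t* = V *m (z%:M - h) *m V^t*.
Proof.
move=> uV; rewrite mulmxBr mulmxBl scalar_mxC -[_%:M *m _ *m _]mulmxA.
by rewrite (unitarymxP uV) mulmx1.
Qed.

Lemma resolvent_conj N (V h : 'M[C]_N) z : V \is unitarymx ->
  resolvent z (V *m h *m V^t*) = V *m resolvent z h *m V^t*.
Proof.
move=> uV; have dE : \det (z%:M - V *m h *m V^t*) = \det (z%:M - h).
  by rewrite sub_conj // det_conj.
have [d0|d0] := eqVneq (\det (z%:M - h)) 0.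
  by rewrite /resolvent dE d0 invr0 !scale0r mulmx0 mul0mx.
rewrite !resolventE ?dE // sub_conj //.
have um : z%:M - h \in unitmx by rewrite unitmxE unitfE.
have h1 : V *m (z%:M - h) *m V^t* *m (V *m invmx (z%:M - h) *m V^t*) = 1%:M.
  rewrite !mulmxA -[_ *m V^t* *m V]mulmxA unitary_mulC // mulmx1.
  by rewrite -[_ *m invmx _]mulmxA mulmxV // mulmx1 (unitarymxP uV).
have um2 : V *m (z%:M - h) *m V^t* \in unitmx by rewrite unitmxE det_conj // -unitmxE.
by apply: (can_inj (mulKmx um2)); rewrite mulmxV.
Qed.

Lemma resolvent_conjV N (V h : 'M[C]_N) z : V \is unitarymx ->
  resolvent z (V^t* *m h *m V) = V^t* *m resolvent z h *m V.
Proof.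
move=> uV; have uV' : V^t* \is unitarymx by rewrite trmxC_unitary.
by have := @resolvent_conj N (V^t*) h z uV'; rewrite adjointK.
Qed.

(** The squared Hilbert-Schmidt norm. *)
Definition hs2 N (M : 'M[C]_N) : R := \sum_i \sum_j cmod (M i j) ^+ 2.

Lemma mul_adjoint_diag N (M : 'M[C]_N) i :
  (M *m M^t*) i i = (\sum_j cmod (M i j) ^+ 2)%:C.
Proof.
rewrite mxE rmorph_sum; apply: eq_bigr => j _.
by rewrite !mxE mulr_conjC.
Qed.

Lemma hs2E N (M : 'M[C]_N) : (hs2 M)%:C = \tr (M *m M^t*).
Proof.
rewrite /mxtrace rmorph_sum; apply: eq_bigr => i _.
by rewrite mul_adjoint_diag.
Qed.

Lemma hs2_conj N (V M : 'M[C]_N) : V \is unitarymx ->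
  hs2 (V *m M *m V^t*) = hs2 M.
Proof.
move=> uV; apply: complexI; rewrite !hs2E !adjointM adjointK.
move: (unitary_mulC uV); move: (V^t*) (M^t*) => W M' WV.
rewrite -[V *m M *m W *m _]mulmxA [W *m _]mulmxA WV mul1mx mxtrace_mulC.
by rewrite -mulmxA [W *m _]mulmxA WV mul1mx mxtrace_mulC.
Qed.

Lemma hs2_conjV N (V M : 'M[C]_N) : V \is unitarymx ->
  hs2 (V^t* *m M *m V) = hs2 M.
Proof.
move=> uV; have uV' : V^t* \is unitarymx by rewrite trmxC_unitary.
by have := @hs2_conj N (V^t*) M uV'; rewrite adjointK.
Qed.

Lemma hermitian_diagonalization N (h : 'M[C]_N) : h \is hermsymmx ->
  exists (V : 'M[C]_N) (lam : 'rV[C]_N),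
    [/\ V \is unitarymx, forall k, lam 0 k \is Num.real,
        h = V^t* *m diag_mx lam *m V
      & perm_eq (eigenvals h) [seq lam 0 k | k <- enum 'I_N]].
Proof.
move=> hh; pose V := spectralmx h; pose lam := spectral_diag h.
have uV : V \is unitarymx := spectral_unitarymx h.
have hE : h = V^t* *m diag_mx lam *m V.
  by rewrite -invmx_unitary //; exact/orthomx_spectralP/hermitian_normalmx.
exists V, lam; split => //.
  by move=> k; exact: (mxOverP (hermitian_spectral_diag_real hh)).
apply: prod_XsubC_eq; rewrite -char_poly_eigenvals [in LHS]hE.
rewrite char_poly_conj ?unitary_mulC // char_poly_trig ?diag_mx_is_trig //.
rewrite big_map big_enum /=; apply: eq_bigr => k _.
by rewrite !mxE eqxx mulr1n.
Qed.

Section Hermitian.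
Variables (N : nat) (h : 'M[C]_N).
Hypothesis hh : h \is hermsymmx.

Lemma eigenvals_real l : l \in eigenvals h -> l = (complex.Re l)%:C.
Proof.
have [V [lam [_ lr _ /perm_mem ->]]] := hermitian_diagonalization hh.
by move=> /mapP[k _ ->]; rewrite RRe_real.
Qed.

Lemma resolvent_diag V (lam : 'rV[C]_N) z : V \is unitarymx ->
  h = V^t* *m diag_mx lam *m V -> (forall k, z != lam 0 k) ->
  resolvent z h = V^t* *m diag_mx (\row_k (z - lam 0 k)^-1) *m V.
Proof.
move=> uV hE zl; rewrite [X in resolvent z X]hE (resolvent_conjV (diag_mx lam) z uV).
suff -> : resolvent z (diag_mx lam) = diag_mx (\row_k (z - lam 0 k)^-1) by [].
have zd : z%:M - diag_mx lam = diag_mx (\row_k (z - lam 0 k)).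
  by apply/matrixP => i j; rewrite !mxE; case: (i == j);
    rewrite ?mulr1n // !mulr0n subr0.
have dn0 : \det (z%:M - diag_mx lam) != 0.
  by rewrite zd det_diag prodf_seq_neq0; apply/allP => k _; rewrite /= mxE subr_eq0.
rewrite resolventE //.
have um : z%:M - diag_mx lam \in unitmx by rewrite unitmxE unitfE.
apply: (can_inj (mulKmx um)); rewrite mulmxV // zd mulmx_diag -diag_const_mx.
by congr diag_mx; apply/rowP => k; rewrite !mxE mulfV // subr_eq0.
Qed.

Lemma resolvent_entry V (lam : 'rV[C]_N) z i j : V \is unitarymx ->
  h = V^t* *m diag_mx lam *m V -> (forall k, z != lam 0 k) ->
  resolvent z h i j = \sum_k ((V k i)^*)%R * V k j * (z - lam 0 k)^-1.
Proof.
move=> uV hE zl; rewrite (resolvent_diag uV hE zl) mul_mx_diag mxE.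
by apply: eq_bigr => k _; rewrite !mxE mulrAC.
Qed.

Lemma sum_unitary_le1 (V : 'M[C]_N) i j : V \is unitarymx ->
  \sum_k cmod (((V k i)^*)%R * V k j) <= 1.
Proof.
move=> uV; have s1 a : \sum_k cmod (V k a) ^+ 2 = 1.
  apply: complexI; have := congr1 (fun M : 'M[C]_N => M a a) (unitary_mulC uV).
  rewrite !mxE eqxx mulr1n => E; apply: etrans _ E; rewrite rmorph_sum.
  apply: eq_bigr => k _.
  by rewrite !mxE mulrC mulr_conjC.
apply: (@le_trans _ _ (\sum_k (cmod (V k i) ^+ 2 + cmod (V k j) ^+ 2) / 2)).
  apply: ler_sum => k _; rewrite cmodM cmod_conjC.
  have := sqr_ge0 (cmod (V k i) - cmod (V k j)); rewrite sqrrB; lra.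
by rewrite -mulr_suml big_split /= !s1; lra.
Qed.

(** In an eigenbasis an entry of the resolvent is an average of the numbers
    [(z - l)^-1] with weights of total mass at most [1]. *)
Lemma resolvent_bound (d : R) z i j : 0 < d ->
  {in eigenvals h, forall l, d <= cmod (z - l)} ->
  cmod (resolvent z h i j) <= d^-1.
Proof.
move=> d0 hz; have [V [lam [uV _ hE pe]]] := hermitian_diagonalization hh.
have hz' k : d <= cmod (z - lam 0 k).
  by apply: hz; rewrite (perm_mem pe); apply/map_f; rewrite mem_enum.
have zl k : z != lam 0 k by rewrite -subr_eq0 -cmod_gt0 (lt_le_trans d0).
rewrite (resolvent_entry i j uV hE zl) (le_trans (cmod_sum _ _ _)) //.
apply: (@le_trans _ _ (\sum_k cmod (((V k i)^*)%R * V k j) * d^-1)).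
  apply: ler_sum => k _; rewrite cmodM ler_wpM2l ?cmod_ge0 // cmodV.
  by rewrite lef_pV2 ?posrE // (lt_le_trans d0).
by rewrite -mulr_suml ler_piMl ?sum_unitary_le1 // invr_ge0 ltW.
Qed.

Lemma resolvent_lip (d : R) z w i j : 0 < d ->
  {in eigenvals h, forall l, d <= cmod (z - l)} ->
  {in eigenvals h, forall l, d <= cmod (w - l)} ->
  cmod (resolvent z h i j - resolvent w h i j) <= cmod (z - w) / d ^+ 2.
Proof.
move=> d0 hz hw; have [V [lam [uV _ hE pe]]] := hermitian_diagonalization hh.
have le k : lam 0 k \in eigenvals h.
  by rewrite (perm_mem pe); apply/map_f; rewrite mem_enum.
have zl k : z != lam 0 k by rewrite -subr_eq0 -cmod_gt0 (lt_le_trans d0) ?hz.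
have wl k : w != lam 0 k by rewrite -subr_eq0 -cmod_gt0 (lt_le_trans d0) ?hw.
rewrite [X in cmod (X - resolvent w h i j)](resolvent_entry i j uV hE zl).
rewrite [X in cmod (\sum_k _ - X)](resolvent_entry i j uV hE wl) -sumrB.
rewrite (le_trans (cmod_sum _ _ _)) //.
apply: (@le_trans _ _ (\sum_k cmod (((V k i)^*)%R * V k j) * (cmod (z - w) / d ^+ 2))).
  apply: ler_sum => k _; rewrite -mulrBr cmodM ler_wpM2l ?cmod_ge0 //.
  rewrite (_ : z - w = (z - lam 0 k) - (w - lam 0 k)); last by ring.
  by apply: cmod_invB; rewrite ?hz ?hw.
rewrite -mulr_suml ler_piMl ?sum_unitary_le1 //.
by rewrite divr_ge0 ?cmod_ge0 ?exprn_ge0 // ltW.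
Qed.

Lemma hs2_resolvent (d : R) z : 0 < d ->
  {in eigenvals h, forall l, d <= cmod (z - l)} ->
  hs2 (resolvent z h) <= N%:R * d^-1 ^+ 2.
Proof.
move=> d0 hz; have [V [lam [uV _ hE pe]]] := hermitian_diagonalization hh.
have hz' k : d <= cmod (z - lam 0 k).
  by apply: hz; rewrite (perm_mem pe); apply/map_f; rewrite mem_enum.
have zl k : z != lam 0 k by rewrite -subr_eq0 -cmod_gt0 (lt_le_trans d0).
rewrite (resolvent_diag uV hE zl).
rewrite hs2_conjV //.
rewrite /hs2 -[X in X%:R](card_ord N) -sum1_card natr_sum mulr_suml.
apply: ler_sum => k _; rewrite mul1r (bigD1 k) //= big1 ?addr0.
  rewrite !mxE eqxx mulr1n ler_pXn2r ?nnegrE ?cmod_ge0 ?invr_ge0 ?(ltW d0) //.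
  by rewrite cmodV lef_pV2 ?posrE // (lt_le_trans d0).
by move=> l lk; rewrite !mxE eq_sym (negbTE lk) mulr0n cmod0 expr0n.
Qed.

Lemma trace_resolvent z : {in eigenvals h, forall l, z != l} ->
  \tr (resolvent z h) = \sum_(l <- eigenvals h) (z - l)^-1.
Proof.
move=> hz; have [V [lam [uV _ hE pe]]] := hermitian_diagonalization hh.
have zl k : z != lam 0 k.
  by apply: hz; rewrite (perm_mem pe); apply/map_f; rewrite mem_enum.
rewrite (perm_big _ pe) big_map big_enum /= (resolvent_diag uV hE zl).
rewrite mxtrace_mulC mulmxA (unitarymxP uV) mul1mx mxtrace_diag.
by apply: eq_bigr => k _; rewrite mxE.
Qed.

End Hermitian.

Lemma eigenvals_conj N (V h : 'M[C]_N) : V \is unitarymx ->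
  perm_eq (eigenvals (V *m h *m V^t*)) (eigenvals h).
Proof.
move=> uV; apply: prod_XsubC_eq.
apply: etrans (esym (char_poly_eigenvals _)) _; apply: etrans _ (char_poly_eigenvals h).
exact: char_poly_conj (unitarymxP uV).
Qed.

Lemma hermsymmx_conj N (V h : 'M[C]_N) : h \is hermsymmx ->
  V *m h *m V^t* \is hermsymmx.
Proof.
move=> /is_hermitianmxP; rewrite expr0 scale1r => hE.
apply/is_hermitianmxP; rewrite expr0 scale1r !adjointM adjointK -hE.
by rewrite mulmxA.
Qed.

(** The determinant of the perturbed matrix only involves the compression of
    the resolvent to the range of the perturbation. *)
Lemma det_perturbation N n (h : 'M[C]_N) (U : 'M[C]_(N, n)) (A0 : 'M[C]_n) z :
  \det (z%:M - h) != 0 ->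
  \det (z%:M - (h + U *m A0 *m U^t*)) =
  \det (z%:M - h) * \det (1%:M - U^t* *m resolvent z h *m U *m A0).
Proof.
move=> d0; have um : z%:M - h \in unitmx by rewrite unitmxE unitfE.
rewrite resolventE //.
have -> : z%:M - (h + U *m A0 *m U^t*) =
    (z%:M - h) *m (1%:M - invmx (z%:M - h) *m U *m A0 *m U^t*).
  by rewrite mulmxBr mulmx1 !mulmxA mulmxV // mul1mx opprD addrA.
rewrite det_mulmx det_1subMC; congr (_ * \det (_ - _)).
by rewrite !mulmxA.
Qed.

End Resolvent.

(** * Matrices as a measurable space *)

(** This alias carries the base point that a measurable type needs. *)
Definition mx_space (R : realType) (N : nat) : Type := 'M[R[i]]_N.

HB.instance Definition _ R N := Choice.on (mx_space R N).
HB.instance Definition _ R N := isPointed.Build (mx_space R N) (const_mx 0).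

Definition mx_gens (R : realType) (N : nat) : set (set (mx_space R N)) :=
  @mx_gen R N.

Section MatrixSpace.
Context {R : realType}.
Local Notation C := R[i].
Local Open Scope sesquilinear_scope.

Local Notation mxT N := (g_sigma_algebraType (@mx_gens R N)).

Lemma cmeasurable_entry N (i j : 'I_N) : cmeasurable (fun h : mxT N => h i j).
Proof.
split=> _ B mB; rewrite setTI; apply: sub_sigma_algebra; exists i, j, B; split => //.
  by left.
by right.
Qed.

Lemma measurable_mx {d} {T : measurableType d} N (f : T -> mxT N) :
  (forall i j, cmeasurable (fun x => f x i j)) -> measurable_fun setT f.
Proof.
move=> hf; apply: (@measurability _ _ T (mxT N) setT f (@mx_gens R N)) => //.
move=> _ [_ [i [j [B [mB [->|->]]]]] <-].
  by have [h _] := hf i j; exact: h.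
by have [_ h] := hf i j; exact: h.
Qed.

Lemma measurable_random_mx {d} {T : measurableType d} N (X : T -> 'M[C]_N) :
  random_mx X <-> measurable_fun setT (X : T -> mxT N).
Proof.
split=> [hX _ B mB|hX B mB]; first by rewrite setTI; exact: hX.
by have := hX measurableT B mB; rewrite setTI.
Qed.

Lemma measurable_conj N (V : 'M[C]_N) :
  measurable_fun setT (fun h : mxT N => V *m h *m V^t* : mxT N).
Proof.
apply: measurable_mx => i j; under eq_fun do rewrite mxE.
apply: cmeasurable_sum => k; apply: cmeasurableM; last exact: cmeasurable_cst.
under eq_fun do rewrite mxE; apply: cmeasurable_sum => l.
by apply: cmeasurableM; [exact: cmeasurable_cst|exact: cmeasurable_entry].
Qed.

Lemma cmeasurable_resolvent N z (i j : 'I_N) :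
  cmeasurable (fun h : mxT N => resolvent z h i j).
Proof.
have ms a b : cmeasurable (fun h : mxT N => (z%:M - h) a b).
  under eq_fun do rewrite !mxE; apply: cmeasurableD; first exact: cmeasurable_cst.
  by apply: cmeasurableN; exact: cmeasurable_entry.
rewrite /resolvent; under eq_fun do rewrite mxE; apply: cmeasurableM.
  by apply: cmeasurableV; exact: cmeasurable_det.
exact: cmeasurable_adj.
Qed.

End MatrixSpace.

Section UnitaryInvariance.
Context {R : realType} {d : measure_display} {T : measurableType d}
  (P : probability T R) (N : nat) (H : T -> 'M[R[i]]_N).
Local Notation C := R[i].
Local Open Scope sesquilinear_scope.
Local Notation mxT N := (g_sigma_algebraType (@mx_gens R N)).
Hypothesis mH : random_mx H.
Hypothesis Hinv : forall V : 'M[C]_N, V \is unitarymx ->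
  same_law P (fun w => V *m H w *m V^t*) H.

Definition bounded_meas (f : mxT N -> R) :=
  measurable_fun setT f /\ exists B, forall h, `|f h| <= B.

Definition mean (f : mxT N -> R) : R := Rintegral P setT (fun w => f (H w)).

Lemma bounded_measD f g : bounded_meas f -> bounded_meas g ->
  bounded_meas (fun h => f h + g h).
Proof.
move=> [mf [B hB]] [mg [B' hB']]; split; first exact: measurable_funD.
by exists (B + B') => h; apply: le_trans (ler_normD _ _) (lerD _ _).
Qed.

Lemma bounded_measZ a f : bounded_meas f -> bounded_meas (fun h => a * f h).
Proof.
move=> [mf [B hB]]; split; first by apply: measurable_funM => //; exact: measurable_cst.
by exists (`|a| * B) => h; rewrite normrM ler_wpM2l.
Qed.

Lemma bounded_meas_sum (I : Type) (r : seq I) (Q : pred I) (F : I -> mxT N -> R) :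
  (forall i, bounded_meas (F i)) -> bounded_meas (fun h => \sum_(i <- r | Q i) F i h).
Proof.
move=> hF; elim: r => [|i r ih].
  under eq_fun do rewrite big_nil; split; first exact: measurable_cst.
  by exists 0 => h; rewrite normr0.
under eq_fun do rewrite big_cons; case: (Q i) => //.
exact: bounded_measD.
Qed.

Lemma bounded_meas_int f : bounded_meas f ->
  P.-integrable setT (EFin \o (fun w => f (H w))).
Proof.
move=> [mf [B hB]]; apply: measurable_bounded_integrable => //.
- by apply: (le_lt_trans (probability_le1 P measurableT)); rewrite ltry.
- by apply: measurableT_comp mf _; apply/measurable_random_mx.
- exists B; split; first exact: num_real.
  by move=> M BM x _ /=; apply: le_trans (hB _) (ltW BM).
Qed.

Lemma le_mean f g : bounded_meas f -> bounded_meas g ->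
  (forall h, f h <= g h) -> mean f <= mean g.
Proof.
by move=> bf bg fg; apply: le_Rintegral => //; exact: bounded_meas_int.
Qed.

Lemma meanD f g : bounded_meas f -> bounded_meas g ->
  mean (fun h => f h + g h) = mean f + mean g.
Proof.
move=> bf bg; exact: (RintegralD _ (bounded_meas_int bf) (bounded_meas_int bg)).
Qed.

Lemma meanZ a f : bounded_meas f -> mean (fun h => a * f h) = a * mean f.
Proof. by move=> bf; exact: (RintegralZl _ _ (bounded_meas_int bf)). Qed.

Lemma mean_cst a : mean (fun=> a) = a.
Proof.
rewrite /mean Rintegral_cst //; suff -> : fine (P setT) = 1 by rewrite mulr1.
by rewrite -[RHS]/(fine 1%E); congr fine; exact: probability_setT.
Qed.

Lemma mean_sum (I : Type) (r : seq I) (Q : pred I) (F : I -> mxT N -> R) :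
  (forall i, bounded_meas (F i)) ->
  mean (fun h => \sum_(i <- r | Q i) F i h) = \sum_(i <- r | Q i) mean (F i).
Proof.
move=> hF; elim: r => [|i r ih].
  by under eq_fun do rewrite big_nil; rewrite big_nil mean_cst.
under eq_fun do rewrite big_cons; rewrite big_cons; case: (Q i) => //.
by rewrite meanD ?ih //; exact: bounded_meas_sum.
Qed.

Lemma mean_conj V f : V \is unitarymx -> bounded_meas f ->
  mean (fun h => f (V *m h *m V^t*)) = mean f.
Proof.
move=> uV [mf [B hB]]; rewrite /mean /Rintegral; congr fine.
have mX : measurable_fun setT (H : T -> mxT N) by apply/measurable_random_mx.
have mY : measurable_fun setT (fun w => V *m H w *m V^t* : mxT N).
  exact: (measurableT_comp (measurable_conj V) mX).
pose X : {mfun T >-> mxT N} := HB.pack (H : T -> mxT N) (isMeasurableFun.Build _ _ _ _ _ mX).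
pose Y : {mfun T >-> mxT N} :=
  HB.pack (fun w => V *m H w *m V^t* : mxT N) (isMeasurableFun.Build _ _ _ _ _ mY).
have mf' : measurable_fun setT (EFin \o f) by exact/measurable_EFinP.
have iX := bounded_meas_int (conj mf (ex_intro _ B hB)).
transitivity (\int[distribution P Y]_h (EFin \o f) h)%E.
  rewrite integral_distribution //.
  apply: measurable_bounded_integrable => //.
  - by apply: (le_lt_trans (probability_le1 P measurableT)); rewrite ltry.
  - exact: measurableT_comp mf mY.
  - exists B; split; first exact: num_real.
    by move=> M BM x _ /=; apply: le_trans (hB _) (ltW BM).
transitivity (\int[distribution P X]_h (EFin \o f) h)%E; last first.
  by rewrite integral_distribution.
apply: eq_measure_integral => B' mB' _; exact: (Hinv uV mB').
Qed.

Lemma measurable_mean_set f c : bounded_meas f -> measurable [set w | c <= f (H w)].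
Proof.
move=> [mf _].
have mfH : measurable_fun setT (fun w => f (H w)).
  by apply: measurableT_comp mf _; apply/measurable_random_mx.
rewrite -[X in measurable X]setTI.
have -> : [set w | c <= f (H w)] = (fun w => f (H w)) @^-1` `[c, +oo[%classic.
  by apply/seteqP; split => w /=; rewrite in_itv /= andbT.
by apply: mfH => //; exact: measurable_itv.
Qed.

Lemma markov_mean f c : 0 < c -> bounded_meas f -> (forall h, 0 <= f h) ->
  fine (P [set w | c <= f (H w)]) <= mean f / c.
Proof.
move=> c0 bf f0; have [mf _] := bf.
have mfH : measurable_fun setT (fun w => f (H w)).
  by apply: measurableT_comp mf _; apply/measurable_random_mx.
have mS := measurable_mean_set c bf.
rewrite ler_pdivlMr // -lee_fin EFinM fineK ?fin_num_measure // /mean /Rintegral.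
rewrite fineK; last exact: integrable_fin_num (bounded_meas_int bf).
rewrite muleC -integral_cst //.
apply: (@le_trans _ _ (\int[P]_(w in [set w | (c <= f (H w))%R]) (f (H w))%:E)%E).
  apply: ge0_le_integral => //.
  - by move=> w _; rewrite lee_fin ltW.
  - by apply/measurable_EFinP; exact: measurable_funTS.
apply: ge0_subset_integral => //.
- exact/measurable_EFinP.
- by move=> w _; rewrite lee_fin.
Qed.

End UnitaryInvariance.

(** * Concentration of the entries of the resolvent *)

Section Reflection.
Context {R : realType} (N : nat).
Local Notation C := R[i].
Local Open Scope sesquilinear_scope.

Lemma sum_delta (f : 'I_N -> C) i : \sum_a (a == i)%:R * f a = f i.
Proof.
rewrite (bigD1 i) //= eqxx mul1r big1 ?addr0 // => a /negbTE ->.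
by rewrite mul0r.
Qed.

Lemma perm_mx_unitary (s : 'S_N) : (perm_mx s : 'M[C]_N) \is unitarymx.
Proof.
apply/unitarymxP; rewrite tr_perm_mx map_perm_mx -perm_mxM mulgV.
by rewrite perm_mx1.
Qed.

Lemma perm_conj_entry (s : 'S_N) (M : 'M[C]_N) i j :
  (perm_mx s *m M *m (perm_mx s)^t*) i j = M (s i) (s j).
Proof.
by rewrite tr_perm_mx map_perm_mx -row_permE -col_permE !mxE.
Qed.

(** The reflection in the hyperplane orthogonal to [v = e_i - 2 e_j]: on the
    coordinates [i, j] it acts by the matrix [3/5 4/5; 4/5 -3/5]. *)
Definition reflection (i j : 'I_N) : 'M[C]_N :=
  let v : 'cV[C]_N := \col_a ((a == i)%:R - 2 * (a == j)%:R) in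
  1%:M - (2 / 5) *: (v *m v^T).

Section Plane.
Variables (i j : 'I_N).
Hypothesis ij : i != j.

Lemma reflection_adjoint : (reflection i j)^t* = reflection i j.
Proof.
rewrite /reflection; set v : 'cV[C]_N := \col_a _.
have cv : map_mx Num.conj v = v.
  by apply/matrixP => a b; rewrite !mxE rmorphB rmorphM /= !rmorph_nat.
rewrite linearB linearZ /= trmx1 trmx_mul trmxK map_mxB map_mx1 map_mxZ map_mxM /=.
by rewrite -map_trmx cv fmorph_div /= !rmorph_nat.
Qed.

Lemma reflection_unitary : reflection i j \is unitarymx.
Proof.
have ji : j != i by rewrite eq_sym.
apply/unitarymxP; rewrite reflection_adjoint /reflection.
set v : 'cV[C]_N := \col_a _.
have vv : v^T *m v = 5%:M.
  apply/matrixP => a b; rewrite !ord1 !mxE eqxx mulr1n.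
  under eq_bigr => c _ do rewrite !mxE mulrBl -mulrA.
  rewrite sumrB -mulr_sumr !sum_delta !eqxx (negbTE ij) (negbTE ji) /=.
  by ring.
rewrite mulmxBl mul1mx mulmxBr mulmx1 -!scalemxAl -!scalemxAr.
rewrite mulmxA -[v *m v^T *m v]mulmxA vv mul_mx_scalar -scalemxAl !scalerA.
have -> : (2 / 5 * (2 / 5 * 5) : C) = 2 / 5 + 2 / 5 by field.
by rewrite scalerDl opprB addrK subrK.
Qed.

Lemma reflection_conj_entry (S : 'M[C]_N) :
  (reflection i j *m S *m (reflection i j)^t*) i j =
  12 / 25 * (S i i - S j j) - 9 / 25 * S i j + 16 / 25 * S j i.
Proof.
have ji : j != i by rewrite eq_sym.
have ri a : reflection i j i a = 3 / 5 * (a == i)%:R + 4 / 5 * (a == j)%:R.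
  rewrite !mxE big_ord1 !mxE eqxx (negbTE ij) [i == a]eq_sym /=.
  by field.
have rj a : reflection i j a j = 4 / 5 * (a == i)%:R - 3 / 5 * (a == j)%:R.
  rewrite !mxE big_ord1 !mxE eqxx (negbTE ji) /=.
  by field.
rewrite reflection_adjoint mxE.
under eq_bigr => b _ do rewrite rj mulrBr !mulrA
  ![_ * _ * (_ == _)%:R]mulrC -!mulrA.
rewrite sumrB !sum_delta.
have row b : (reflection i j *m S) i b = 3 / 5 * S i b + 4 / 5 * S j b.
  rewrite mxE; under eq_bigr => a _ do rewrite ri mulrDl -!mulrA.
  by rewrite big_split /= -!mulr_sumr !sum_delta !mulrA.
by rewrite !row; field.
Qed.

End Plane.
End Reflection.

Section SecondMoment.
Context {R : realType} {d : measure_display} {T : measurableType d}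
  (P : probability T R) (N : nat) (H : T -> 'M[R[i]]_N).
Local Notation C := R[i].
Local Open Scope sesquilinear_scope.
Local Notation mxT N := (g_sigma_algebraType (@mx_gens R N)).
Hypothesis mH : random_mx H.
Hypothesis Hinv : forall V : 'M[C]_N, V \is unitarymx ->
  same_law P (fun w => V *m H w *m V^t*) H.
Variables (z : C) (K2 : R).
Hypothesis K20 : 0 <= K2.
Hypothesis N2 : (1 < N)%N.
Local Notation Rz := (@resolvent R N z).
Local Notation E := (mean P H).

(** Cutting off by a unitarily invariant event makes the moments finite. *)
Definition cutoff (h : 'M[C]_N) : R :=
  if hs2 (Rz h) <= N%:R * K2 then 1 else 0.

Lemma cutoff_conj V h : V \is unitarymx -> cutoff (V *m h *m V^t*) = cutoff h.
Proof. by move=> uV; rewrite /cutoff resolvent_conj // hs2_conj. Qed.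

Lemma cutoff_ge0 h : 0 <= cutoff h.
Proof. by rewrite /cutoff; case: ifP. Qed.

Lemma measurable_cutoff : measurable_fun setT (cutoff : mxT N -> R).
Proof.
have mh : measurable_fun setT (fun h : mxT N => hs2 (Rz h)).
  apply: measurable_sum => i; apply: measurable_sum => j.
  exact: (measurable_cmod_sqr (cmeasurable_resolvent z i j)).
have mb : measurable_fun setT (fun h : mxT N => hs2 (Rz h) <= N%:R * K2).
  by apply: measurable_fun_ler => //; exact: measurable_cst.
by apply: measurable_fun_ifT => //; exact: measurable_cst.
Qed.

Lemma cmod_le_hs2 (M : 'M[C]_N) i j : cmod (M i j) ^+ 2 <= hs2 M.
Proof.
rewrite /hs2 (bigD1 i) //= (bigD1 j) //= -addrA lerDl addr_ge0 //.
  by apply: sumr_ge0 => *; exact: sqr_ge0.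
by apply: sumr_ge0 => *; apply: sumr_ge0 => *; exact: sqr_ge0.
Qed.

Definition weight (F : 'M[C]_N -> C) (h : mxT N) : R := cutoff h * cmod (F (Rz h)) ^+ 2.

Lemma weight_ge0 F h : 0 <= weight F h.
Proof. by rewrite mulr_ge0 ?cutoff_ge0 ?sqr_ge0. Qed.

Lemma weight_entry i j : bounded_meas (weight (fun M => M i j)).
Proof.
split.
  apply: measurable_funM; first exact: measurable_cutoff.
  exact: (measurable_cmod_sqr (cmeasurable_resolvent z i j)).
exists (N%:R * K2) => h; rewrite ger0_norm ?weight_ge0 // /weight /cutoff.
case: ifP => [hs|_]; last by rewrite mul0r mulr_ge0.
by rewrite mul1r; apply: le_trans hs; exact: cmod_le_hs2.
Qed.

Lemma weight_bounded F (g : mxT N -> R) :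
  cmeasurable (fun h : mxT N => F (Rz h)) -> bounded_meas g ->
  (forall h, weight F h <= g h) -> bounded_meas (weight F).
Proof.
move=> mF [_ [B hB]] Fg; split.
  by apply: measurable_funM; [exact: measurable_cutoff|exact: measurable_cmod_sqr].
exists B => h; rewrite ger0_norm ?weight_ge0 //.
by apply: le_trans (Fg h) (le_trans (ler_norm _) (hB h)).
Qed.

Local Notation q i j := (E (weight (fun M => M i j))).

Lemma q_perm (s : 'S_N) i j : q (s i) (s j) = q i j.
Proof.
rewrite -(mean_conj mH Hinv (perm_mx_unitary s) (weight_entry i j)).
congr (mean P H _); apply/funext => h.
rewrite /weight cutoff_conj ?perm_mx_unitary // resolvent_conj ?perm_mx_unitary //.
by rewrite perm_conj_entry.
Qed.

Lemma q_offdiag i j k l : i != j -> k != l -> q i j = q k l.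
Proof.
move=> ij kl; pose s := (tperm i k * tperm (tperm i k j) l)%g.
have si : s i = k.
  rewrite permM tpermL tpermD //; last by rewrite eq_sym.
  by rewrite -[k in _ != k](tpermL i k) (inj_eq perm_inj) eq_sym.
have sj : s j = l by rewrite permM tpermL.
by rewrite -si -sj q_perm.
Qed.

(** Permutation matrices are unitary, hence all off-diagonal entries have the same
    second moment, while the total of the second moments is at most [N * K2]. *)
Lemma q_offdiag_le i j : i != j -> q i j <= K2 / (N%:R - 1).
Proof.
move=> ij; have N1 : 0 < N%:R - 1 :> R by rewrite subr_gt0 ltr1n.
have N0 : 0 < N%:R :> R by rewrite ltr0n (ltn_trans _ N2).
have tot : \sum_k \sum_l q k l <= N%:R * K2.
  have tr k : \sum_l q k l = E (fun h => \sum_l weight (fun M => M k l) h).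
    by rewrite (mean_sum P mH) // => l; exact: weight_entry.
  rewrite (eq_bigr _ (fun k _ => tr k)) -(mean_sum P mH); last by move=> k; apply: bounded_meas_sum => l; exact: weight_entry.
  rewrite -[leRHS](mean_cst P H); apply: (le_mean P mH).
  - by apply: bounded_meas_sum => k; apply: bounded_meas_sum => l; exact: weight_entry.
  - by split; [exact: measurable_cst|exists `|N%:R * K2|].
  - move=> h; rewrite /weight; under eq_bigr => k _ do rewrite -mulr_sumr.
    rewrite -mulr_sumr -/(hs2 (Rz h)) /cutoff; case: ifP => hs.
      by rewrite mul1r.
    by rewrite mul0r mulr_ge0.
have off : N%:R * ((N%:R - 1) * q i j) <= \sum_k \sum_l q k l.
  rewrite mulr_natl -[X in _ *+ X](card_ord N) -sumr_const; apply: ler_sum => k _.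
  have cN : (N%:R - 1 : R) = (N.-1)%:R by rewrite -subn1 natrB // (ltn_trans _ N2).
  rewrite cN mulr_natl (bigD1 k) //=.
  have -> : q i j *+ N.-1 = \sum_(l < N | l != k) q k l.
    rewrite (eq_bigr (fun=> q i j)); last first.
      by move=> l lk; apply: q_offdiag => //; rewrite eq_sym.
    by rewrite sumr_const; congr (_ *+ _); rewrite cardC1 card_ord.
  rewrite lerDr -(mean_cst P H 0); apply: (le_mean P mH).
  - by split; [exact: measurable_cst|exists 0 => h; rewrite normr0].
  - exact: weight_entry.
  - by move=> h; exact: weight_ge0.
rewrite ler_pdivlMr // mulrC -(ler_pM2l N0); exact: le_trans off tot.
Qed.

Lemma cmod_sum3 (a b c : C) :
  cmod (a + b + c) ^+ 2 <= 3 * (cmod a ^+ 2 + cmod b ^+ 2 + cmod c ^+ 2).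
Proof.
have h1 := ler_cmodD (a + b) c; have h2 := ler_cmodD a b.
have h : cmod (a + b + c) <= cmod a + cmod b + cmod c.
  by apply: le_trans h1 _; rewrite lerD2r.
apply: (@le_trans _ _ ((cmod a + cmod b + cmod c) ^+ 2)).
  by rewrite ler_pXn2r ?nnegrE ?addr_ge0 ?cmod_ge0.
have := sqr_ge0 (cmod a - cmod b); have := sqr_ge0 (cmod b - cmod c).
have := sqr_ge0 (cmod a - cmod c); nra.
Qed.

(** Conjugating by a reflection turns an off-diagonal entry into a combination
    that contains the difference of two diagonal entries; hence diagonal
    differences are as small in mean square as off-diagonal entries. *)
Lemma diag_diff i j : i != j ->
  let F M : C := (M : 'M[C]_N) i i - M j j in
  bounded_meas (weight F) /\ E (weight F) <= 21 * (K2 / (N%:R - 1)).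
Proof.
move=> ij F; have ji : j != i by rewrite eq_sym.
pose V : 'M[C]_N := reflection i j.
have uV : V \is unitarymx := reflection_unitary ij.
pose g (a b c : R) h := 3 * (a * weight (fun M => M i j) (V *m h *m V^t*) +
  b * weight (fun M => M i j) h + c * weight (fun M => M j i) h).
have b1 : bounded_meas (fun h => weight (fun M => M i j) (V *m h *m V^t*)).
  have [m1 [B hB]] := weight_entry i j; split; last by exists B => h; exact: hB.
  exact: (measurableT_comp m1 (measurable_conj V)).
have we1 := weight_entry i j; have we2 := weight_entry j i.
have lin a b c : bounded_meas (g a b c) /\
    E (g a b c) = 3 * (a * q i j + b * q i j + c * q j i).
  have c1 := bounded_measZ a b1; have c2 := bounded_measZ b we1.
  have c3 := bounded_measZ c we2.
  have c12 := bounded_measD c1 c2; have c123 := bounded_measD c12 c3.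
  split; first exact: (bounded_measZ 3 c123).
  have Ea := etrans (meanZ P mH a b1)
    (f_equal (fun x => a * x) (mean_conj mH Hinv uV we1)).
  have Eab := etrans (meanD P mH c1 c2) (f_equal2 +%R Ea (meanZ P mH b we1)).
  have Eabc := etrans (meanD P mH c12 c3) (f_equal2 +%R Eab (meanZ P mH c we2)).
  exact (etrans (meanZ P mH 3 c123) (f_equal (fun x => 3 * x) Eabc)).
(* Solving the entry of the reflected matrix for [S i i - S j j] gives the
   coefficients [25/12], [3/4], [-4/3]; [3] times the sum of their squares is
   less than [21]. *)
have [bg Eg] := lin ((25 / 12) ^+ 2) ((3 / 4) ^+ 2) ((4 / 3) ^+ 2).
have Fg h : weight F h <= g ((25 / 12) ^+ 2) ((3 / 4) ^+ 2) ((4 / 3) ^+ 2) h.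
  rewrite /g /weight cutoff_conj // resolvent_conj // reflection_conj_entry //.
  set S := Rz h; set r := 12 / 25 * _ - _ + _.
  have e1 : (25 / 12 : C) = (25 / 12 : R)%:C by rewrite fmorph_div /= !rmorph_nat.
  have e2 : (3 / 4 : C) = (3 / 4 : R)%:C by rewrite fmorph_div /= !rmorph_nat.
  have e3 : (4 / 3 : C) = (4 / 3 : R)%:C by rewrite fmorph_div /= !rmorph_nat.
  have -> : F S = (25 / 12 : R)%:C * r + (3 / 4 : R)%:C * S i j
      + - ((4 / 3 : R)%:C * S j i).
    by rewrite -e1 -e2 -e3 /F /r; field.
  have cR (x : R) : 0 <= x -> cmod (x%:C : C) = x.
    by move=> x0; rewrite cmod_real ger0_norm.
  apply: le_trans (ler_wpM2l (cutoff_ge0 h) (cmod_sum3 _ _ _)) _.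
  rewrite cmodN !cmodM !cR //.
  rewrite le_eqVlt; apply/orP; left; apply/eqP; ring.
have bF : bounded_meas (weight F).
  apply: weight_bounded bg Fg.
  apply: cmeasurableD; first exact: cmeasurable_resolvent.
  by apply: cmeasurableN; exact: cmeasurable_resolvent.
split=> //; apply: le_trans (le_mean P mH bF bg Fg) _.
rewrite Eg.
have := q_offdiag_le ij; have := q_offdiag_le ji.
rewrite (q_offdiag ji ij); set x := E _ => _ hx.
have x0 : 0 <= x.
  rewrite -(mean_cst P H 0); apply: (le_mean P mH).
  - by split; [exact: measurable_cst|exists 0 => h; rewrite normr0].
  - exact: weight_entry.
  - by move=> h; exact: weight_ge0.
by lra.
Qed.

End SecondMoment.

Lemma sqr_sum_le (R : realType) (N : nat) (a : 'I_N -> R) :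
  (\sum_i a i) ^+ 2 <= N%:R * \sum_i a i ^+ 2.
Proof.
have h : 0 <= \sum_i \sum_j (a i - a j) ^+ 2.
  by apply: sumr_ge0 => i _; apply: sumr_ge0 => j _; exact: sqr_ge0.
have inner i : \sum_j (a i - a j) ^+ 2 =
    N%:R * a i ^+ 2 - 2 * a i * (\sum_j a j) + \sum_j a j ^+ 2.
  under eq_bigr => j _ do rewrite sqrrB.
  rewrite big_split /= sumrB sumr_const card_ord mulr_natl.
  congr (_ - _ + _); rewrite mulr_sumr; apply: eq_bigr => j _.
  by rewrite -mulr_natl mulrA.
have outer : \sum_i \sum_j (a i - a j) ^+ 2 =
    2 * (N%:R * (\sum_i a i ^+ 2) - (\sum_i a i) ^+ 2).
  under eq_bigr => i _ do rewrite inner.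
  rewrite big_split /= sumrB -mulr_sumr sumr_const card_ord -mulr_suml -mulr_sumr.
  by rewrite -(mulr_natl (\sum_j _) N); ring.
by move: h; rewrite outer; lra.
Qed.

Section EntryConcentration.
Context {R : realType} {d : measure_display} {T : measurableType d}
  (P : probability T R) (N : nat) (H : T -> 'M[R[i]]_N).
Local Notation C := R[i].
Local Open Scope sesquilinear_scope.
Local Notation mxT N := (g_sigma_algebraType (@mx_gens R N)).
Hypothesis mH : random_mx H.
Hypothesis Hinv : forall V : 'M[C]_N, V \is unitarymx ->
  same_law P (fun w => V *m H w *m V^t*) H.
Variables (z : C) (K2 : R).
Hypothesis K20 : 0 <= K2.
Hypothesis N2 : (1 < N)%N.
Local Notation Rz := (@resolvent R N z).
Local Notation E := (mean P H).
Local Notation wt := (weight z K2).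

Definition entry_error i j (M : 'M[C]_N) : C :=
  M i j - (i == j)%:R * (N%:R^-1 * \tr M).

(** A diagonal entry minus the normalised trace is the mean of its differences
    with the diagonal entries, so it inherits their second moment bound. *)
Lemma entry_moment i j :
  bounded_meas (wt (entry_error i j)) /\
  E (wt (entry_error i j)) <= 21 * (K2 / (N%:R - 1)).
Proof.
have N1 : 0 < N%:R - 1 :> R by rewrite subr_gt0 ltr1n.
have N0 : 0 < N%:R :> R by rewrite ltr0n (ltn_trans _ N2).
have NC : N%:R != 0 :> C by rewrite pnatr_eq0 -lt0n (ltn_trans _ N2).
have B0 : 0 <= K2 / (N%:R - 1) by rewrite divr_ge0 // ltW.
have [->|ij] := eqVneq i j; last first.
  have FE : entry_error i j = fun M => M i j.
    by apply/funext => M; rewrite /entry_error (negbTE ij) mul0r subr0.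
  rewrite FE; split; first exact: weight_entry.
  by apply: le_trans (q_offdiag_le mH Hinv z K20 N2 ij) _; lra.
pose D k (M : 'M[C]_N) : C := M j j - M k k.
pose b := 21 * (K2 / (N%:R - 1)).
have b0 : 0 <= b by rewrite mulr_ge0.
have bD k : bounded_meas (wt (D k)) /\ E (wt (D k)) <= b.
  have [<-|jk] := eqVneq j k; last exact: (diag_diff mH Hinv z K20 N2 jk).
  have -> : wt (D j) = fun=> 0.
    by apply/funext => h; rewrite /weight /D subrr cmod0 expr0n mulr0.
  split; last by rewrite mean_cst.
  by split; [exact: measurable_cst|exists 0 => h; rewrite normr0].
pose g h := N%:R^-1 * \sum_k wt (D k) h.
have bS : bounded_meas (fun h => \sum_k wt (D k) h).
  by apply: bounded_meas_sum => k; have [] := bD k.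
have bg : bounded_meas g := bounded_measZ N%:R^-1 bS.
have Fg h : wt (entry_error j j) h <= g h.
  rewrite /g /weight -mulr_sumr [leRHS]mulrCA.
  apply: ler_wpM2l; first exact: cutoff_ge0.
  set S := Rz h.
  have -> : entry_error j j S = N%:R^-1 * \sum_k D k S.
    rewrite /entry_error /D sumrB sumr_const card_ord eqxx mul1r mulrBr.
    by rewrite -(mulr_natl (S j j)) mulrA mulVf // mul1r.
  rewrite cmodM exprMn -(rmorph_nat (real_complex R)) -fmorphV cmod_real.
  rewrite ger0_norm ?invr_ge0 ?ler0n // expr2 -mulrA ler_pM2l ?invr_gt0 //.
  rewrite ler_pdivrMl //; apply: le_trans (sqr_sum_le _).
  rewrite ler_pXn2r ?nnegrE ?cmod_ge0 ?cmod_sum //.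
  by apply: sumr_ge0 => k _; exact: cmod_ge0.
have bF : bounded_meas (wt (entry_error j j)).
  apply: weight_bounded bg Fg.
  apply: cmeasurableD; first exact: cmeasurable_resolvent.
  apply: cmeasurableN; apply: cmeasurableM; first exact: cmeasurable_cst.
  apply: cmeasurableM; first exact: cmeasurable_cst.
  by apply: cmeasurable_sum => k; exact: cmeasurable_resolvent.
split=> //; apply: le_trans (le_mean P mH bF bg Fg) _.
have Eg := etrans (meanZ P mH N%:R^-1 bS)
  (f_equal (fun x => N%:R^-1 * x) (mean_sum P mH _ _ (fun k => (bD k).1))).
apply: le_trans (_ : N%:R^-1 * \sum_(k < N) E (wt (D k)) <= _).
  by rewrite le_eqVlt; apply/orP; left; apply/eqP; exact Eg.
rewrite ler_pdivrMl // -[X in _ <= X%:R * _](card_ord N) -sum1_card natr_sum mulr_suml.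
by apply: ler_sum => k _; rewrite mul1r; have [] := bD k.
Qed.

Lemma entry_deviation i j (e : R) : 0 < e ->
  measurable [set w | e ^+ 2 <= wt (entry_error i j) (H w)] /\
  fine (P [set w | e ^+ 2 <= wt (entry_error i j) (H w)]) <=
    21 * (K2 / (N%:R - 1)) / e ^+ 2.
Proof.
move=> e0; have [bF EF] := entry_moment i j; have e2 : 0 < e ^+ 2 by rewrite exprn_gt0.
split; first exact: (measurable_mean_set mH _ bF).
apply: le_trans (markov_mean P mH e2 bF _) _.
  by move=> h; exact: weight_ge0.
by rewrite ler_pM2r ?invr_gt0.
Qed.

End EntryConcentration.

Section ResolventLimit.
Context {R : realType} {d : nat -> measure_display}
  {T : forall N, measurableType (d N)} (P : forall N, probability (T N) R)
  (H : forall N, T N -> 'M[R[i]]_N) (mu : probability (measurableTypeR R) R).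
Local Notation C := R[i].
Local Notation S := (csupp mu).
Local Notation G := (cauchy_transform mu).
Hypothesis hH : UCI P H mu.

Lemma spectrum_whp (e : R) : 0 < e ->
  with_high_probability P
    (fun N => [set w | {in eigenvals (H w), forall l, cdist l S < e}]).
Proof.
move=> e0; apply: whpS (UCI_no_outlier hH e0) => N w /= h l lin.
by apply: le_lt_trans h; exact: (le_bigmax_seq _ l predT (fun l => cdist l S) lin isT).
Qed.

Lemma off_spectrum N (w : T N) (e : R) z : 2 * e <= cdist z S ->
  {in eigenvals (H w), forall l, cdist l S < e} ->
  {in eigenvals (H w), forall l, e <= cmod (z - l)}.
Proof.
move=> hz h l /h le; have := cdist_lip z l (csupp_neq0 mu); lra.
Qed.

Lemma stieltjes_whp (dl e : R) z : 0 < dl -> dl <= cdist z S -> 0 < e ->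
  with_high_probability P (fun N => [set w |
    {in eigenvals (H w), forall l, dl <= cmod (z - l)} ->
    cmod (N%:R^-1 * \sum_(l <- eigenvals (H w)) (z - l)^-1 - G z) < e]).
Proof.
move=> d0 /off_supportP hz e0.
have e2 : 0 < e / 2 by rewrite divr_gt0.
have [cRe cIm] := cut_kernel_continuous z d0.
have bRe x : `|complex.Re (cut_kernel dl z x)| <= dl^-1.
  exact: le_trans (ler_Re_cmod _) (cut_kernel_bound z x d0).
have bIm x : `|complex.Im (cut_kernel dl z x)| <= dl^-1.
  exact: le_trans (ler_Im_cmod _) (cut_kernel_bound z x d0).
have test (f : R -> R) : continuous f -> (forall x, `|f x| <= dl^-1) ->
    with_high_probability P (fun N => [set w | (0 < N)%N -> `| N%:R^-1 *
      \sum_(l <- eigenvals (H w)) f (complex.Re l) - Rintegral mu setT f| < e / 2]).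
  move=> cf bf.
  have cf1 : continuous (fun x => f x + dl^-1).
    by move=> x; exact: (continuousD (cf x) (@cst_continuous _ _ dl^-1 x)).
  have bf1 : exists K : R, forall x, `|f x + dl^-1| <= K.
    exists (dl^-1 + dl^-1) => x; apply: le_trans (ler_normD _ _) (lerD (bf x) _).
    by rewrite ger0_norm // invr_ge0 ltW.
  apply: whpS (UCI_spectral_measure hH cf1 bf1 e2) => N w /= h N0.
  rewrite -(Rintegral_esm_dist _ mu N0 _ bf) //.
  exact: continuous_measurable_fun.
have [mk1 mk2] := cmeasurable_kernel z.
have iRe : Rintegral mu setT (fun x => complex.Re (cut_kernel dl z x)) = complex.Re (G z).
  apply: eq_Rintegral_msupp => //; first exact: continuous_measurable_fun.
  by move=> x hx; rewrite cut_kernelE //; exact: hz.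
have iIm : Rintegral mu setT (fun x => complex.Im (cut_kernel dl z x)) = complex.Im (G z).
  apply: eq_Rintegral_msupp => //; first exact: continuous_measurable_fun.
  by move=> x hx; rewrite cut_kernelE //; exact: hz.
apply: (whp_large (N0 := 1)) (whpI (test _ cRe bRe) (test _ cIm bIm)).
move=> N N0 w /= [h1 h2] hl.
have lE l : l \in eigenvals (H w) -> cut_kernel dl z (complex.Re l) = (z - l)^-1.
  move=> lin; have lr := eigenvals_real (UCI_hermitian hH w) lin.
  by rewrite cut_kernelE -?lr // hl.
apply: le_lt_trans (ler_cmod_ReIm _) _.
rewrite -(rmorph_nat (real_complex R)) -fmorphV ReB ImB Re_scal Im_scal Re_sum Im_sum.
rewrite [e]splitr; apply: ltrD.
  rewrite -iRe; apply: le_lt_trans (h1 N0); rewrite le_eqVlt; apply/orP; left; apply/eqP.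
  by congr (`|_ * _ - _|); apply: eq_big_seq => l lin; rewrite lE.
rewrite -iIm; apply: le_lt_trans (h2 N0); rewrite le_eqVlt; apply/orP; left; apply/eqP.
by congr (`|_ * _ - _|); apply: eq_big_seq => l lin; rewrite lE.
Qed.

(** A fixed corner of the resolvent of a unitarily invariant matrix tends to
    the scalar matrix [G z]. *)
Lemma resolvent_whp n (dl e : R) z : 0 < dl -> 2 * dl <= cdist z S -> 0 < e ->
  with_high_probability P (fun N => [set w | forall i j : 'I_N,
    (i < n)%N -> (j < n)%N ->
    cmod (resolvent z (H w) i j - (i == j)%:R * G z) < e]).
Proof.
move=> d0 hz e0; have e2 : 0 < e / 2 by rewrite divr_gt0.
pose K2 : R := dl^-1 ^+ 2.
have K20 : 0 <= K2 by rewrite exprn_ge0 // invr_ge0 ltW.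
have dev ab : with_high_probability P (fun N => [set w | forall i j : 'I_N,
    (i : nat, j : nat) = ab -> weight z K2 (entry_error i j) (H w) < (e / 2) ^+ 2]).
  case: ab => a b.
  pose F N : set (T N) := if insub a is Some i then if insub b is Some j
    then (if (1 < N)%N then
      ~` [set w | (e / 2) ^+ 2 <= weight z K2 (@entry_error R N i j) (H w)] else set0)
    else setT else setT.
  have dv N (i j : 'I_N) (N2 : (1 < N)%N) := entry_deviation
    (@UCI_random _ _ _ _ _ _ hH N) (@UCI_invariant _ _ _ _ _ _ hH N) z K20 N2 i j e2.
  have mF N : measurable (F N).
    rewrite /F; case: (insub a) => [i|] //; case: (insub b) => [j|] //.
    by case: ifP => // N2; apply: measurableC; have [] := dv N i j N2.
  have : with_high_probability P F.
    exists F; split; [exact: mF|by move=> N x|].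
    apply/(prob_cvg1P P mF) => eps eps0.
    pose c := 21 * K2 / (e / 2) ^+ 2.
    have c0 : 0 <= c by apply: divr_ge0; [exact: mulr_ge0|exact: sqr_ge0].
    pose N0 := (Num.truncn (c / eps)).+3; exists N0 => N N0N.
    have N2 : (1 < N)%N by apply: leq_trans N0N.
    have cN : c / (N%:R - 1) <= eps.
      have hN : c / eps < N%:R - 1.
        apply: lt_le_trans (truncnS_gt _) _.
        by rewrite lerBrDr natr1 ler_nat (leq_trans _ N0N).
      have hN0 : 0 < N%:R - 1 :> R by rewrite subr_gt0 ltr1n.
      by rewrite ler_pdivrMr // -ler_pdivrMl // mulrC ltW.
    rewrite /F N2; case: (insub a) => [i|]; last by rewrite setCT measure0 ltW.
    case: (insub b) => [j|]; last by rewrite setCT measure0 ltW.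
    rewrite setCK; have [_ h] := dv N i j N2; apply: le_trans h (le_trans _ cN).
    by rewrite /c le_eqVlt; apply/orP; left; apply/eqP; ring.
  apply: whpS => N w; rewrite /F => hw i j [ia jb].
  move: hw; rewrite -ia -jb !valK; case: ifP => // _ /negP.
  by rewrite -ltNge.
have devn := whp_all (r := [seq (a, b) | a <- iota 0 n, b <- iota 0 n])
  (fun ab _ => dev ab).
have hz1 : dl <= cdist z S by lra.
apply: (whp_large (N0 := 1)) (whpI (spectrum_whp d0) (whpI (stieltjes_whp d0 hz1 e2) devn)).
move=> N N0 w /= [sp [st dv]] i j ilt jlt.
have hl := off_spectrum hz sp.
have hs : hs2 (resolvent z (H w)) <= N%:R * K2.
  exact: (hs2_resolvent (UCI_hermitian hH w) d0 hl).
have : cmod (entry_error i j (resolvent z (H w))) < e / 2.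
  have := dv (i : nat, j : nat).
  rewrite allpairs_f ?mem_iota //= => /(_ isT) /(_ i j erefl).
  rewrite /weight /cutoff hs mul1r ltr_pXn2r ?nnegrE ?cmod_ge0 //.
  exact: ltW.
have zl : {in eigenvals (H w), forall l, z != l}.
  by move=> l /hl; rewrite -subr_eq0 -cmod_gt0; exact: lt_le_trans.
have := st hl; rewrite -(trace_resolvent (UCI_hermitian hH w) zl).
rewrite /entry_error; set t := N%:R^-1 * _; set M := resolvent _ _.
move=> ht hM; rewrite [e]splitr.
apply: le_lt_trans (ler_cmod_dist ((i == j)%:R * t) _ _) _.
apply: ltr_leD => //; rewrite -mulrBr; case: (i == j).
  by rewrite mul1r ltW.
by rewrite mul0r cmod0 ltW.
Qed.

End ResolventLimit.

(** * Reduction to a deterministic perturbation *)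

Section Transfer.
Context {R : realType} {d : measure_display} {T : measurableType d}
  (P : probability T R) (N : nat) (H A : T -> 'M[R[i]]_N).
Local Notation C := R[i].
Local Open Scope sesquilinear_scope.
Local Notation mxT N := (g_sigma_algebraType (@mx_gens R N)).

(** Given [A = V a0 V^*], the conditional law of [H] is invariant under
    conjugation by [V]; integrating over [A] by Tonelli's theorem, the random
    perturbation can be replaced by [a0] in every event that is invariant under
    simultaneous conjugation. *)
Lemma transfer (a0 : 'M[C]_N) (X : set (mxT N * mxT N)) :
  random_mx H -> random_mx A -> independent_mx P H A ->
  (forall V : 'M[C]_N, V \is unitarymx -> same_law P (fun w => V *m H w *m V^t*) H) ->
  (forall w, exists2 V : 'M[C]_N, V \is unitarymx & A w = V *m a0 *m V^t*) ->
  measurable X ->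
  (forall (V : 'M[C]_N) a h, V \is unitarymx ->
     X (V *m a *m V^t*, V *m h *m V^t*) <-> X (a, h)) ->
  P [set w | X (A w, H w)] = P [set w | X (a0, H w)].
Proof.
move=> mH mA ind inv hA mX hX.
have mA' : measurable_fun setT (A : T -> mxT N) by apply/measurable_random_mx.
have mH' : measurable_fun setT (H : T -> mxT N) by apply/measurable_random_mx.
have mJ : measurable_fun setT (fun w => (A w, H w) : mxT N * mxT N).
  exact: measurable_fun_pair.
pose RA : {mfun T >-> mxT N} := HB.pack (A : T -> mxT N) (isMeasurableFun.Build _ _ _ _ _ mA').
pose RH : {mfun T >-> mxT N} := HB.pack (H : T -> mxT N) (isMeasurableFun.Build _ _ _ _ _ mH').
pose RJ : {mfun T >-> (mxT N * mxT N)%type} :=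
  HB.pack (fun w => (A w, H w) : mxT N * mxT N) (isMeasurableFun.Build _ _ _ _ _ mJ).
pose m1 := distribution P RA; pose m2 := distribution P RH.
have prodE : ((m1 \x m2) X = distribution P RJ X)%E.
  apply: product_measure_unique => // B B' mB mB'.
  rewrite /m1 /m2 /distribution /pushforward /= muleC -(ind _ _ mB' mB).
  by congr (P _); apply/seteqP; split => w /= [].
rewrite -[LHS]/(distribution P RJ X) -prodE /product_measure1.
rewrite ge0_integral_distribution //; last exact: measurable_fun_xsection.
have cst w : (m2 (xsection X (RA w)) = P [set w | X (a0, H w)])%E.
  have [V uV AE] := hA w.
  have mB : measurable (xsection X (A w : mxT N)) by exact: measurable_xsection.
  rewrite -[LHS]/(P (H @^-1` xsection X (A w))) -(inv V uV _ mB).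
  have xs h : xsection X (A w : mxT N) h <-> X (A w, h).
    by rewrite /xsection /=; split => [/set_mem|/mem_set].
  by congr (P _); apply/seteqP; split => w'; rewrite /preimage /= xs AE hX.
under eq_integral => w _ do rewrite /= cst.
rewrite integral_cst // [X in (_ * X)%E](_ : _ = 1%E) ?mule1 //.
exact: probability_setT.
Qed.

End Transfer.

Section LocallyLipschitz.
Context {R : realType} (n : nat).
Local Notation C := R[i].

Definition entries_le (B : R) (K : 'M[C]_n) := forall i j, cmod (K i j) <= B.

(** Polynomial functions of the entries are bounded and Lipschitz on bounded
    sets; this form is stable under sums and products. *)
Definition loclip (F : 'M[C]_n -> C) := forall B : R, exists L M : R,
  [/\ 0 <= L, 0 <= M, forall K, entries_le B K -> cmod (F K) <= M &
   forall K K' e, entries_le B K -> entries_le B K' -> 0 <= e ->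
     (forall i j, cmod (K i j - K' i j) <= e) -> cmod (F K - F K') <= L * e].

Lemma loclip_cst c : loclip (fun=> c).
Proof.
move=> B; exists 0, (cmod c); split => //; first exact: cmod_ge0.
by move=> *; rewrite subrr cmod0 mul0r.
Qed.

Lemma loclip_entry i j : loclip (fun K => K i j).
Proof.
move=> B; exists 1, `|B|; split => //.
- by move=> K /(_ i j) h; apply: le_trans h (ler_norm _).
- by move=> K K' e _ _ _ h; rewrite mul1r.
Qed.

Lemma loclipD F F' : loclip F -> loclip F' -> loclip (fun K => F K + F' K).
Proof.
move=> hF hF' B; have [L [M [L0 M0 bM lL]]] := hF B.
have [L' [M' [L0' M0' bM' lL']]] := hF' B.
exists (L + L'), (M + M'); split; rewrite ?addr_ge0 //.
  by move=> K hK; apply: le_trans (ler_cmodD _ _) (lerD (bM K hK) (bM' K hK)).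
move=> K K' e hK hK' e0 h; rewrite mulrDl opprD addrACA.
exact: le_trans (ler_cmodD _ _) (lerD (lL K K' e hK hK' e0 h) (lL' K K' e hK hK' e0 h)).
Qed.

Lemma loclipM F F' : loclip F -> loclip F' -> loclip (fun K => F K * F' K).
Proof.
move=> hF hF' B; have [L [M [L0 M0 bM lL]]] := hF B.
have [L' [M' [L0' M0' bM' lL']]] := hF' B.
exists (L * M' + M * L'), (M * M'); split; rewrite ?addr_ge0 ?mulr_ge0 //.
  by move=> K hK; rewrite cmodM ler_pM ?cmod_ge0 ?bM ?bM'.
move=> K K' e hK hK' e0 h.
have -> : F K * F' K - F K' * F' K' = (F K - F K') * F' K + F K' * (F' K - F' K').
  by ring.
apply: le_trans (ler_cmodD _ _) _; rewrite !cmodM mulrDl; apply: lerD.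
  rewrite mulrAC; apply: ler_pM; rewrite ?cmod_ge0 ?bM' //; exact: lL.
rewrite -mulrA; apply: ler_pM; rewrite ?cmod_ge0 ?bM //; exact: lL'.
Qed.

Lemma loclip_sum (I : Type) (r : seq I) (Q : pred I) (F : I -> 'M[C]_n -> C) :
  (forall i, loclip (F i)) -> loclip (fun K => \sum_(i <- r | Q i) F i K).
Proof.
move=> h; elim: r => [|i r ih].
  by under eq_fun do rewrite big_nil; exact: loclip_cst.
under eq_fun do rewrite big_cons; case: (Q i) => //; exact: loclipD.
Qed.

Lemma loclip_prod (I : Type) (r : seq I) (Q : pred I) (F : I -> 'M[C]_n -> C) :
  (forall i, loclip (F i)) -> loclip (fun K => \prod_(i <- r | Q i) F i K).
Proof.
move=> h; elim: r => [|i r ih].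
  by under eq_fun do rewrite big_nil; exact: loclip_cst.
under eq_fun do rewrite big_cons; case: (Q i) => //; exact: loclipM.
Qed.

(** The determinant whose zeros are the eigenvalues of the perturbed matrix, as
    a function of the compressed resolvent. *)
Definition outlier_det (A0 K : 'M[C]_n) : C := \det (1%:M - K *m A0).

Lemma loclip_outlier_det A0 : loclip (outlier_det A0).
Proof.
rewrite /outlier_det /determinant; apply: loclip_sum => s; apply: loclipM.
  exact: loclip_cst.
apply: loclip_prod => i; under eq_fun do rewrite !mxE.
apply: loclipD; first exact: loclip_cst.
under eq_fun do rewrite -mulN1r.
apply: loclipM; first exact: loclip_cst.
apply: loclip_sum => k; apply: loclipM; first exact: loclip_entry.
exact: loclip_cst.
Qed.

End LocallyLipschitz.

Section Compression.
Context {R : realType} (N n : nat).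
Local Notation C := R[i].
Local Open Scope sesquilinear_scope.

(** The first [n] columns of the identity; every matrix of the first [n] columns of
    a unitary matrix is a unitary image of it. *)
Definition corner : 'M[C]_(N, n) := \matrix_(i, j) (i == j :> nat)%:R.

Hypothesis le_nN : (n <= N)%N.

Lemma colsub_corner m (V : 'M[C]_(m, N)) : colsub (widen_ord le_nN) V = V *m corner.
Proof.
apply/matrixP => i j; rewrite !mxE (bigD1 (widen_ord le_nN j)) //= !mxE eqxx mulr1.
rewrite big1 ?addr0 // => k kj; rewrite !mxE.
have -> : (k == j :> nat) = false by apply/negbTE; move: kj; rewrite -val_eqE.
by rewrite mulr0.
Qed.

Lemma compression_entry (M : 'M[C]_N) i j :
  (corner^t* *m M *m corner) i j = M (widen_ord le_nN i) (widen_ord le_nN j).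
Proof.
rewrite -colsub_corner mxE.
have := colsub_corner (M^t*); move/(congr1 (fun B => B^t*)).
by rewrite adjointM adjointK => <-; rewrite !mxE conjCK.
Qed.

End Compression.

(** * Convergence of the ratio of characteristic polynomials *)

Section RatioLimit.
Context {R : realType} {d : nat -> measure_display}
  {T : forall N, measurableType (d N)} (P : forall N, probability (T N) R)
  (H : forall N, T N -> 'M[R[i]]_N) (mu : probability (measurableTypeR R) R)
  (r : nat) (A0 : 'M[R[i]]_(2 * r)) (A : forall N, T N -> 'M[R[i]]_N).
Local Notation C := R[i].
Local Notation S := (csupp mu).
Local Notation G := (cauchy_transform mu).
Local Notation Phi := (outlier_det A0).
Local Notation mxT N := (g_sigma_algebraType (@mx_gens R N)).
Local Open Scope sesquilinear_scope.
Hypothesis hH : UCI P H mu.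
Hypothesis hA : finite_rank_perturbation P H A0 A.

Definition padded N : 'M[C]_N := corner N (2 * r) *m A0 *m (corner N (2 * r))^t*.

Definition compressed N (h : 'M[C]_N) (z : C) : 'M[C]_(2 * r) :=
  (corner N (2 * r))^t* *m resolvent z h *m corner N (2 * r).

Lemma perturbation_padded N (w : T N) : (2 * r <= N)%N ->
  exists2 V : 'M[C]_N, V \is unitarymx & A w = V *m padded N *m V^t*.
Proof.
move=> le2r; have [V uV AE] := FRP_form hA le2r w; exists V => //.
by rewrite AE (colsub_corner le2r) /padded adjointM !mulmxA.
Qed.

Lemma det_padded N (h : 'M[C]_N) z : \det (z%:M - h) != 0 ->
  \det (z%:M - (h + padded N)) = \det (z%:M - h) * Phi (compressed h z).
Proof. by move=> d0; rewrite /padded det_perturbation. Qed.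

Lemma compressed_entry N (h : 'M[C]_N) z (le2r : (2 * r <= N)%N) i j :
  compressed h z i j = resolvent z h (widen_ord le2r i) (widen_ord le2r j).
Proof. by rewrite /compressed (compression_entry le2r). Qed.

(** [H + A] has the same spectrum as a conjugate of [H] plus the padded matrix. *)
Lemma ratio_form N (w : T N) : (2 * r <= N)%N -> exists h : 'M[C]_N,
  [/\ h \is hermsymmx, eigenvals h =i eigenvals (H w) &
   forall z, \det (z%:M - H w) != 0 ->
     \det (z%:M - (H w + A w)) = \det (z%:M - H w) * Phi (compressed h z)].
Proof.
move=> le2r; have [V uV AE] := perturbation_padded w le2r.
pose h := V^t* *m H w *m V.
have uV' : V^t* \is unitarymx by rewrite trmxC_unitary.
have hE : h = V^t* *m H w *m (V^t*)^t* by rewrite adjointK.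
have HE : V *m h *m V^t* = H w.
  rewrite /h !mulmxA (unitarymxP uV) mul1mx -mulmxA (unitarymxP uV).
  exact: mulmx1.
have dE z : \det (z%:M - H w) = \det (z%:M - h) by rewrite -HE sub_conj // det_conj.
exists h; split.
- by rewrite hE; apply: hermsymmx_conj; exact: (UCI_hermitian hH w).
- by rewrite hE; apply: perm_mem; exact: eigenvals_conj.
- move=> z; rewrite dE => d0; rewrite -det_padded // -[in LHS]HE AE -mulmxDl -mulmxDr.
  by rewrite sub_conj // det_conj.
Qed.

(** The ratio of the characteristic polynomials is within [e] of [D]; clearing the
    denominator leaves a polynomial condition, which is measurable. *)
Definition ratio_event N (z D : C) (e : R) : set (mxT N * mxT N) :=
  [set p | cmod (\det (z%:M - (p.2 + p.1 : 'M[C]_N)) - D * \det (z%:M - (p.2 : 'M[C]_N)))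
     < e * cmod (\det (z%:M - (p.2 : 'M[C]_N)))].

Lemma measurable_ratio_event N z D e : measurable (@ratio_event N z D e).
Proof.
have m1 i j : cmeasurable (fun p : mxT N * mxT N => p.1 i j).
  have [a b] := @cmeasurable_entry R N i j.
  by split; [exact: (measurableT_comp a measurable_fst)|exact: (measurableT_comp b measurable_fst)].
have m2 i j : cmeasurable (fun p : mxT N * mxT N => p.2 i j).
  have [a b] := @cmeasurable_entry R N i j.
  by split; [exact: (measurableT_comp a measurable_snd)|exact: (measurableT_comp b measurable_snd)].
have d2 : cmeasurable (fun p : mxT N * mxT N => \det (z%:M - (p.2 : 'M[C]_N))).
  apply: cmeasurable_det => i j; under eq_fun do rewrite !mxE.
  apply: cmeasurableD; first exact: cmeasurable_cst.
  exact: cmeasurableN.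
have d1 : cmeasurable (fun p : mxT N * mxT N => \det (z%:M - (p.2 + p.1 : 'M[C]_N))).
  apply: cmeasurable_det => i j; under eq_fun do rewrite !mxE.
  apply: cmeasurableD; first exact: cmeasurable_cst.
  by apply: cmeasurableN; exact: cmeasurableD.
have dd : cmeasurable (fun p : mxT N * mxT N =>
    \det (z%:M - (p.2 + p.1 : 'M[C]_N)) - D * \det (z%:M - (p.2 : 'M[C]_N))).
  apply: cmeasurableD => //; apply: cmeasurableN.
  by apply: cmeasurableM => //; exact: cmeasurable_cst.
have mr : measurable_fun setT (fun p : mxT N * mxT N => e * cmod (\det (z%:M - (p.2 : 'M[C]_N)))).
  by apply: measurable_funM; [exact: measurable_cst|exact: measurable_cmod].
have := measurable_fun_ltr (measurable_cmod dd) mr => /(_ measurableT [set true]).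
rewrite setTI; apply.
exact: I.
Qed.

Lemma ratio_event_conj N z D e (V : 'M[C]_N) a h : V \is unitarymx ->
  @ratio_event N z D e (V *m a *m V^t*, V *m h *m V^t*) <-> @ratio_event N z D e (a, h).
Proof.
move=> uV; rewrite /ratio_event /= -mulmxDl -mulmxDr !sub_conj //.
by rewrite !det_conj.
Qed.

Lemma scalar_entries_le B (g : C) : cmod g <= B -> entries_le B (g%:M : 'M[C]_(2 * r)).
Proof.
move=> gB i j; rewrite !mxE; case: (i == j); first by rewrite mulr1n.
by rewrite mulr0n cmod0 (le_trans (cmod_ge0 g)).
Qed.

Lemma det_neq0 N (h : 'M[C]_N) z (e : R) : 0 < e ->
  {in eigenvals h, forall l, e <= cmod (z - l)} -> \det (z%:M - h) != 0.
Proof.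
move=> e0 hz; rewrite horner_prod_eigenvals prodf_seq_neq0; apply/allP => l lin.
by rewrite /= -cmod_gt0 (lt_le_trans e0) ?hz.
Qed.

(** For the padded matrix only a fixed corner of the resolvent matters, and that
    corner tends to [G z]; the event is conjugation invariant, so the statement
    transfers to the random perturbation. *)
Lemma point_whp (dl e : R) z : 0 < dl -> 2 * dl <= cdist z S -> 0 < e ->
  with_high_probability P
    (fun N => [set w | @ratio_event N z (Phi (G z)%:M) e (A w, H w)]).
Proof.
move=> d0 hz e0; pose B := 2 / dl.
have B0 : 0 < B by rewrite divr_gt0.
have [L [M [L0 M0 _ lip]]] := loclip_outlier_det A0 B.
pose k := e / (L + 1) / 2.
have k0 : 0 < k by rewrite !divr_gt0 // ltr_wpDl.
have pad : with_high_probability P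
    (fun N => [set w | @ratio_event N z (Phi (G z)%:M) e (padded N, H w)]).
  apply: (whp_large (N0 := 2 * r)) (whpI (spectrum_whp hH d0)
    (resolvent_whp hH (2 * r) d0 hz k0)) => N le2r w /= [sp rs].
  have hl := off_spectrum hz sp; have dn0 := det_neq0 d0 hl.
  rewrite /ratio_event /= (det_padded dn0) [X in cmod (X - _)]mulrC -mulrBl cmodM.
  rewrite ltr_pM2r ?cmod_gt0 //.
  have dB : dl^-1 <= B.
    have i0 : 0 < dl^-1 by rewrite invr_gt0.
    by rewrite /B; lra.
  have b1 : entries_le B (compressed (H w) z).
    move=> i j; rewrite (compressed_entry _ _ le2r); apply: le_trans dB.
    exact: (resolvent_bound (UCI_hermitian hH w) _ _ d0 hl).
  have b2 : entries_le B ((G z)%:M : 'M[C]_(2 * r)).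
    apply: scalar_entries_le; apply: cauchy_transform_bound => //.
    by apply/off_supportP; lra.
  apply: le_lt_trans (lip _ _ k b1 b2 (ltW k0) _) _ => [i j|].
    rewrite (compressed_entry _ _ le2r) [X in _ - X]mxE.
    have := rs (widen_ord le2r i) (widen_ord le2r j) (ltn_ord i) (ltn_ord j).
    have -> : (widen_ord le2r i == widen_ord le2r j) = (i == j) by [].
    by case: (i == j); rewrite /= ?mulr1n ?mulr0n ?mul1r ?mul0r; exact: ltW.
  have L1 : 0 < L + 1 by rewrite ltr_wpDl.
  rewrite /k mulrA ltr_pdivrMr // mulrA ltr_pdivrMr //; nra.
(* When [N < 2 r] the factorisation of [A] is not available, and the event is
   replaced by the empty one. *)
pose E0 N := if (2 * r <= N)%N then
  [set w : T N | @ratio_event N z (Phi (G z)%:M) e (padded N, H w)] else set0.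
pose E1 N := if (2 * r <= N)%N then
  [set w : T N | @ratio_event N z (Phi (G z)%:M) e (A w, H w)] else set0.
have mE0 N : measurable (E0 N).
  rewrite /E0; case: ifP => // _; rewrite -[X in measurable X]setTI.
  apply: (measurable_fun_pair _ _ measurableT (measurable_ratio_event z (Phi (G z)%:M) e)).
    exact: measurable_cst.
  by apply/measurable_random_mx; exact: (@UCI_random _ _ _ _ _ _ hH N).
have mE1 N : measurable (E1 N).
  rewrite /E1; case: ifP => // _; rewrite -[X in measurable X]setTI.
  apply: (measurable_fun_pair _ _ measurableT (measurable_ratio_event z (Phi (G z)%:M) e)).
    by apply/measurable_random_mx; exact: (@FRP_random _ _ _ _ _ _ _ _ hA N).
  by apply/measurable_random_mx; exact: (@UCI_random _ _ _ _ _ _ hH N).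
have eqE N : P N (E1 N) = P N (E0 N).
  rewrite /E0 /E1; case: ifP => [le2r|_]; last exact: erefl.
  apply: transfer.
  - exact: (@UCI_random _ _ _ _ _ _ hH N).
  - exact: (@FRP_random _ _ _ _ _ _ _ _ hA N).
  - exact: (@FRP_independent _ _ _ _ _ _ _ _ hA N).
  - exact: (@UCI_invariant _ _ _ _ _ _ hH N).
  - by move=> w; exact: perturbation_padded.
  - exact: measurable_ratio_event.
  - by move=> V a h uV; exact: ratio_event_conj.
exists E1; split=> //.
  by move=> N; rewrite /E1; case: ifP => // _ w [].
under eq_fun do rewrite eqE.
have [F [mF FE Fc]] := pad.
apply/(prob_cvg1P P mE0) => eps eps0.
have [N1 hN] := (prob_cvg1P P mF).1 Fc eps eps0.
exists (maxn N1 (2 * r)) => N; rewrite geq_max => /andP[/hN h le2r].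
have mcE := measurableC (mE0 N); have mcF := measurableC (mF N).
apply: le_trans h; rewrite fine_le ?fin_num_measure //.
apply: le_measure; [exact/mem_set|exact/mem_set|].
by move=> x; apply: contra_not; rewrite /E0 le2r; exact: FE.
Qed.

End RatioLimit.

Section Net.
Context {R : realType}.
Local Notation C := R[i].

(** Two points in the same cell of a square grid are close; one representative
    is kept for every cell that meets [Q]. *)
Lemma finite_net (Q : set C) (L k : R) : 0 < k -> (forall z, Q z -> cmod z <= L) ->
  exists2 Z : seq C, forall y, y \in Z -> Q y &
    forall z, Q z -> exists2 y, y \in Z & cmod (z - y) <= k.
Proof.
move=> k0 QL; have k2 : 0 < k / 2 by rewrite divr_gt0.
pose c (x : R) := Num.truncn ((x + L) / (k / 2)).
pose f (z : C) := (c (complex.Re z), c (complex.Im z)).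
pose M := (Num.truncn ((L + L) / (k / 2))).+1.
pose cell ab : set C := [set z | Q z /\ f z = ab].
pose grid := [seq (a, b) | a <- iota 0 M, b <- iota 0 M].
pose Z := [seq xget 0 (cell ab) | ab <- grid & `[< cell ab !=set0 >]].
have cellP ab : cell ab !=set0 -> cell ab (xget 0 (cell ab)).
  by case=> z hz; exact: xgetPex (ex_intro _ z hz).
have close (x y : R) : - L <= x -> - L <= y -> c x = c y -> `|x - y| <= k / 2.
  move=> xL yL cE; rewrite ler_norml.
  have b (t : R) : - L <= t -> (c t)%:R * (k / 2) <= t + L < ((c t)%:R + 1) * (k / 2).
    move=> tL; have t0 : 0 <= (t + L) / (k / 2) by apply: divr_ge0; lra.
    have /andP[h1 h2] := truncn_itv t0; rewrite -[X in _ < X]natr1 in h2.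
    by apply/andP; split; [rewrite -ler_pdivlMr|rewrite -ltr_pdivrMr].
  have /andP[a1 a2] := b x xL; have /andP[b1 b2] := b y yL.
  rewrite mulrDl mul1r in a2 b2; rewrite cE in a1 a2.
  by apply/andP; split; lra.
have part z : Q z -> [/\ - L <= complex.Re z, - L <= complex.Im z,
    complex.Re z <= L & complex.Im z <= L].
  move=> /QL zL; have := le_trans (ler_Re_cmod z) zL; have := le_trans (ler_Im_cmod z) zL.
  by rewrite !ler_norml => /andP[? ?] /andP[? ?]; split.
exists Z => [y /mapP[ab]|z Qz].
  by rewrite mem_filter => /andP[/asboolP h _] ->; have [] := cellP _ h.
have ne : cell (f z) !=set0 by exists z.
exists (xget 0 (cell (f z))).
  apply: map_f; rewrite mem_filter; apply/andP; split; first exact/asboolP.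
  have cM (x : R) : - L <= x -> x <= L -> c x \in iota 0 M.
    move=> x1 x2; rewrite mem_iota /= add0n ltnS; apply: le_truncn.
    by rewrite ler_pM2r ?invr_gt0 // lerD2r.
  have [r1 r2 r3 r4] := part z Qz.
  by apply: allpairs_f; exact: cM.
have [Qy fy] := cellP _ ne; set y := xget _ _ in Qy fy *.
have [z1 z2 _ _] := part z Qz; have [y1 y2 _ _] := part y Qy.
case: fy => e1 e2; apply: le_trans (ler_cmod_ReIm _) _; rewrite ReB ImB.
have := close _ _ z1 y1 (esym e1); have := close _ _ z2 y2 (esym e2); lra.
Qed.

End Net.

Section UniformLimit.
Context {R : realType} {d : nat -> measure_display}
  {T : forall N, measurableType (d N)} (P : forall N, probability (T N) R)
  (H : forall N, T N -> 'M[R[i]]_N) (mu : probability (measurableTypeR R) R)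
  (r : nat) (A0 : 'M[R[i]]_(2 * r)) (A : forall N, T N -> 'M[R[i]]_N).
Local Notation C := R[i].
Local Notation S := (csupp mu).
Local Notation G := (cauchy_transform mu).
Local Notation Phi := (outlier_det A0).
Hypothesis hH : UCI P H mu.
Hypothesis hA : finite_rank_perturbation P H A0 A.

Definition limit_det (z : C) : C := Phi (G z)%:M.

Lemma compressed_bound N (h : 'M[C]_N) (dl : R) z : (2 * r <= N)%N ->
  h \is hermsymmx -> 0 < dl -> {in eigenvals h, forall l, dl <= cmod (z - l)} ->
  entries_le dl^-1 (compressed r h z).
Proof.
move=> le2r hh d0 hz i j; rewrite (compressed_entry _ _ le2r).
exact: (resolvent_bound hh _ _ d0 hz).
Qed.

Lemma limit_det_lip (dl : R) : 0 < dl -> exists2 L : R, 0 < L &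
  forall z w, dl <= cdist z S -> dl <= cdist w S ->
    cmod (limit_det z - limit_det w) <= L * cmod (z - w).
Proof.
move=> d0; have [L [M [L0 M0 _ lip]]] := loclip_outlier_det A0 (2 / dl).
exists (L * (2 / dl ^+ 2) + 1); first by rewrite ltr_wpDl // mulr_ge0 // divr_ge0 // sqr_ge0.
move=> z w /off_supportP hz /off_supportP hw.
have bz := scalar_entries_le (r := r) (cauchy_transform_bound d0 hz).
have bw := scalar_entries_le (r := r) (cauchy_transform_bound d0 hw).
have Glip := cauchy_transform_lip d0 hz hw.
have e0 : 0 <= 2 * (cmod (z - w) / dl ^+ 2).
  exact: le_trans (cmod_ge0 _) Glip.
apply: le_trans (lip _ _ _ bz bw e0 _) _ => [i j|].
  rewrite !mxE -mulrnBl; case: (i == j); first by rewrite mulr1n.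
  by rewrite mulr0n cmod0.
apply: (@le_trans _ _ (L * (2 / dl ^+ 2) * cmod (z - w))); last first.
  by rewrite ler_wpM2r ?cmod_ge0 // lerDl.
by rewrite le_eqVlt; apply/orP; left; apply/eqP; ring.
Qed.

Definition ratio N (w : T N) (z : C) : C :=
  \det (z%:M - (H w + A w)) / \det (z%:M - H w).

(** Off the spectrum the ratio and its limit are Lipschitz with constants that do
    not depend on [N], so convergence on a finite net is uniform convergence. *)
Lemma uniform_whp (dl e L : R) : 0 < dl -> 0 < e ->
  with_high_probability P (fun N => [set w | [/\ (2 * r <= N)%N,
    {in eigenvals (H w), forall l, cdist l S < dl} &
    forall z, 2 * dl <= cdist z S -> cmod z <= L ->
      cmod (ratio w z - limit_det z) < e]]).
Proof.
move=> d0 e0.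
have sum3 (a b c x y : R) :
    a < e / 3 -> b <= e / 4 -> c <= e / 4 -> y <= a + c -> x <= b + y -> x < e by lra.
have [La [Ma [La0 _ _ lip]]] := loclip_outlier_det A0 dl^-1.
have [Lb Lb0 lipb] := limit_det_lip d0.
have d2 : 0 < dl ^+ 2 by rewrite exprn_gt0.
have e3 : 0 < e / 3 by rewrite divr_gt0.
pose k := Num.min (e / 4 / Lb) (e / 4 / (La + 1) * dl ^+ 2).
have La1 : 0 < La + 1 by rewrite ltr_wpDl.
have k0 : 0 < k.
  by rewrite lt_min divr_gt0 ?divr_gt0 //= mulr_gt0 // divr_gt0 // divr_gt0.
have [Z ZQ Znet] := @finite_net R
  [set z | 2 * dl <= cdist z S /\ cmod z <= L] L k k0 (fun z hz => hz.2).
have nets := whp_all (r := Z) (fun y yZ => point_whp hH hA d0 (ZQ y yZ).1 e3).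
apply: (whp_large (N0 := 2 * r)) (whpI (spectrum_whp hH d0) nets).
move=> N le2r w /= [sp hZ]; split => // z hz zL.
have [y yZ zy] := Znet z (conj hz zL).
have [hy yL] := ZQ y yZ.
have offz := off_spectrum hz sp; have offy := off_spectrum hy sp.
have [h [hh ev hE]] := ratio_form hH hA w le2r.
have rE x : {in eigenvals (H w), forall l, dl <= cmod (x - l)} ->
    ratio w x = Phi (compressed r h x).
  move=> hx; have dn0 := det_neq0 d0 hx.
  by rewrite /ratio hE // mulrC mulKf.
have offh x : {in eigenvals (H w), forall l, dl <= cmod (x - l)} ->
    {in eigenvals h, forall l, dl <= cmod (x - l)}.
  by move=> hx l; rewrite ev; exact: hx.
have h1 : cmod (ratio w y - limit_det y) < e / 3.
  have := hZ y yZ; rewrite /ratio_event /= => hev.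
  have dn0 := det_neq0 d0 offy.
  rewrite -(ltr_pM2r (_ : 0 < cmod (\det (y%:M - H w)))) ?cmod_gt0 //.
  by rewrite -cmodM mulrBl divfK.
have h2 : cmod (ratio w z - ratio w y) <= e / 4.
  rewrite !rE //.
  have kd : 0 <= k / dl ^+ 2 by rewrite divr_ge0 // ltW.
  apply: le_trans (lip _ _ (k / dl ^+ 2) (compressed_bound le2r hh d0 (offh _ offz))
    (compressed_bound le2r hh d0 (offh _ offy)) kd _) _ => [i j|].
    rewrite [X in cmod (X - _)](compressed_entry h z le2r i j).
    rewrite [X in cmod (_ - X)](compressed_entry h y le2r i j).
    apply: le_trans (resolvent_lip hh _ _ d0 (offh _ offz) (offh _ offy)) _.
    by rewrite ler_pM2r ?invr_gt0.
  have kk : k / dl ^+ 2 <= e / 4 / (La + 1) by rewrite ler_pdivrMr // ge_min lexx orbT.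
  apply: le_trans (ler_wpM2l La0 kk) _.
  have q0 : 0 <= e / 4 / (La + 1) by rewrite divr_ge0 ?divr_ge0 // ltW.
  have : (La + 1) * (e / 4 / (La + 1)) = e / 4 by rewrite mulrC divfK // gt_eqF.
  by lra.
have h3 : cmod (limit_det y - limit_det z) <= e / 4.
  have hz1 : dl <= cdist z S by lra.
  have hy1 : dl <= cdist y S by lra.
  apply: le_trans (lipb y z hy1 hz1) _; rewrite cmodB.
  apply: le_trans (ler_wpM2l (ltW Lb0) zy) _.
  by rewrite mulrC -ler_pdivlMr // ge_min lexx.
have t1 := ler_cmod_dist (ratio w y) (ratio w z) (limit_det z).
have t2 := ler_cmod_dist (limit_det y) (ratio w y) (limit_det z).
exact: (sum3 _ _ _ _ _ h1 h2 h3 t2 t1).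
Qed.

Lemma csupp_bounded : exists2 M : R, 0 <= M & forall s, S s -> cmod s <= M.
Proof.
have [M [_ hM]] := compact_bounded (UCI_compact hH).
exists (`|M| + 1); first by rewrite addr_ge0.
move=> _ [x hx <-]; rewrite cmod_real; apply: (hM (`|M| + 1)) => //.
by rewrite (le_lt_trans (ler_norm M)) // ltrDl.
Qed.

(** Far away the resolvent is small, so the perturbed matrix has no eigenvalue. *)
Lemma no_far_eigenvalue (dl : R) : 0 < dl -> exists L : R,
  forall N (w : T N), (2 * r <= N)%N ->
    {in eigenvals (H w), forall l, cdist l S < dl} ->
    forall z, z \in eigenvals (H w + A w) -> cmod z <= L.
Proof.
move=> d0; have [M M0 SM] := csupp_bounded.
have [La [Ma [La0 _ _ lip]]] := loclip_outlier_det A0 1.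
pose D := 2 * La + 1; have D1 : 1 <= D by rewrite /D; lra.
have D0 : 0 < D by lra.
exists (M + dl + D) => N w le2r sp z zin; rewrite leNgt; apply/negP => zL.
have off : {in eigenvals (H w), forall l, D <= cmod (z - l)}.
  move=> l /sp/(cdist_lt (csupp_neq0 mu))[s /SM sM ls].
  have h1 := ler_cmod_dist l z 0; have h2 := ler_cmod_dist s l 0.
  rewrite !subr0 in h1 h2; lra.
have [h [hh ev hE]] := ratio_form hH hA w le2r.
have dn0 := det_neq0 D0 off.
have : \det (z%:M - (H w + A w)) = 0.
  rewrite horner_prod_eigenvals; apply/eqP; rewrite prodf_seq_eq0; apply/hasP.
  by exists z; rewrite //= subrr.
rewrite hE // => /eqP; rewrite mulf_eq0 (negbTE dn0) /= => /eqP Phi0.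
have offh : {in eigenvals h, forall l, D <= cmod (z - l)} by move=> l; rewrite ev; exact: off.
have cb := compressed_bound le2r hh D0 offh.
have D1' : D^-1 <= 1 by rewrite invf_le1.
have b1 : entries_le 1 (compressed r h z) by move=> i j; exact: le_trans (cb i j) D1'.
have b0 : entries_le 1 (0 : 'M[C]_(2 * r)) by move=> i j; rewrite mxE cmod0.
have iD : 0 <= D^-1 by rewrite invr_ge0 ltW.
have := lip _ _ D^-1 b0 b1 iD.
rewrite Phi0 subr0 {1}/outlier_det mul0mx subr0 det1 cmod1 => h1.
have : 1 <= La * D^-1.
  by apply: h1 => i j; rewrite mxE sub0r cmodN; exact: cb.
by rewrite ler_pdivlMr // mul1r /D; lra.
Qed.

End UniformLimit.

(** * The limit function and its zeros *)

Section SeqMin.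
Context {R : realType}.

Lemma seq_min_pos (I : eqType) (s : seq I) (Q : I -> R -> Prop) :
  (forall i h h', 0 < h' -> h' <= h -> Q i h -> Q i h') ->
  (forall i, i \in s -> exists2 h, 0 < h & Q i h) ->
  exists2 h, 0 < h & forall i, i \in s -> Q i h.
Proof.
move=> mono; elim: s => [_|i s ih hs]; first by exists 1.
have [h h0 hQ] : exists2 h, 0 < h & forall i', i' \in s -> Q i' h.
  by apply: ih => i' i's; apply: hs; rewrite inE i's orbT.
have [h1 h10 hQ1] := hs i (mem_head i s).
have hm : 0 < Num.min h h1 by rewrite lt_min h0 h10.
exists (Num.min h h1) => // i'; rewrite inE => /orP[/eqP ->|i's].
  by apply: mono hQ1 => //; rewrite ge_min lexx orbT.
by apply: mono (hQ i' i's) => //; rewrite ge_min lexx.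
Qed.

End SeqMin.

Section Asymptotics.
Context {R : realType}.
Local Notation C := R[i].
Implicit Types (f g : C -> C) (x : C) (p : nat).

(** At [x], [|f z|] is equivalent to a positive multiple of [|z - x| ^ p]. The
    error is a factor [t] close to [1] because such errors multiply. *)
Definition has_order x f p := exists2 c : R, 0 < c & forall t, 1 < t ->
  exists2 h : R, 0 < h & forall z, 0 < cmod (z - x) < h ->
    c / t * cmod (z - x) ^+ p <= cmod (f z) <= c * t * cmod (z - x) ^+ p.

Lemma has_orderM x f g p q : has_order x f p -> has_order x g q ->
  has_order x (fun z => f z * g z) (p + q).
Proof.
move=> [c c0 hf] [c' c0' hg]; exists (c * c'); first exact: mulr_gt0.
move=> t t1; have t0 : 0 < t by lra.
have s1 : 1 < Num.sqrt t by rewrite -[ltLHS]sqrtr1 ltr_sqrt.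
have s0 : 0 < Num.sqrt t by lra.
have sq : Num.sqrt t * Num.sqrt t = t by rewrite -expr2 sqr_sqrtr ?ltW.
have [h h0 hh] := hf _ s1; have [h' h0' hh'] := hg _ s1.
exists (Num.min h h'); first by rewrite lt_min h0 h0'.
move=> z /andP[z0]; rewrite lt_min => /andP[zh zh'].
have z1 : 0 < cmod (z - x) < h by rewrite z0 zh.
have z1' : 0 < cmod (z - x) < h' by rewrite z0 zh'.
have /andP[a1 a2] := hh z z1; have /andP[b1 b2] := hh' z z1'.
move: (Num.sqrt t) s0 sq a1 a2 b1 b2 => s s0 <- a1 a2 b1 b2.
have x0 q' : 0 <= cmod (z - x) ^+ q' by rewrite exprn_ge0 ?cmod_ge0.
have cs : 0 <= c / s by rewrite divr_ge0 ?ltW.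
have cs' : 0 <= c' / s by rewrite divr_ge0 ?ltW.
rewrite cmodM exprD; apply/andP; split.
  have := ler_pM (mulr_ge0 cs (x0 p)) (mulr_ge0 cs' (x0 q)) a1 b1.
  apply: le_trans; rewrite le_eqVlt; apply/orP; left; apply/eqP.
  by field; rewrite gt_eqF.
have := ler_pM (cmod_ge0 (f z)) (cmod_ge0 (g z)) a2 b2.
move=> h3; apply: le_trans h3 _; rewrite le_eqVlt; apply/orP; left; apply/eqP.
by ring.
Qed.

Lemma has_order1 x : has_order x (fun=> 1) 0.
Proof.
exists 1 => // t t1; exists 1 => // z _; rewrite expr0 cmod1 !mulr1 !mul1r.
have t0 : 0 < t by lra.
by rewrite invf_le1 // ltW.
Qed.

Lemma has_order_exp x f p n : has_order x f p ->
  has_order x (fun z => f z ^+ n) (n * p).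
Proof.
move=> hf; elim: n => [|n ih]; first exact: has_order1.
by under eq_fun do rewrite exprS; rewrite mulSn; exact: has_orderM.
Qed.

Lemma has_order_prod x (I : Type) (s : seq I) (f : I -> C -> C) (p : I -> nat) :
  (forall i, has_order x (f i) (p i)) ->
  has_order x (fun z => \prod_(i <- s) f i z) (\sum_(i <- s) p i).
Proof.
move=> hf; elim: s => [|i s ih].
  by under eq_fun do rewrite big_nil; rewrite big_nil; exact: has_order1.
by under eq_fun do rewrite big_cons; rewrite big_cons; exact: has_orderM.
Qed.

Lemma vanishes_has_order x f p a : a != 0 -> vanishes_to_order f x p ->
  has_order x (fun z => a * f z) p.
Proof.
move=> a0 [c c0 hf]; have ca : 0 < cmod a by rewrite cmod_gt0.
have cc : 0 < cmod c by rewrite cmod_gt0.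
exists (cmod a * cmod c); first exact: mulr_gt0.
move=> t t1; have t0 : 0 < t by lra.
have it1 : t^-1 < 1 by rewrite invf_lt1.
have e0 : 0 < cmod c * (1 - t^-1) by rewrite mulr_gt0 // subr_gt0.
have [h h0 hh] := hf _ e0; exists h => // z hz.
have z0 : 0 < cmod (z - x) by case/andP: hz.
have q0 : 0 < cmod (z - x) ^+ p by rewrite exprn_gt0.
have := hh z hz; set y := f z / _ => hy.
have fE : cmod (f z) = cmod y * cmod (z - x) ^+ p.
  by rewrite /y cmodM cmodV cmodX divfK // gt_eqF.
have h1 := ler_cmod_dist y c 0; rewrite !subr0 cmodB in h1.
have h2 := ler_cmod_dist c y 0; rewrite !subr0 in h2.
have ct : cmod c * (1 - t^-1) = cmod c - cmod c / t by rewrite mulrBr mulr1.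
have tt : cmod c + (cmod c - cmod c / t) <= cmod c * t.
  rewrite -subr_ge0 (_ : _ - _ = cmod c / t * (t - 1) ^+ 2).
    by rewrite mulr_ge0 ?sqr_ge0 // divr_ge0 ?ltW.
  by field; rewrite gt_eqF.
rewrite ct in hy.
rewrite cmodM fE mulrA; apply/andP; split; rewrite ler_pM2r // -mulrA ler_pM2l //; lra.
Qed.

End Asymptotics.

Section LimitDeterminant.
Context {R : realType} (mu : probability (measurableTypeR R) R)
  (n : nat) (A0 : 'M[R[i]]_n)
  (j : nat) (theta : 'I_j -> R[i]) (theta_inj : injective theta)
  (htheta : forall z : R[i], (exists i, theta i = z) <-> z != 0 /\ eigenvalue A0 z)
  (k : 'I_j -> nat) (hk : forall i, k i = mup (theta i) (char_poly A0))
  (m : 'I_j -> nat) (xi : forall i, 'I_(m i) -> R[i])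
  (hxi : forall i, lists_outliers mu (theta i) (xi i)).
Local Notation C := R[i].
Local Notation S := (csupp mu).
Local Notation G := (cauchy_transform mu).

Lemma theta_neq0 i : theta i != 0.
Proof. by have [] := (htheta (theta i)).1 (ex_intro _ i erefl). Qed.

Lemma outlier_det_scalar g :
  outlier_det A0 g%:M = \prod_(i < j) (1 - theta i * g) ^+ k i.
Proof.
have h1 : outlier_det A0 g%:M = \prod_(l <- eigenvals A0) (1 - g * l).
  rewrite /outlier_det mul_scalar_mx; have [->|g0] := eqVneq g 0.
    by rewrite scale0r subr0 det1 big1 // => l _; rewrite mul0r subr0.
  have -> : 1%:M - g *: A0 = g *: (g^-1%:M - A0).
    by rewrite scalerBr scale_scalar_mx mulfV.
  rewrite detZ horner_prod_eigenvals -[in g ^+ n](size_eigenvals A0).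
  apply: esym; transitivity (\prod_(l <- eigenvals A0) (g * (g^-1 - l))).
    by apply: eq_bigr => l _; rewrite mulrBr mulfV.
  by rewrite big_split /= big_const_seq count_predT iter_mulr_1.
rewrite h1.
transitivity (\prod_(l <- eigenvals A0) \prod_(i < j) (if l == theta i then 1 - theta i * g else 1)).
  rewrite [LHS]big_seq [RHS]big_seq; apply: eq_bigr => l lin.
  have [l0|l0] := eqVneq l 0.
    rewrite l0 mulr0 subr0 big1 // => i _.
    by rewrite eq_sym (negbTE (theta_neq0 i)).
  have el : eigenvalue A0 l.
    by rewrite eigenvalue_root_char char_poly_eigenvals root_prod_XsubC.
  have [i thi] := (htheta l).2 (conj l0 el).
  rewrite (bigD1 i) //= thi eqxx (mulrC g) big1 ?mulr1 // => i' ii'.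
  by rewrite -thi (inj_eq theta_inj) eq_sym (negbTE ii').
rewrite exchange_big /=; apply: eq_bigr => i _.
rewrite hk char_poly_eigenvals mu_prod_XsubC.
elim: (eigenvals A0) => [|l s ih]; first by rewrite big_nil.
by rewrite big_cons /= ih; case: (l == theta i); rewrite ?exprS ?mul1r.
Qed.

Definition outlier_points : seq C :=
  flatten [seq [seq xi n' | n' <- enum 'I_(m i)] | i <- enum 'I_j].

Lemma outlier_pointsP z : reflect (exists i (n' : 'I_(m i)), z = xi n') (z \in outlier_points).
Proof.
apply: (iffP flatten_mapP) => [[i _ /mapP[n' _ ->]]|[i [n' ->]]]; first by exists i, n'.
by exists i; rewrite ?mem_enum //; apply: map_f; rewrite mem_enum.
Qed.

Lemma outlier_points_off z : z \in outlier_points -> 0 < cdist z S.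
Proof.
move=> /outlier_pointsP[i [n' ->]]; apply: cdist_csupp_gt0.
have [h _] := hxi i; have : outlier_set mu (theta i) (xi n').
  by rewrite -h; exists n'.
by case.
Qed.

Definition point_mult (z : C) := (\sum_(i < j) k i * #|[pred n' | @xi i n' == z]|)%N.

Lemma limit_det_zero z : 0 < cdist z S -> outlier_det A0 (G z)%:M = 0 ->
  z \in outlier_points.
Proof.
move=> dz /eqP; rewrite outlier_det_scalar prodf_seq_eq0 => /hasP[i _ /=].
rewrite expf_eq0 => /andP[_]; rewrite subr_eq0 => /eqP h.
apply/outlier_pointsP; exists i.
have : outlier_set mu (theta i) z.
  split; first by move=> Sz; have := cdist_le z Sz; rewrite subrr cmod0 leNgt dz.
  by apply: (mulfI (theta_neq0 i)); rewrite -h mulfV // theta_neq0.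
by have [<- _] := hxi i; case=> n' _ <-; exists n'.
Qed.

(** Each zero of [G - 1 / theta] of order [p] is a zero of the limit
    determinant of order [p] times the multiplicity of [theta]. *)
Lemma limit_det_order z : 0 < cdist z S ->
  has_order z (fun w => outlier_det A0 (G w)%:M) (point_mult z).
Proof.
move=> dz; under eq_fun do rewrite outlier_det_scalar.
apply: has_order_prod => i; apply: has_order_exp.
have -> : (fun w => 1 - theta i * G w) = (fun w => - theta i * (G w - (theta i)^-1)).
  by apply/funext => w; rewrite mulNr mulrBr mulfV ?theta_neq0 // opprB.
apply: vanishes_has_order; first by rewrite oppr_eq0 theta_neq0.
have [img ord] := hxi i.
have [/existsP[n' /eqP zE]|none] := boolP [exists n', @xi i n' == z].
  by rewrite -zE; exact: ord.
have -> : #|[pred n' | @xi i n' == z]| = 0%N.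
  apply: eq_card0 => n'; rewrite !inE; apply/negbTE; apply: contra none => h.
  by apply/existsP; exists n'.
exists (G z - (theta i)^-1).
  rewrite subr_eq0; apply/negP => /eqP h.
  have : outlier_set mu (theta i) z.
    by split=> // Sz; have := cdist_le z Sz; rewrite subrr cmod0 leNgt dz.
  rewrite -img => -[n' _ zE]; move/negP: none; apply.
  by apply/existsP; exists n'; rewrite zE.
move=> e e0; pose D := cdist z S / 2.
have D0 : 0 < D by rewrite divr_gt0.
have c0 : 0 < 2 / D ^+ 2 + 1 by rewrite ltr_wpDl // divr_ge0 // sqr_ge0.
exists (Num.min D (e / (2 / D ^+ 2 + 1))); first by rewrite lt_min D0 divr_gt0.
move=> w /andP[_]; rewrite lt_min => /andP[wD we].
rewrite expr0 divr1 opprB addrA subrK.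
have lw := cdist_lip z w (csupp_neq0 mu).
have offz : D <= cdist z S by rewrite /D; lra.
have offw : D <= cdist w S by rewrite cmodB in wD; rewrite /D in wD *; lra.
apply: le_lt_trans (cauchy_transform_lip D0 ((off_supportP mu D w).1 offw)
  ((off_supportP mu D z).1 offz)) _.
rewrite ltr_pdivlMr // in we; apply: le_lt_trans we.
rewrite mulrDr mulr1 -[leLHS]addr0; apply: lerD; last exact: cmod_ge0.
by rewrite le_eqVlt; apply/orP; left; apply/eqP; ring.
Qed.

End LimitDeterminant.

Section PositiveMinimum.
Context {R : realType}.
Local Notation C := R[i].

Lemma cmod_pair_ball (p q : R * R) (e : R) : ball p e q ->
  cmod ((p.1 +i* p.2) - (q.1 +i* q.2)) < e + e.
Proof.
case: p q => [a b] [a' b'] [/= h1 h2]; apply: le_lt_trans (ler_cmod_ReIm _) _.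
exact: ltrD.
Qed.

Lemma pos_min (F : C -> C) (K : set C) (L M : R) :
  (forall z, K z -> cmod z <= L) ->
  (forall z, (forall e : R, 0 < e -> exists2 w, K w & cmod (z - w) < e) -> K z) ->
  (forall z w, K z -> K w -> cmod (F z - F w) <= M * cmod (z - w)) ->
  (forall z, K z -> F z != 0) ->
  exists2 c : R, 0 < c & forall z, K z -> c <= cmod (F z).
Proof.
move=> KL Kcl Flip F0.
pose K' : set (R * R) := [set p | K (p.1 +i* p.2)].
have [[p0 hp0]|empty] := pselect (exists p, K' p); last first.
  exists 1 => // -[a b] hz; exfalso; apply: empty; by exists (a, b).
have cK : compact K'.
  apply: (@subclosed_compact _ _ (`[- L, L]%classic `*` `[- L, L]%classic)).
  - move=> p hp; apply: Kcl => e e0.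
    have e2 : 0 < e / 2 by rewrite divr_gt0.
    have [q [hq pq]] := hp _ (nbhsx_ballx p _ e2).
    by exists (q.1 +i* q.2) => //; have := cmod_pair_ball pq; rewrite -splitr.
  - by apply: compact_setX; exact: segment_compact.
  - case=> a b /KL h; split => /=; rewrite in_itv /= -ler_norml.
      exact: le_trans (ler_Re_cmod (a +i* b)) h.
    exact: le_trans (ler_Im_cmod (a +i* b)) h.
have cF : {within K', continuous (fun p : R * R => cmod (F (p.1 +i* p.2)))}.
  apply/subspace_continuousP => p hp; apply/cvgrPdist_lt => e e0.
  have M1 : 0 < `|M| + 1 by rewrite ltr_wpDl.
  pose h := e / (`|M| + 1) / 2; have h0 : 0 < h by rewrite !divr_gt0.
  rewrite near_withinE; apply: filterS (nbhsx_ballx p _ h0) => q pq hq.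
  have d1 : `|cmod (F (p.1 +i* p.2)) - cmod (F (q.1 +i* q.2))|
      <= cmod (F (p.1 +i* p.2) - F (q.1 +i* q.2)).
    have t1 := ler_cmod_dist (F (q.1 +i* q.2)) (F (p.1 +i* p.2)) 0.
    have t2 := ler_cmod_dist (F (p.1 +i* p.2)) (F (q.1 +i* q.2)) 0.
    rewrite !subr0 in t1 t2; rewrite [X in _ <= X + _]cmodB in t2.
    by rewrite ler_norml; apply/andP; split; lra.
  apply: le_lt_trans d1 _; apply: le_lt_trans (Flip _ _ hp hq) _.
  have := cmod_pair_ball pq; set t := cmod _ => ht.
  have t0 : 0 <= t by exact: cmod_ge0.
  apply: (@le_lt_trans _ _ ((`|M| + 1) * t)).
    by rewrite ler_wpM2r // (le_trans (ler_norm M)) // lerDl.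
  by rewrite mulrC -ltr_pdivlMr //; apply: lt_le_trans ht _; rewrite /h -splitr.
have [p hp pmin] := compact_EVT_min (ex_intro _ p0 hp0) cK cF.
exists (cmod (F (p.1 +i* p.2))); first by rewrite cmod_gt0; exact: (F0 _ (set_mem hp)).
by case=> a b hz; apply: (pmin (a, b)); exact: mem_set.
Qed.

End PositiveMinimum.

(** * Counting the outliers *)

Section Counting.
Context {R : realType} {d : nat -> measure_display}
  {T : forall N, measurableType (d N)} (P : forall N, probability (T N) R)
  (H : forall N, T N -> 'M[R[i]]_N) (mu : probability (measurableTypeR R) R)
  (r : nat) (A0 : 'M[R[i]]_(2 * r)) (A : forall N, T N -> 'M[R[i]]_N)
  (j : nat) (theta : 'I_j -> R[i]) (k : 'I_j -> nat)
  (m : 'I_j -> nat) (xi : forall i, 'I_(m i) -> R[i]).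
Local Notation C := R[i].
Local Notation S := (csupp mu).
Local Notation G := (cauchy_transform mu).
Local Notation F := (limit_det mu A0).
Local Notation pts := (outlier_points xi).
Local Notation mult := (point_mult k xi).
Hypothesis hH : UCI P H mu.
Hypothesis hA : finite_rank_perturbation P H A0 A.
Hypothesis theta_inj : injective theta.
Hypothesis htheta :
  forall z : C, (exists i, theta i = z) <-> z != 0 /\ eigenvalue A0 z.
Hypothesis hk : forall i, k i = mup (theta i) (char_poly A0).
Hypothesis hxi : forall i, lists_outliers mu (theta i) (@xi i).

(** The zeros of the limit determinant are outlier points, and away from them its
    modulus attains a positive minimum by compactness. *)
Lemma limit_det_lower_bound (dl s L : R) : 0 < dl -> 0 < s ->
  exists2 c : R, 0 < c & forall z, dl <= cdist z S -> cmod z <= L ->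
    (forall x, x \in pts -> s <= cmod (z - x)) -> c <= cmod (F z).
Proof.
move=> d0 s0; have [M M0 lip] := limit_det_lip mu A0 d0.
pose K := [set z | [/\ dl <= cdist z S, cmod z <= L &
  forall x, x \in pts -> s <= cmod (z - x)]].
have [||||c c0 hc] := @pos_min R F K L M.
- by move=> z [].
- move=> z hz; split.
  + apply/ler_addgt0Pr => e e0; have [w [h _ _] zw] := hz e e0.
    have := cdist_lip w z (csupp_neq0 mu); rewrite cmodB; lra.
  + apply/ler_addgt0Pr => e e0; have [w [_ h _] zw] := hz e e0.
    have := ler_cmod_dist w z 0; rewrite !subr0; lra.
  + move=> x xin; apply/ler_addgt0Pr => e e0; have [w [_ _ h] zw] := hz e e0.
    have := ler_cmod_dist z w x; have := h x xin; rewrite (cmodB w z); lra.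
- by move=> z w [h1 _ _] [h2 _ _]; exact: lip.
- move=> z [h1 _ h3]; apply/eqP => F0.
  have zin : z \in pts.
    by apply: (limit_det_zero theta_inj htheta hk hxi _ F0); exact: lt_le_trans h1.
  by have := h3 z zin; rewrite subrr cmod0 leNgt s0.
by exists c => // z h1 h2 h3; apply: hc.
Qed.

(** The spectrum of [H + A] outside the [dl]-neighbourhood of the support lies in
    the discs of radius [eta] about the outlier points, each disc containing as
    many eigenvalues as the limit determinant has zeros at its centre. *)
Definition well_placed N (dl eta : R) (w : T N) :=
  (forall x, x \in eigenvals (H w + A w) -> dl < cdist x S ->
     exists2 y, y \in pts & cmod (x - y) < eta) /\
  (forall y, y \in pts ->
     count (fun x => cmod (x - y) < eta) (eigenvals (H w + A w)) = mult y).

(** Away from small discs about the outlier points the limit determinant is bounded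
    below, so the uniformly close ratio cannot vanish there. On two circles
    about each point both have the modulus of a monomial up to a factor, which
    determines the number of zeros inside. *)
Lemma well_placed_whp (dl d0 eta : R) : 0 < dl -> dl < d0 ->
  (forall y, y \in pts -> d0 <= cdist y S) ->
  (forall y y', y \in pts -> y' \in pts -> y != y' -> 2 * eta <= cmod (y - y')) ->
  0 < eta -> eta <= d0 - dl ->
  with_high_probability P (fun N => [set w | well_placed dl eta w]).
Proof.
move=> dl0 dld ptsd sep eta0 etad.
have dl2 : 0 < dl / 2 by rewrite divr_gt0.
have [h h0 asym] : exists2 h, 0 < h & forall y, y \in pts -> exists2 c : R, 0 < c &
    forall z, 0 < cmod (z - y) < h ->
      c / (5 / 4) * cmod (z - y) ^+ mult y <= cmod (F z)
        <= c * (5 / 4) * cmod (z - y) ^+ mult y.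
  apply: seq_min_pos => [y h h' h'0 h'h [c c0 hc]|y yin].
    exists c => // z /andP[z0 zh]; apply: hc; rewrite z0 /=; exact: lt_le_trans h'h.
  have yS : 0 < cdist y S by apply: lt_le_trans (ptsd y yin); lra.
  have [c c0 hc] := limit_det_order theta_inj htheta hk hxi yS.
  have [|h h0 hh] := hc (5 / 4); first by lra.
  by exists h => //; exists c.
(* The radii must have a ratio greater than [3] to count zeros. *)
pose rho := Num.min eta h / 2; pose s := rho / 4.
have rho0 : 0 < rho by rewrite divr_gt0 // lt_min eta0.
have rho_eta : rho <= eta / 2 by rewrite ler_pM2r ?invr_gt0 // ge_min lexx.
have rho_h : rho <= h / 2 by rewrite ler_pM2r ?invr_gt0 // ge_min lexx orbT.
have s0 : 0 < s by rewrite divr_gt0.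
have s3 : 3 * s < rho by rewrite /s; lra.
have [L1 far] := no_far_eigenvalue hH hA dl2.
have [L2 L20 ptsL] : exists2 L2, 0 < L2 & forall y, y \in pts -> cmod y <= L2.
  have [||h' h'0 hh'] := @seq_min_pos R _ pts (fun y h' => cmod y <= h'^-1).
  - move=> y a b b0 ba; move=> hy; apply: le_trans hy _.
    by rewrite lef_pV2 ?posrE // (lt_le_trans b0).
  - move=> y _; exists ((cmod y + 1)^-1); last by rewrite invrK lerDl.
    by rewrite invr_gt0 ltr_wpDl ?cmod_ge0.
  by exists h'^-1; rewrite ?invr_gt0.
pose L := Num.max L1 (L2 + eta).
have [c c0 low] := limit_det_lower_bound L dl0 s0.
(* The limit determinant lies within a factor [5/4] of [c' |z - y| ^ mult y]; an
   error of at most a quarter of this monomial leaves the ratio between its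
   half and three halves of it. *)
have [e e0 he] : exists2 e : R, 0 < e & forall y, y \in pts -> exists2 c' : R, 0 < c' &
    (e <= c' / 4 * s ^+ mult y /\ forall z, 0 < cmod (z - y) < h ->
      c' / (5 / 4) * cmod (z - y) ^+ mult y <= cmod (F z)
        <= c' * (5 / 4) * cmod (z - y) ^+ mult y).
  apply: seq_min_pos => [y a b b0 ba [c' c'0 [h1 h2]]|y yin].
    by exists c' => //; split => //; exact: le_trans h1.
  have [c' c'0 hc'] := asym y yin.
  exists (c' / 4 * s ^+ mult y); last by exists c'.
  by rewrite mulr_gt0 ?exprn_gt0 // divr_gt0.
pose eps := Num.min c e.
have eps0 : 0 < eps by rewrite lt_min c0 e0.
apply: whpS (uniform_whp hH hA L dl2 eps0) => N w /= [le2r sp unif].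
rewrite (_ : 2 * (dl / 2) = dl) in unif; last by field.
have inside x : x \in eigenvals (H w + A w) -> dl <= cdist x S ->
    exists2 y, y \in pts & cmod (x - y) < s.
  move=> xin xS; apply: contrapT => none.
  have xL : cmod x <= L by rewrite le_max (far N w le2r sp x xin).
  have := unif x xS xL; rewrite /ratio horner_prod_eigenvals.
  have -> : \prod_(l <- eigenvals (H w + A w)) (x - l) = 0.
    by apply/eqP; rewrite prodf_seq_eq0; apply/hasP; exists x; rewrite //= subrr.
  rewrite mul0r sub0r cmodN lt_min ltNge low //.
  move=> y yin; rewrite leNgt; apply/negP => xy; apply: none; by exists y.
have near_own x y : x \in eigenvals (H w + A w) -> y \in pts -> cmod (x - y) < eta ->
    cmod (x - y) < s.
  move=> xin yin xy.
  have xS : dl <= cdist x S.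
    have := cdist_lip y x (csupp_neq0 mu); have := ptsd y yin; rewrite cmodB; lra.
  have [y' y'in xy'] := inside x xin xS.
  have [->//|yy'] := eqVneq y y'.
  have := sep y y' yin y'in yy'; have := ler_cmod_dist x y y'; rewrite (cmodB y x).
  have se : s <= eta by rewrite /s; lra.
  by lra.
split.
  move=> x xin /ltW xS; have [y yin xy] := inside x xin xS; exists y => //.
  by apply: lt_le_trans xy _; rewrite /s; lra.
move=> y yin.
have -> : count (fun x => cmod (x - y) < eta) (eigenvals (H w + A w)) =
    count (fun x => cmod (x - y) < s) (eigenvals (H w + A w)).
  apply: eq_in_count => x xin; apply/idP/idP => [h1|h1]; first exact: near_own.
  by apply: lt_le_trans h1 _; rewrite /s; lra.
have [c' c'0 [ec' hc']] := he y yin.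
have c20 : 0 < c' / 2 by rewrite divr_gt0.
apply: (@count_zeros R _ (eigenvals (H w)) y s rho (c' / 2) (mult y) s0 s3 c20).
- move=> a ain; have [h1|h1] := ltP (cmod (a - y)) s; first by left.
  right; rewrite ltNge; apply/negP => h2.
  have : cmod (a - y) < s by apply: near_own => //; lra.
  by rewrite ltNge h1.
- move=> b bin; have := sp b bin.
  have := cdist_lip y b (csupp_neq0 mu); have := ptsd y yin; rewrite cmodB; lra.
- move=> z hz; rewrite -(horner_prod_eigenvals (H w + A w) z) -(horner_prod_eigenvals (H w) z).
  rewrite -/(ratio H A w z).
  have zr : s <= cmod (z - y) <= rho by case: hz => ->; apply/andP; split; lra.
  have /andP[z1 z2] := zr.
  have zS : dl <= cdist z S.
    have := cdist_lip y z (csupp_neq0 mu); have := ptsd y yin; rewrite cmodB; lra.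
  have zL : cmod z <= L.
    rewrite le_max; apply/orP; right; have := ptsL y yin.
    have := ler_cmod_dist y z 0; rewrite !subr0; lra.
  have := unif z zS zL; rewrite lt_min => /andP[_ un].
  have zh : 0 < cmod (z - y) < h by apply/andP; split; lra.
  have /andP[F1 F2] := hc' z zh.
  have mono : s ^+ mult y <= cmod (z - y) ^+ mult y.
    by apply: lerXn2r; rewrite ?nnegrE ?cmod_ge0 // ltW.
  have X0 : 0 <= cmod (z - y) ^+ mult y by rewrite exprn_ge0 ?cmod_ge0.
  have eX : e <= c' / 4 * cmod (z - y) ^+ mult y.
    by apply: le_trans ec' _; rewrite ler_pM2l // divr_gt0.
  have t1 := ler_cmod_dist (F z) (ratio H A w z) 0.
  have t2 := ler_cmod_dist (ratio H A w z) (F z) 0.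
  rewrite !subr0 in t1 t2; rewrite [X in _ <= X + _]cmodB in t2.
  move: (cmod (z - y) ^+ mult y) X0 eX F1 F2 => X X0 eX F1 F2.
  have cX : 0 <= c' * X by rewrite mulr_ge0 // ltW.
  rewrite (_ : c' / (5 / 4) * X = 4 / 5 * (c' * X)) in F1; last by field.
  rewrite (_ : c' * (5 / 4) * X = 5 / 4 * (c' * X)) in F2; last by field.
  rewrite (_ : c' / 4 * X = 1 / 4 * (c' * X)) in eX; last by field.
  rewrite (_ : c' / 2 * X = 1 / 2 * (c' * X)); last by field.
  rewrite (_ : 3 * (c' / 2) * X = 3 / 2 * (c' * X)); last by field.
  by apply/andP; split; lra.
Qed.

End Counting.

(** * Labelling the outliers *)

Section Labelling.
Context {R : realType}.
Local Notation C := R[i].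

Lemma perm_map_lift (T1 T2 : eqType) (f : T1 -> T2) (s : seq T1) (t : seq T2) :
  perm_eq (map f s) t -> exists2 s', perm_eq s s' & map f s' = t.
Proof.
case: s => [|x0 s0]; first by move=> /perm_size/esym/size0nil ->; exists [::].
move: (x0 :: s0) => s; rewrite perm_sym => /(perm_iotaP (f x0))[Is pI ->].
rewrite size_map in pI; exists [seq nth x0 s i | i <- Is].
  rewrite perm_sym; apply: perm_trans (perm_map _ pI) _.
  by rewrite -/(mkseq _ _) mkseq_nth.
rewrite -map_comp; apply/eq_in_map => i; rewrite (perm_mem pI) mem_iota /= add0n => lt.
by rewrite (nth_map x0).
Qed.

(** If each point is the centre of as many outliers as there are indices attached to
    it, then the outliers can be distributed among the indices. *)
Lemma label_fibres (X : finType) (O : seq C) (c : C -> C) (pt : X -> C) :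
  perm_eq (map c O) [seq pt x | x <- enum X] ->
  exists2 lam : X -> C, perm_eq O [seq lam x | x <- enum X] & forall x, c (lam x) = pt x.
Proof.
move=> /perm_map_lift[s' ps cO].
have ss : size s' = size (enum X) by rewrite -(size_map c) cO size_map.
pose lam x := nth 0 s' (index x (enum X)).
have lamE : [seq lam x | x <- enum X] = s'.
  apply: (@eq_from_nth _ 0); first by rewrite size_map ss.
  move=> i; rewrite size_map => lt; case E : (enum X) lt => [//|x0 s] lt.
  by rewrite -E (nth_map x0) ?E // /lam E index_uniq // -E enum_uniq.
exists lam; first by rewrite lamE.
move=> x; have : [seq c (lam x) | x <- enum X] = [seq pt x | x <- enum X].
  by rewrite (map_comp c lam) lamE cO.
by move/eq_in_map; apply; rewrite mem_enum.
Qed.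

Section Indices.
Variables (j : nat) (k m : 'I_j -> nat).

Definition outlier_index := {i : 'I_j & 'I_(m i) * 'I_(k i)}%type.

Definition label_list (lam : forall i, 'I_(m i) -> 'I_(k i) -> C) : seq C :=
  \big[cat/[::]]_(i < j) \big[cat/[::]]_(n < m i) [seq lam i n l | l <- enum 'I_(k i)].

Lemma count_label_list lam a :
  count a (label_list lam) =
  (\sum_(i < j) \sum_(n < m i) \sum_(l < k i) a (lam i n l))%N.
Proof.
rewrite /label_list (big_morph _ (count_cat a) (erefl _ : count a [::] = 0%N)).
apply: eq_bigr => i _; rewrite (big_morph _ (count_cat a) (erefl _ : count a [::] = 0%N)).
apply: eq_bigr => n _; rewrite count_map -sum1_count big_enum_cond /=.
by rewrite big_mkcond.
Qed.

Lemma count_index (lam : outlier_index -> C) a :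
  count a [seq lam x | x <- enum {: outlier_index}] =
  (\sum_(i < j) \sum_(n < m i) \sum_(l < k i) a (lam (Tagged _ (n, l))))%N.
Proof.
rewrite count_map -sum1_count big_enum_cond big_mkcond /=.
under [RHS]eq_bigr => i _ do rewrite pair_bigA /=.
rewrite (sig_big_dep predT (fun i => predT) (fun i p => (a (lam (Tagged _ (p.1, p.2))) : nat))) /=.
by apply: eq_bigr => -[i [n l]] _.
Qed.

Lemma label_list_index (lam : outlier_index -> C) :
  perm_eq [seq lam x | x <- enum {: outlier_index}]
    (label_list (fun i n l => lam (Tagged _ (n, l)))).
Proof. by apply/seq.permP => a; rewrite count_index count_label_list. Qed.

Lemma size_label_list lam : size (label_list lam) = (\sum_(i < j) k i * m i)%N.
Proof.
rewrite -count_predT count_label_list; apply: eq_bigr => i _.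
by rewrite /= !sum_nat_const !card_ord muln1 mulnC.
Qed.

End Indices.

(** When the discs of radius [eta] about the points are disjoint, this is the centre
    of the disc that contains [x]. *)
Definition centre (pts : seq C) (eta : R) (x : C) : C :=
  nth 0 pts (find (fun y => cmod (x - y) < eta) pts).

Lemma centreE (pts : seq C) (eta : R) x y :
  (forall y y', y \in pts -> y' \in pts -> y != y' -> 2 * eta <= cmod (y - y')) ->
  y \in pts -> cmod (x - y) < eta -> centre pts eta x = y.
Proof.
move=> sep yin xy; have hs : has (fun y => cmod (x - y) < eta) pts by apply/hasP; exists y.
have := nth_find 0 hs; rewrite -/(centre pts eta x) => xc.
apply/eqP; apply: contraT => cy.
have cin : centre pts eta x \in pts by rewrite mem_nth // -has_find.
have := sep _ _ cin yin cy; have := ler_cmod_dist x (centre pts eta x) y.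
rewrite (cmodB _ x); lra.
Qed.

End Labelling.

Section Assembly.
Context {R : realType} (mu : probability (measurableTypeR R) R) (N : nat) (M : 'M[R[i]]_N)
  (j : nat) (k m : 'I_j -> nat) (xi : forall i, 'I_(m i) -> R[i]).
Local Notation C := R[i].
Local Notation S := (csupp mu).
Local Notation pts := (outlier_points xi).
Local Notation mult := (point_mult k xi).

(** The discs are disjoint and lie beyond distance [dl] from the support, so the
    eigenvalues counted in them are exactly the outliers, each with one centre. *)
Lemma labelling_exists (dl d0 eta : R) :
  (forall y, y \in pts -> d0 <= cdist y S) ->
  (forall y y', y \in pts -> y' \in pts -> y != y' -> 2 * eta <= cmod (y - y')) ->
  eta <= d0 - dl ->
  (forall x, x \in eigenvals M -> dl < cdist x S ->
     exists2 y, y \in pts & cmod (x - y) < eta) ->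
  (forall y, y \in pts -> count (fun x => cmod (x - y) < eta) (eigenvals M) = mult y) ->
  exists lam : forall i, 'I_(m i) -> 'I_(k i) -> C,
    perm_eq [seq x <- eigenvals M | dl < cdist x S] (label_list lam) /\
    forall i (n : 'I_(m i)) (l : 'I_(k i)), cmod (lam i n l - xi n) < eta.
Proof.
move=> ptsd sep etad inside cnt.
pose c := centre pts eta; pose O := [seq x <- eigenvals M | dl < cdist x S].
pose pt (x : outlier_index k m) := xi (tagged x).1.
have ptin x : pt x \in pts by apply/outlier_pointsP; exists (tag x), (tagged x).1.
have cO x : x \in O -> c x \in pts /\ cmod (x - c x) < eta.
  rewrite mem_filter => /andP[xS xin]; have [y yin xy] := inside x xin xS.
  by rewrite /c (centreE sep yin xy).
have pe : perm_eq (map c O) [seq pt x | x <- enum {: outlier_index k m}].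
  apply/allP => y _ /=; apply/eqP; rewrite count_index.
  have [yin|yout] := boolP (y \in pts); last first.
    rewrite !big1 => [|i _]; last first.
      rewrite big1 // => n _; rewrite big1 // => l _ /=.
      have := ptin (Tagged _ (n, l)); rewrite /pt /=; case: eqP => // ->.
      by rewrite (negbTE yout).
    apply/eqP; rewrite -leqn0 leqNgt -has_count; apply/hasPn => _ /mapP[x xO ->].
    have [cin _] := cO x xO; apply: contra yout => /eqP <-; exact: cin.
  transitivity (mult y); last first.
    rewrite /point_mult; apply: eq_bigr => i _; rewrite mulnC -sum1_card big_distrl /=.
    rewrite big_mkcond /=; apply: eq_bigr => n _ /=.
    by rewrite /pt /= sum_nat_const card_ord inE; case: (xi n == y); rewrite ?mul1n ?muln1 ?muln0.
  rewrite -(cnt y yin) count_map count_filter; apply: eq_in_count => x xin /=.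
  apply/andP/idP => [[/eqP cxy xS]|xy].
    have [|_] := cO x; first by rewrite mem_filter xS.
    by rewrite cxy.
  split; first by apply/eqP; exact: centreE.
  have := cdist_lip y x (csupp_neq0 mu); have := ptsd y yin; rewrite cmodB; lra.
have [lam ps clam] := label_fibres pe.
exists (fun i n l => lam (Tagged _ (n, l))); split.
  exact: perm_trans ps (label_list_index lam).
move=> i n l; have := clam (Tagged _ (n, l)); rewrite /pt /= => <-.
have [] // := cO (lam (Tagged (fun i => ('I_(m i) * 'I_(k i))%type) (n, l))).
by rewrite (perm_mem ps); apply: map_f; rewrite mem_enum.
Qed.

End Assembly.

Theorem theorem3p9 (R : realType) (d : nat -> measure_display)
    (T : forall N, measurableType (d N)) (P : forall N, probability (T N) R)
    (H : forall N, T N -> 'M[R[i]]_N)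
    (mu : probability (measurableTypeR R) R) (hH : UCI P H mu)
    (r : nat) (hr : (1 <= r)%N) (A0 : 'M[R[i]]_(2 * r))
    (A : forall N, T N -> 'M[R[i]]_N)
    (hA : finite_rank_perturbation P H A0 A)
    (j : nat) (theta : 'I_j -> R[i]) (theta_inj : injective theta)
    (htheta : forall z : R[i],
      (exists i, theta i = z) <-> z != 0 /\ eigenvalue A0 z)
    (k : 'I_j -> nat) (hk : forall i, k i = mup (theta i) (char_poly A0))
    (m : 'I_j -> nat) (xi : forall i, 'I_(m i) -> R[i])
    (hxi : forall i, lists_outliers mu (theta i) (xi i)) :
  exists2 delta0 : R, 0 < delta0 &
  forall delta : R, 0 < delta < delta0 ->
  let outliers N (w : T N) :=
    [seq z <- eigenvals (H N w + A N w) | delta < cdist z (csupp mu)] in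
  with_high_probability P (fun N =>
    [set w | size (outliers N w) = (\sum_(i < j) k i * m i)%N]) /\
  exists lam : forall N, T N -> forall i, 'I_(m i) -> 'I_(k i) -> R[i],
    with_high_probability P (fun N =>
      [set w | perm_eq (outliers N w)
        (\big[cat/[::]]_(i < j) \big[cat/[::]]_(n < m i)
           [seq lam N w i n l | l <- enum 'I_(k i)])]) /\
    forall i (n : 'I_(m i)) (l : 'I_(k i)),
      tends_to0_in_probability P (fun N w => cmod (lam N w i n l - xi i n)).
Proof.
pose S := csupp mu; pose pts := outlier_points xi.
have [d0 d00 ptsd] : exists2 d0 : R, 0 < d0 & forall y, y \in pts -> d0 <= cdist y S.
  apply: seq_min_pos => [y h h' _ h'h|y yin]; first exact: le_trans.
  by exists (cdist y S) => //; exact: (outlier_points_off hxi).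
have [sep sep0 hsep] : exists2 sep : R, 0 < sep & forall y, y \in pts ->
    forall y', y' \in pts -> y != y' -> 2 * sep <= cmod (y - y').
  apply: seq_min_pos => [y h h' _ h'h hy y' y'in yy'|y yin].
    by apply: le_trans (hy y' y'in yy'); rewrite ler_pM2l.
  apply: seq_min_pos => [y' h h' _ h'h hy yy'|y' y'in].
    by apply: le_trans (hy yy'); rewrite ler_pM2l.
  have [->|yy'] := eqVneq y y'; first by exists 1.
  exists (cmod (y - y') / 2); first by rewrite divr_gt0 // cmod_gt0 subr_eq0.
  by move=> _; rewrite mulrC divfK.
exists d0 => // dl /andP[dl0 dld0] outliers.
pose eta0 := Num.min sep (d0 - dl).
have eta00 : 0 < eta0 by rewrite lt_min sep0 subr_gt0.
have eta0d : eta0 <= d0 - dl by rewrite ge_min lexx orbT.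
have sepE e : e <= eta0 -> forall y y', y \in pts -> y' \in pts -> y != y' ->
    2 * e <= cmod (y - y').
  move=> ee y y' yin y'in yy'; apply: le_trans (hsep y yin y' y'in yy').
  by rewrite ler_pM2l //; apply: le_trans ee _; rewrite ge_min lexx.
have placed e : 0 < e -> e <= eta0 ->
    with_high_probability P (fun N => [set w | well_placed H mu A k xi dl e w]).
  move=> e0 ee; apply: (well_placed_whp hH hA theta_inj htheta hk hxi dl0 dld0 ptsd _ e0).
    exact: sepE.
  exact: le_trans ee eta0d.
pose good N w (lam : forall i, 'I_(m i) -> 'I_(k i) -> R[i]) :=
  perm_eq (outliers N w) (label_list lam) /\
  forall i n l, cmod (lam i n l - xi i n) < eta0.
have goodP N w : well_placed H mu A k xi dl eta0 w -> exists lam, good N w lam.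
  move=> [h1 h2]; exact: (labelling_exists ptsd (sepE _ (lexx _)) eta0d h1 h2).
pose lam N w := if pselect (exists lam, good N w lam) is left h
  then projT1 (cid h) else fun _ _ _ => 0.
have lamP N w : well_placed H mu A k xi dl eta0 w -> good N w (lam N w).
  move=> /goodP h; rewrite /lam; case: pselect => // h'; exact: projT2 (cid h').
have whp0 := placed _ eta00 (lexx _).
split.
  apply: whpS whp0 => N w /= /lamP[pe _].
  by rewrite (perm_size pe) size_label_list.
exists lam; split; first by apply: whpS whp0 => N w /= /lamP[].
(* The labels chosen at the scale [eta0] serve every smaller scale [e1]: an outlier
   in the disc of radius [eta0] about [xi i n] that is within [e1] of some point
   can only be within [e1] of [xi i n], as the larger discs are disjoint. *)
move=> i n l e e0; pose e1 := Num.min e eta0.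
have e10 : 0 < e1 by rewrite lt_min e0.
have e1eta : e1 <= eta0 by rewrite ge_min lexx orbT.
apply: whpS (whpI whp0 (placed _ e10 e1eta)) => N w /= [/lamP[pe near] [inside _]].
have : lam N w i n l \in outliers N w.
  rewrite (perm_mem pe) -has_pred1 has_count count_label_list.
  rewrite (bigD1 i) //= (bigD1 n) //= (bigD1 l) //= eqxx.
  by [].
rewrite mem_filter => /andP[xS xin]; have [y yin xy] := inside _ xin xS.
have xiin : xi i n \in pts by apply/outlier_pointsP; exists i, n.
have [yE|yn] := eqVneq y (xi i n).
  by rewrite -yE; apply: lt_le_trans xy _; rewrite ge_min lexx.
have := sepE _ (lexx _) y _ yin xiin yn.
have := ler_cmod_dist (lam N w i n l) y (xi i n); rewrite (cmodB y (lam N w i n l)).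
have := near i n l; lra.
Qed.
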